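(* Let $\mathcal{H}$ be a real Hilbert space and let $f:\mathcal{H}\to\mathbb{R}\cup\{+\infty\}$ be a proper, convex, lower semicontinuous function with $\operatorname{argmin} f\neq\emptyset$. Assume $0<q<1$ and $\alpha,c,p>0$. For some starting points $x_0,x_1\in\mathcal{H}$ let $(x_k)$ be the sequence generated by $$x_{k+1}=\operatorname{prox}_{f}\left(x_k+\left(1-\frac{\alpha}{k^q}\right)(x_k-x_{k-1})-\frac{c}{k^p}x_k\right),\quad\text{for all }k\ge 1.$$ For every $k\ge 2$ let $u_k\in\partial f(x_k)$ be the element defined by $$x_k=\left(1-\frac{\alpha}{(k-1)^q}\right)(x_{k-1}-x_{k-2})-u_k+\left(1-\frac{c}{(k-1)^p}\right)x_{k-1}.$$ Then the following hold. (i) If $q+1<p\le 2$ and, in case $p=2$, additionally $c>q(1-q)$, then $(x_k)$ converges weakly to a minimizer of $f$. Further, $f(x_k)-\min_{\mathcal H} f=\mathcal{O}(k^{-q-1})$, $\|x_k-x_{k-1}\|=\mathcal{O}(k^{-\frac{q+1}{2}})$ and $\|u_k\|=o(k^{-\frac{q+1}{2}})$ as $k\to+\infty$. Moreover, $\sum_{k=2}^{+\infty}k^q(f(x_k)-\min_{\mathcal H} f)<+\infty$, $\sum_{k=1}^{+\infty}k\|x_k-x_{k-1}\|^2<+\infty$ and $\sum_{k=2}^{+\infty}k^{q+1}\|u_k\|^2<+\infty$. (ii) If $p=q+1$, then for all $s\in\left]\frac12,\frac{q+1}{2}\right[$ one has $f(x_k)-\min_{\mathcal H} f=o(k^{-2s})$,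 $\|x_k-x_{k-1}\|=o(k^{-s})$ and $\|u_k\|=o(k^{-s})$ as $k\to+\infty$. Further, $\sum_{k=2}^{+\infty}k^{2s-1}(f(x_k)-\min_{\mathcal H} f)<+\infty$, $\sum_{k=1}^{+\infty}k^{2s-q}\|x_k-x_{k-1}\|^2<+\infty$ and $\sum_{k=2}^{+\infty}k^{2s}\|u_k\|^2<+\infty$. (iii) If $1<p<q+1$, then $\lim_{k\to+\infty}\|x_k-x^*\|=0$, where $x^*$ is the minimal norm element of $\operatorname{argmin} f$. Further (still with $1<p<q+1$): - if $1<p\le 2q$, then $\|x_k-x_{k-1}\|^2=\mathcal{O}(k^{q-p-1})$, $\|u_k\|^2=\mathcal{O}(k^{q-p-1})$ and $f(x_k)-\min_{\mathcal H} f=\mathcal{O}(k^{-p})$ as $k\to+\infty$; - if $2q<p\le\frac{3q+1}{2}$, then $\|x_k-x_{k-1}\|^2=\mathcal{O}(k^{-q-1})$, $\|u_k\|^2=\mathcal{O}(k^{-q-1})$ and $f(x_k)-\min_{\mathcal H} f=\mathcal{O}(k^{-p})$ as $k\to+\infty$; - if $\frac{3q+1}{2}<p<q+1$, then $\|x_k-x_{k-1}\|^2=\mathcal{O}(k^{2p-4q-2})$ and $\|u_k\|^2=\mathcal{O}(k^{2p-4q-2})$ as $k\to+\infty$; additionally, if $\frac{3q+1}{2}<p<\frac{4q+2}{3}$ then $f(x_k)-\min_{\mathcal H} f=\mathcal{O}(k^{-p})$, and if $\frac{4q+2}{3}\le p<q+1$ then $f(x_k)-\min_{\mathcal H} f=\mathcal{O}(k^{2p-4q-2})$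 as $k\to+\infty$; - if $2q<p$, then $\sum_{k=2}^{+\infty}k^{2q}\|u_k\|^2<+\infty$ and $\sum_{k=1}^{+\infty}k^q\|x_{k+1}-x_k\|^2<+\infty$.
   Context: For $s>0$, $\operatorname{prox}_{sf}(x)=\operatorname{argmin}_{y\in\mathcal H}\left(f(y)+\frac{1}{2s}\|y-x\|^2\right)$. $\partial f$ is the convex subdifferential; since $\operatorname{prox}_f=(I+\partial f)^{-1}$, the vector $u_k$ defined by the stated equality indeed belongs to $\partial f(x_k)$. The minimal norm element of $\operatorname{argmin} f$ is the projection of $0$ onto this nonempty closed convex set. *)

(* Defs.v *)
From HB Require Import structures.
From mathcomp Require Import all_boot all_order all_algebra sesquilinear.
From mathcomp Require Import all_classical all_reals all_analysis.

Set Implicit Arguments.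
Unset Strict Implicit.
Unset Printing Implicit Defensive.

Import Order.TTheory GRing.Theory Num.Theory.
Import numFieldNormedType.Exports.

Local Open Scope classical_set_scope.
Local Open Scope ring_scope.

(* A real Hilbert space is a complete normed module H together with an inner
   product dot : {dot H for idfun} (bilinear, symmetric, positive definite)
   which induces the norm of H. *)
Definition induces_norm (R : realType) (H : normedModType R)
    (dot : {dot H for idfun}) : Prop :=
  forall x : H, dot x x = `|x| ^+ 2.

Definition weak_cvg (R : realType) (H : normedModType R)
    (dot : {dot H for idfun}) (x : nat -> H) (l : H) : Prop :=
  forall y : H, (fun k => dot (x k) y : R) @ \oo --> (dot l y : R).

Section convex_analysis.
Context {R : realType} {H : normedModType R}.
Implicit Types f : H -> \bar R.
Local Open Scope ereal_scope.

Definition proper_function f : Prop :=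
  (forall x, f x != -oo) /\ (exists x, f x < +oo).

(* The products rely on the library convention 0 * +oo = 0; when f never takes
   the value -oo, no indeterminate sum occurs. *)
Definition convex_efunction f : Prop :=
  forall (x y : H) (t : R), (0 <= t <= 1)%R ->
    f (t *: x + (1 - t) *: y)%R <= t%:E * f x + (1 - t)%:E * f y.

Definition argmin f : set H := [set x | forall y, f x <= f y].

(* When argmin f is nonempty the infimum is attained, so that this is
   f y - min f. *)
Definition min_gap f (y : H) : \bar R := f y - ereal_inf (range f).

(* For f proper, convex and lower semicontinuous on a Hilbert space and s > 0,
   the argmin below is a singleton, so the default value 0 is never used. *)
Definition prox (s : R) f (x : H) : H :=
  xget 0%R (argmin (fun y => f y + ((2 * s)^-1 * `|y - x| ^+ 2)%:E)).

Definition subdifferential (dot : {dot H for idfun}) f (x : H) : set H :=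
  [set u | f x \is a fin_num /\
           forall y, f x + (dot u (y - x)%R)%:E <= f y].

Definition min_norm (A : set H) : set H :=
  [set z | A z /\ forall y, A y -> (`|z| <= `|y|)%R].

End convex_analysis.

(* Main.v *)
(* Put d_k = x_k - x_(k-1) and W_k = f(x_k) - min f + |d_k|^2 / 2 + c / (2 k^p) |x_k|^2.
   The optimality condition of the proximal step says that
   u_(k+1) = (1 - alpha / k^q) d_k - d_(k+1) - (c / k^p) x_k is a subgradient at x_(k+1).
   Testing it against d_(k+1) makes W_k decrease by about (alpha / k^q) |d_k|^2; testing
   it against x_(k+1) - z bounds f(x_(k+1)) - f(z) by telescoping terms in <d_k, x_k - z>
   and |x_(k-1) - z|^2.

   For a minimizer z and r <= q + 1, r < p, the energy
     k^r W_k + b (k^(r-1) <d_k, x_k - z> + alpha k^(r-1-q) |x_(k-1) - z|^2 / 2)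
   with b large decreases up to summable errors, so a discrete Gronwall argument gives
   the rates and the sums of (i) with r = q + 1, of (ii) with r between 2 s and q + 1, and
   the sums of (iii) with r = 2 q. For (i), |x_k - z| then converges and Opial's argument
   applies.

   For (iii), z is replaced by the minimizer y_k of f + c / (2 k^p) |.|^2, which tends
   strongly to the minimal norm solution and moves by O(1 / k). Strong convexity of
   f + c / (2 k^p) |.|^2 turns the same computation, now unweighted and with b small, into
     (1 + kappa k^-om) V_(k+1) <= V_k + O(k^(-th-om))  with om < 1,
   hence V_k = O(k^-th), for om = max(q, p - q) and the exponents th of the theorem. *)

Require Import Defs.
From HB Require Import structures.
From mathcomp Require Import all_boot all_order all_algebra sesquilinear.
From mathcomp Require Import all_classical all_reals all_analysis.
From mathcomp Require Import ring lra.
Import Order.TTheory GRing.Theory Num.Theory.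
Import numFieldNormedType.Exports.

Set Implicit Arguments.
Unset Strict Implicit.
Unset Printing Implicit Defensive.

Local Open Scope classical_set_scope.
Local Open Scope ring_scope.

(** * Powers of the index and summability *)

Section powers.
Context {R : realType}.
Implicit Types (r s h : R) (k n : nat).

(** Two effects compete in the weighted energy. The growth of k^r costs O(k^(r-1)) W_k, and only the
    correlation term, whose increment contains - b k^(r-1) times the gap, can pay for it: this is
    why b must exceed the growth constant of k^r. The kinetic errors created in return are O(k^(r-1)
    |d|^2), and the damping, of order k^(r-q) |d|^2, absorbs them for large k whatever b is, because
    q < 1. The bound r <= q + 1 keeps the anchor weight k^(r-1-q) from increasing, and r < p makes
    the cost k^(r-1-p) |z|^2 of the Tikhonov term at z summable. With the moving target nothing
    grows, but a contraction of order k^-om is wanted, so the correlation gets the weight k^-q. Its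
    kinetic errors then have exactly the order of the damping, and b has to be small. The Tikhonov
    term is taken at x_k and the subgradient at x_(k+1); the mismatch, of order k^-p |d_(k+1)|^2, is
    absorbed by the damping since q < 1 < p. The smallness conditions hold only for large k, hence
    the eventual hypotheses in the recurrences and sums. *)

Lemma expr_1D_le n h : 0 <= h <= 1 -> (1 + h) ^+ n <= 1 + 2 ^+ n * h.
Proof.
(* The coefficient 2^n - 1 is the exact one at h = 1 and makes the induction close. *)
move=> /andP[h0 h1]; suff : (1 + h) ^+ n <= 1 + (2 ^+ n - 1) * h by lra.
elim: n => [|n ih]; first by rewrite !expr0; lra.
rewrite !exprS; have n1 : 1 <= 2 ^+ n :> R by rewrite exprn_ege1 // ler1n.
have := ler_wpM2l (addr_ge0 ler01 h0) ih.
have : 0 <= (2 ^+ n - 1) * (h * (1 - h)) by rewrite !mulr_ge0 ?subr_ge0.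
lra.
Qed.

(** Derivatives are avoided: for an integer n >= |r| the power lies between X^-1 and X with X = (1 +
    h)^n, and X^-1 >= 2 - X because (X - 1)^2 >= 0. *)
Lemma powR_1D_sub r : exists2 C : R, 0 <= C &
  forall h, 0 <= h <= 1 -> `|(1 + h) `^ r - 1| <= C * h.
Proof.
pose n := Num.bound `|r|.
have rn : `|r| <= n%:R by apply/ltW/archi_boundP.
exists (2 ^+ n); first by rewrite exprn_ge0.
move=> h /andP[h0 h1]; have h11 : 1 <= 1 + h by lra.
have up : (1 + h) ^+ n <= 1 + 2 ^+ n * h by apply: expr_1D_le; rewrite h0 h1.
have X1 : 1 <= (1 + h) ^+ n by rewrite exprn_ege1.
have rU : (1 + h) `^ r <= (1 + h) ^+ n.
  by rewrite -powR_mulrn ?ler_powR ?(le_trans _ h11) // (le_trans _ rn) // ler_norm.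
have rL : ((1 + h) ^+ n)^-1 <= (1 + h) `^ r.
  rewrite -powR_mulrn ?(le_trans _ h11) // -powRN ler_powR //.
  by rewrite lerNl (le_trans _ rn) // -normrN ler_norm.
have : 2 - (1 + h) ^+ n <= ((1 + h) ^+ n)^-1.
  have X0 : 0 < (1 + h) ^+ n by rewrite (lt_le_trans _ X1).
  rewrite -(ler_pM2r X0) mulVf ?gt_eqF //.
  have := sqr_ge0 ((1 + h) ^+ n - 1); rewrite expr2; lra.
by move=> *; rewrite ler_norml; apply/andP; split; lra.
Qed.

Lemma powR_le_l r (x y : R) : 0 <= r -> 0 <= x -> x <= y -> x `^ r <= y `^ r.
Proof.
move=> r0 x0 xy; have := @ge0_ler_powR R r r0 x y; rewrite !nnegrE.
by apply=> //; exact: le_trans xy.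
Qed.

(* (1 + c h)^(1/s) <= (1 + c h)^n <= 1 + h for c = 2^-n and n >= 1/s. *)
Lemma powR_1D_ge s : 0 < s -> exists2 c : R, 0 < c <= 1 &
  forall h, 0 <= h <= 1 -> 1 + c * h <= (1 + h) `^ s.
Proof.
move=> s0; pose n := Num.bound s^-1.
have sn : s^-1 <= n%:R by apply/ltW/archi_boundP; rewrite invr_ge0 ltW.
have n2 : 1 <= 2 ^+ n :> R by rewrite exprn_ege1 // ler1n.
have n0 : 0 < 2 ^+ n :> R by rewrite (lt_le_trans _ n2).
exists (2 ^+ n)^-1; first by rewrite invr_gt0 n0 invf_le1.
move=> h /andP[h0 h1].
have ch0 : 0 <= (2 ^+ n)^-1 * h by rewrite mulr_ge0 // invr_ge0 ltW.
have ch1 : (2 ^+ n)^-1 * h <= 1 by rewrite ler_pdivrMl // mulr1 (le_trans h1).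
have nh : 2 ^+ n * ((2 ^+ n)^-1 * h) = h by rewrite mulrA mulfV ?mul1r // gt_eqF.
move: ((2 ^+ n)^-1 * h) ch0 ch1 nh => c ch0 ch1 nh.
have -> : 1 + c = ((1 + c) `^ s^-1) `^ s.
  by rewrite -powRrM mulVf ?gt_eqF // powRr1 // addr_ge0.
apply: powR_le_l; [exact: ltW|exact: powR_ge0|].
apply: (@le_trans _ _ ((1 + c) ^+ n)).
  by rewrite -powR_mulrn ?addr_ge0 //; apply: ler_powR => //; lra.
by rewrite -nh; apply: (expr_1D_le n); rewrite ch0.
Qed.

Definition pw r k : R := k%:R `^ r.

Lemma pw_gt0 r k : (0 < k)%N -> 0 < pw r k.
Proof. by move=> k0; rewrite powR_gt0 // ltr0n. Qed.

Lemma pw_ge0 r k : 0 <= pw r k. Proof. exact: powR_ge0. Qed.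

Lemma pwD r s k : (0 < k)%N -> pw (r + s) k = pw r k * pw s k.
Proof. by move=> k0; rewrite /pw powRD // pnatr_eq0 -lt0n k0 implybT. Qed.

Lemma pw0 k : pw 0 k = 1. Proof. exact: powRr0. Qed.

Lemma pw1 k : pw 1 k = k%:R. Proof. by rewrite /pw powRr1. Qed.

Lemma pwN r k : pw (- r) k = (pw r k)^-1. Proof. exact: powRN. Qed.

Lemma pw_le r s k : (0 < k)%N -> r <= s -> pw r k <= pw s k.
Proof. by move=> k0 rs; rewrite /pw ler_powR // ler1n. Qed.

Lemma pwX2 r k : pw (2 * r) k = pw r k ^+ 2.
Proof. by rewrite /pw -powR_mulrn ?powR_ge0 // -powRrM mulrC. Qed.

Lemma pw_anti r k : r <= 0 -> (0 < k)%N -> pw r k.+1 <= pw r k.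
Proof.
move=> r0 k0; rewrite -[r]opprK (pwN (- r)) (pwN (- r) k).
rewrite lef_pV2 ?posrE ?pw_gt0 // /pw; apply: powR_le_l; rewrite ?oppr_ge0 //.
by rewrite ler_nat.
Qed.

Lemma pw_mono r k n : 0 <= r -> (k <= n)%N -> pw r k <= pw r n.
Proof. by move=> r0 kn; rewrite /pw; apply: powR_le_l; rewrite ?ler_nat. Qed.

Lemma pw_succ r k : (0 < k)%N -> pw r k.+1 = pw r k * (1 + k%:R^-1) `^ r.
Proof.
move=> k0; rewrite /pw -powRM ?ler0n // ?addr_ge0 ?invr_ge0 //.
by congr powR; rewrite mulrDr mulr1 mulfV ?pnatr_eq0 -?lt0n // -natr1.
Qed.

(** The discrete counterpart of the derivative r k^(r-1) of k^r, from [powR_1D_sub] at h = 1 / k. *)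
Lemma pw_diff r : exists2 C : R, 0 <= C &
  forall k, (0 < k)%N -> `|pw r k.+1 - pw r k| <= C * pw (r - 1) k.
Proof.
have [C C0 HC] := powR_1D_sub r; exists C => // k k0.
rewrite pw_succ // -{2}[pw r k]mulr1 -mulrBr normrM (ger0_norm (pw_ge0 _ _)).
rewrite pwD // (pwN 1) pw1 mulrCA ler_wpM2l ?pw_ge0 // HC //.
by rewrite invr_ge0 ler0n invf_le1 ?ltr0n // ler1n.
Qed.

Lemma pw_succ_le r : exists2 C : R, 1 <= C &
  forall k, (0 < k)%N -> pw r k.+1 <= C * pw r k /\ pw r k <= C * pw r k.+1.
Proof.
have suff_one (s : R) : exists2 C : R, 0 <= C &
    forall k, (0 < k)%N -> pw s k.+1 <= C * pw s k.
  have [C C0 HC] := pw_diff s; exists (1 + C); first by rewrite addr_ge0.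
  move=> k k0; have := HC _ k0; have := ler_norm (pw s k.+1 - pw s k).
  have : pw (s - 1) k <= pw s k by apply: pw_le => //; lra.
  by move=> /(ler_wpM2l C0) *; lra.
have [C1 C10 H1] := suff_one r; have [C2 C20 H2] := suff_one (- r).
exists (1 + C1 + C2); first by lra.
move=> k k0; split.
  by apply: (le_trans (H1 k k0)); rewrite ler_wpM2r ?pw_ge0 //; lra.
have := H2 k k0; rewrite !pwN ler_pdivlMr ?pw_gt0 // => H.
have : (pw r k.+1)^-1 * pw r k <= 1 + C1 + C2 by lra.
by rewrite mulrC ler_pdivrMr ?pw_gt0.
Qed.

Lemma pw_small r s (e : R) : r < s -> 0 < e -> \forall k \near \oo, pw r k <= e * pw s k.
Proof.
move=> rs e0; near=> k.
have k0 : (0 < k)%N by near: k; exact: nbhs_infty_gt.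
have -> : s = (s - r) + r by lra.
rewrite pwD // mulrA -[leLHS]mul1r ler_wpM2r ?pw_ge0 //.
have sr : 0 < s - r by lra.
have : (e^-1) `^ ((s - r)^-1) <= k%:R by near: k; exact: nbhs_infty_ger.
move=> H; rewrite -ler_pdivrMl // mulr1.
have -> : e^-1 = (e^-1 `^ (s - r)^-1) `^ (s - r).
  by rewrite -powRrM mulVf ?gt_eqF // powRr1 // invr_ge0 ltW.
by apply: powR_le_l; rewrite ?powR_ge0 // ltW.
Unshelve. all: by end_near. Qed.

End powers.

Arguments pw : simpl never.

Lemma near_ge (P : nat -> Prop) : (\forall k \near \oo, P k) ->
  exists N, forall n, (N <= n)%N -> P n.
Proof. by move=> [N _ HN]; exists N. Qed.

Lemma near_succ (P : nat -> Prop) : (\forall k \near \oo, P k) ->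
  \forall k \near \oo, P k.+1.
Proof. by move=> [N _ HN]; exists N => // n Nn; apply: HN; exact: leqW. Qed.

Section sums.
Context {R : realType}.
Implicit Types (a b : nat -> R) (k n : nat).

(* Used for eventually nonnegative sequences, where it means summability. *)
Definition bsum a := exists M, forall n, series a n <= M.

Lemma bsum_near a b : (\forall k \near \oo, a k <= b k) -> bsum b -> bsum a.
Proof.
move=> [N _ HN] [M HM].
pose B := \sum_(0 <= k < N) `|b k| + \sum_(0 <= k < N) `|a k|.
have B0 : 0 <= M + B.
  have /le_trans -> // : 0 <= M by have := HM 0%N; rewrite /series /= big_geq.
  by rewrite lerDl addr_ge0 // sumr_ge0.
have aux n : (n <= N)%N -> series a n <= \sum_(0 <= k < N) `|a k|.
  move=> nN; rewrite /series /= (big_cat_nat (leq0n _) nN) //=.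
  by rewrite -[leLHS]addr0 lerD ?sumr_ge0 // ler_sum // => i _; rewrite ler_norm.
exists (M + B) => n; case: (leqP n N) => [nN|/ltnW nN].
  apply: (le_trans (aux _ nN)).
  have : 0 <= M by have := HM 0%N; rewrite /series /= big_geq.
  have : 0 <= \sum_(0 <= k < N) `|b k| by rewrite sumr_ge0.
  by rewrite /B => *; lra.
have := HM n; rewrite /series /= !(big_cat_nat (leq0n _) nN) //=.
have := aux N (leqnn _); rewrite /series /=.
have : \sum_(N <= i < n) a i <= \sum_(N <= i < n) b i.
  by rewrite !big_nat ler_sum // => i /andP[Ni _]; apply: HN.
have : - (\sum_(0 <= k < N) b k) <= \sum_(0 <= k < N) `|b k|.
  by rewrite -sumrN ler_sum // => i _; rewrite -normrN ler_norm.
by rewrite /B => *; lra.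
Qed.

Lemma bsumD a b : bsum a -> bsum b -> bsum (fun k => a k + b k).
Proof.
move=> [M HM] [N HN]; exists (M + N) => n.
by rewrite /series /= big_split lerD ?HM ?HN.
Qed.

Lemma bsumZ (c : R) a : 0 <= c -> bsum a -> bsum (fun k => c * a k).
Proof.
move=> c0 [M HM]; exists (c * M) => n.
by rewrite /series /= -mulr_sumr ler_wpM2l ?HM.
Qed.

Lemma bsumS a : bsum a -> bsum (fun k => a k.+1).
Proof.
move=> [M HM]; exists (M - a 0%N) => n; have := HM n.+1.
by rewrite /series /= big_nat_recl //= lerBrDr addrC.
Qed.

Lemma bsumS_inv a : bsum (fun k => a k.+1) -> bsum a.
Proof.
move=> [M HM]; exists (Num.max 0 (M + a 0%N)) => -[|n].
  by rewrite /series /= big_geq // le_max lexx.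
rewrite /series /= big_nat_recl //= le_max; apply/orP; right.
by rewrite addrC lerD2r; exact: HM.
Qed.

Lemma bsum_cvg a : bsum a -> (\forall k \near \oo, 0 <= a k) -> cvgn (series a).
Proof.
move=> [M HM] [N _ HN]; apply: (@near_nondecreasing_is_cvgn _ _ M).
- exists N => // n Nn m nm; rewrite /series /= (big_cat_nat (leq0n _) nm) //=.
  rewrite lerDl big_nat sumr_ge0 // => i /andP[ni _]; apply: HN.
  exact: leq_trans Nn ni.
- by exists 0%N => // n _; exact: HM.
Qed.

Lemma bsum_cvg0 a : bsum a -> (\forall k \near \oo, 0 <= a k) -> a @ \oo --> 0.
Proof. by move=> ba a0; apply/cvg_series_cvg_0/bsum_cvg. Qed.

(** With r = - s - 1, the power k^r is at most a constant times the telescoping difference k^-s -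
    (k+1)^-s; [powR_1D_ge] bounds that difference from below. *)
Lemma bsum_pw (r : R) : r < -1 -> bsum (pw r).
Proof.
move=> r1; have [s sE] : exists s, r = - s - 1 by exists (- r - 1); lra.
have s0 : 0 < s by lra.
have [c /andP[c0 c1] low] := powR_1D_ge s0.
have [C C1 HC] := pw_succ_le r.
pose b k := pw (- s) k - pw (- s) k.+1.
apply: (@bsum_near _ (fun k => C * c^-1 * b k)).
  near=> k; have k0 : (0 < k)%N by near: k; exact: nbhs_infty_gt.
  rewrite -mulrA -ler_pdivrMl ?(lt_le_trans _ C1) //.
  apply: (@le_trans _ _ (pw r k.+1)).
    by rewrite ler_pdivrMl ?(lt_le_trans _ C1) // (HC k k0).2.
  rewrite ler_pdivlMl // /b !pwN (pw_succ s) //.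
  have kr0 : 0 < k%:R :> R by rewrite ltr0n.
  have h01 : 0 <= (k%:R^-1 : R) <= 1 by rewrite invr_ge0 ltW //= invf_le1 // ler1n.
  have L := low _ h01; set X := (1 + k%:R^-1) `^ s in L *.
  have P0 := pw_gt0 s k0; set P := pw s k in P0 *.
  have X0 : 0 < X.
    by rewrite (lt_le_trans _ L) // addr_gt0 // mulr_gt0 // invr_gt0.
  have -> : P^-1 - (P * X)^-1 = (P * X)^-1 * (X - 1) by field; rewrite !gt_eqF.
  have -> : pw r k.+1 = (P * X)^-1 * (k.+1%:R)^-1.
    by rewrite sE pwD // (pwN s) (pwN 1) pw1 (pw_succ s).
  have PX0 : 0 <= (P * X)^-1 by rewrite invr_ge0 ltW // mulr_gt0.
  rewrite mulrCA ler_wpM2l //.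
  apply: (@le_trans _ _ (c * k%:R^-1)); last by rewrite lerBrDl.
  by rewrite ler_wpM2l ?(ltW c0) // lef_pV2 ?posrE ?ltr0n // ler_nat.
exists (C * c^-1 * pw (- s) 0) => m; rewrite /series /=.
have C0 : 0 <= C * c^-1 by rewrite mulr_ge0 ?invr_ge0 ?(ltW c0) // (le_trans _ C1).
rewrite -mulr_sumr ler_wpM2l // /b.
under eq_bigr do rewrite -opprB.
rewrite sumrN telescope_sumr // opprB lerBlDr lerDl; exact: pw_ge0.
Unshelve. all: by end_near. Qed.

Lemma bsum_nneseries m (e : nat -> \bar R) a : bsum a ->
  (forall k, (m <= k)%N -> e k = (a k)%:E) -> (forall k, (m <= k)%N -> 0 <= a k) ->
  (\sum_(m <= k <oo) e k < +oo)%E.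
Proof.
move=> [M HM] ea a0.
have e0 k : (m <= k)%N -> true -> (0 <= e k)%E by move=> mk _; rewrite ea // lee_fin a0.
pose B := M + \sum_(0 <= k < m) `|a k|.
have M0 : 0 <= M by have := HM 0%N; rewrite /series /= big_geq.
apply: (@le_lt_trans _ _ B%:E); last by rewrite ltry.
apply: lime_le; first exact: is_cvg_nneseries.
near=> n; have mn : (m <= n)%N by near: n; exact: nbhs_infty_ge.
rewrite big_nat (eq_bigr (fun k => (a k)%:E)); last by move=> k /andP[mk _]; exact: ea.
rewrite -big_nat sumEFin lee_fin /B; have := HM n; rewrite /series /= (big_cat_nat (leq0n _) mn) //=.
have : - (\sum_(0 <= k < m) a k) <= \sum_(0 <= k < m) `|a k|.
  by rewrite -sumrN ler_sum // => i _; rewrite -normrN ler_norm.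
by move=> *; lra.
Unshelve. all: by end_near. Qed.

End sums.

(** * Recursive inequalities *)

Section recurrences.
Context {R : realType}.
Implicit Types (E G Y eta zeta : nat -> R) (k n : nat).

(** The inequality 1 + t <= exp t turns the product of the growth factors into an exponential of a
    bounded sum, so E is bounded by some M. Then eta E <= M eta is summable, and telescoping E
    bounds the sum of G. *)
Lemma gronwall E G eta zeta : bsum eta -> bsum zeta ->
  (\forall k \near \oo, 0 <= E k) -> (\forall k \near \oo, 0 <= G k) ->
  (\forall k \near \oo, 0 <= eta k) -> (\forall k \near \oo, 0 <= zeta k) ->
  (\forall k \near \oo, E k.+1 + G k <= (1 + eta k) * E k + zeta k) ->
  (exists2 M, 0 <= M & \forall k \near \oo, E k <= M) /\ bsum G.
Proof.
move=> beta bzeta E0 G0 eta0 zeta0 EG.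
have [Me HMe] := beta; have [Mz HMz] := bzeta.
have [M M0 EM] : exists2 M, 0 <= M & \forall k \near \oo, E k <= M.
  have [N HN] : exists N, forall n, (N <= n)%N ->
      [/\ 0 <= E n, 0 <= G n, 0 <= eta n, 0 <= zeta n &
      E n.+1 + G n <= (1 + eta n) * E n + zeta n].
    by apply: near_ge; near=> n; split; near: n.
  pose S n := \sum_(N <= j < n) eta j; pose Z n := \sum_(N <= j < n) zeta j.
  have S0 n : 0 <= S n.
    by rewrite /S big_nat sumr_ge0 // => i /andP[/HN[]].
  have Z0 n : 0 <= Z n.
    by rewrite /Z big_nat sumr_ge0 // => i /andP[/HN[]].
  have claim n : (N <= n)%N -> E n <= expR (S n) * (E N + Z n).
    elim: n => [|n ih].
      by rewrite leqn0 => /eqP N0; rewrite /S /Z N0 !big_geq // expR0 mul1r addr0.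
    rewrite leq_eqVlt => /predU1P[<-|]; first by rewrite /S /Z !big_geq // expR0 mul1r addr0.
    rewrite ltnS => Nn; have [En Gn etan zetan H] := HN _ Nn.
    rewrite /S /Z !big_nat_recr //= -/(S n) -/(Z n) expRD.
    have e1 : 1 + eta n <= expR (eta n) by exact: expR_ge1Dx.
    have eS : 1 <= expR (S n) by rewrite -expR0 ler_expR.
    have [EN _ _ _ _] := HN _ (leqnn N).
    have A : (1 + eta n) * E n <= expR (eta n) * (expR (S n) * (E N + Z n)).
      by apply: ler_pM => //; [rewrite addr_ge0 | exact: ih].
    have B : zeta n <= expR (eta n) * (expR (S n) * zeta n).
      rewrite mulrA ler_peMl // -[leLHS]mulr1 ler_pM //.
      by rewrite (le_trans _ e1) // lerDl.
    by lra.
  pose Be := Me + \sum_(0 <= j < N) `|eta j|.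
  pose Bz := Mz + \sum_(0 <= j < N) `|zeta j|.
  have tail (a : nat -> R) M n : (forall n, series a n <= M) -> (N <= n)%N ->
      \sum_(N <= j < n) a j <= M + \sum_(0 <= j < N) `|a j|.
    move=> /(_ n) + Nn; rewrite /series /= (big_cat_nat (leq0n _) Nn) //=.
    have : - (\sum_(0 <= k < N) a k) <= \sum_(0 <= k < N) `|a k|.
      by rewrite -sumrN ler_sum // => i _; rewrite -normrN ler_norm.
    by move=> *; lra.
  have [EN _ _ _ _] := HN _ (leqnn N).
  exists (expR Be * (E N + Bz)).
    rewrite mulr_ge0 ?expR_ge0 // addr_ge0 //.
    by apply: le_trans (tail _ _ N HMz (leqnn N)); exact: Z0.
  exists N => // n Nn; apply: (le_trans (claim n Nn)).
  apply: ler_pM; rewrite ?expR_ge0 ?addr_ge0 //.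
    by rewrite ler_expR; exact: tail.
  by rewrite lerD2l; exact: tail.
split; first by exists M.
(* E is nonnegative only eventually, whereas the telescoped sum has to be bounded for every n;
   truncation at 0 supplies the lower bound. *)
pose E' k := Num.max 0 (E k).
apply: (@bsum_near _ _ (fun k => (E' k - E' k.+1) + (M * eta k + zeta k))).
  near=> k.
  have e0 : 0 <= E k by near: k.
  have e1 : 0 <= E k.+1.
    by near: k; exact: (near_succ E0).
  rewrite /E' !max_r //.
  have : E k.+1 + G k <= (1 + eta k) * E k + zeta k by near: k.
  have : eta k * E k <= eta k * M by rewrite ler_wpM2l //; near: k.
  by move=> *; lra.
apply: bsumD; last by apply: bsumD => //; exact: bsumZ.
exists (E' 0%N) => n; rewrite /series /=.
under eq_bigr do rewrite -opprB.
by rewrite sumrN telescope_sumr // opprB lerBlDr lerDl /E' le_max lexx.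
Unshelve. all: by end_near. Qed.

(** Subtracting the partial sums of zeta leaves an eventually nonincreasing sequence that is bounded
    below. *)
Lemma quasi_decreasing_cvg Y zeta (m : R) : bsum zeta ->
  (\forall k \near \oo, 0 <= zeta k) -> (\forall k \near \oo, m <= Y k) ->
  (\forall k \near \oo, Y k.+1 <= Y k + zeta k) -> cvgn Y.
Proof.
move=> bz z0 mY HY.
have cz := bsum_cvg bz z0; have [Mz HMz] := bz.
have cX : cvgn (fun k => Y k - series zeta k).
  apply: (@near_nonincreasing_is_cvgn _ _ (m - Mz)); last first.
    near=> k; have : m <= Y k by near: k.
    by have := HMz k; lra.
  move: HY => [N _ HN]; exists N => // n /= Nn k nk.
  elim: k nk => [|k ih]; first by rewrite leqn0 => /eqP ->.
  rewrite leq_eqVlt => /predU1P[<-//|]; rewrite ltnS => nk.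
  apply: le_trans (ih nk); have := HN k (leq_trans Nn nk).
  by rewrite seriesSr /=; lra.
have -> : Y = (fun k => Y k - series zeta k) + series zeta.
  by apply/funext => k; rewrite fctE subrK.
exact: is_cvgD.
Unshelve. all: by end_near. Qed.

(** Induction on V_k <= M k^-th. Half of the contraction kap k^-om absorbs the source once M is
    large; the other half covers the passage from k^-th to (k+1)^-th, whose relative cost O(1 / k)
    is small against k^-om since om < 1. *)
Lemma powR_decay (V : nat -> R) (kap C om th : R) : 0 < kap -> 0 <= om -> om < 1 ->
  (\forall k \near \oo, 0 <= V k) ->
  (\forall k \near \oo, V k.+1 + kap * pw (- om) k * V k.+1 <=
     V k + C * pw (- th - om) k) ->
  exists M, \forall k \near \oo, V k <= M * pw (- th) k.
Proof.
move=> kap0 om0 om1 V0 HV.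
have [C1 C10 HC1] := pw_diff (- th) (R := R).
(* With 1 / k <= e k^-om, the relative loss of k^-th costs at most (1 + kap) C1 e k^-om <= kap k^-om
   / 2. *)
pose e := kap / (2 * (C1 + 1) * (1 + kap)).
have e0 : 0 < e by rewrite divr_gt0 // !mulr_gt0 //; lra.
have eE : e * (2 * (C1 + 1) * (1 + kap)) = kap.
  by rewrite /e mulfVK // gt_eqF // !mulr_gt0 //; lra.
move: e e0 eE => e e0 eE.
have [N HN] : exists N, forall n, (N <= n)%N -> [/\ (0 < n)%N, 0 <= V n.+1,
   V n.+1 + kap * pw (- om) n * V n.+1 <= V n + C * pw (- th - om) n &
   pw (-1) n <= e * pw (- om) n].
  apply: near_ge; near=> n; split; near: n.
  - exact: nbhs_infty_gt.
  - exact: (near_succ V0).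
  - exact: HV.
  - by apply: pw_small => //; lra.
have N0 : (0 < N)%N by have [] := HN _ (leqnn _).
(* The first entry starts the induction at N, the second gives 2 C <= M kap. *)
pose M := Num.max (V N / pw (- th) N) (2 * `|C| / kap).
have M0 : 0 <= M by rewrite le_max orbC divr_ge0 ?(ltW kap0) // mulr_ge0.
have MC : 2 * C <= M * kap.
  rewrite -ler_pdivrMr // le_max; apply/orP; right.
  by rewrite ler_pM2r ?invr_gt0 // ler_pM2l // ler_norm.
exists M; exists N => //; elim=> [|n ih] /=.
  by rewrite leqn0 => /eqP E; move: N0; rewrite E.
rewrite leq_eqVlt => /predU1P[<-|].
  by rewrite -ler_pdivrMr ?pw_gt0 // le_max lexx.
rewrite ltnS => Nn; have [n0 Vn H pe] := HN _ Nn; have {ih} := ih Nn => /= ih.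
have w0 : 0 < pw (- om) n :> R by exact: pw_gt0.
have w1 : pw (- om) n <= 1 :> R by rewrite -(pw0 n) pw_le //; lra.
have p0 : 0 < pw (- th) n :> R by exact: pw_gt0.
have := HC1 _ n0; rewrite ler_norml => /andP[+ _].
move: H; rewrite !pwD // => H low.
move: (pw (- om) n) (pw (- th) n) (pw (- th) n.+1) (pw (-1) n) pe w0 w1 p0 low H ih
  => w p p' t pe w0 w1 p0 low H ih.
rewrite -(@ler_pM2l _ (1 + kap * w)); last by rewrite addr_gt0 // mulr_gt0.
have kw : 0 <= kap * w by rewrite mulr_ge0 // ltW.
have kw1 : kap * w <= kap by rewrite ler_piMr // ltW.
apply: (@le_trans _ _ (M * (p * (1 + kap * w / 2)))).
  have : 0 <= (M * kap - 2 * C) * (p * w) by rewrite mulr_ge0 ?subr_ge0 // mulr_ge0 ?ltW.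
  by lra.
rewrite [leRHS]mulrCA ler_wpM2l //.
have Ct : C1 * (p * t) <= C1 * (p * (e * w)).
  by rewrite ler_wpM2l // ler_wpM2l // ltW.
have ew0 : 0 <= p * (e * w) by rewrite ltW // !mulr_gt0.
have : (1 + kap * w) * (p - C1 * (p * (e * w))) <= (1 + kap * w) * p'.
  by apply: ler_wpM2l; lra.
have : (1 + kap * w) * (C1 * (p * (e * w))) <= (1 + kap) * (C1 * (p * (e * w))).
  by rewrite ler_wpM2r ?mulr_ge0 //; lra.
have : (1 + kap) * ((C1 + 1) * (p * (e * w))) = p * kap * w / 2.
  by rewrite -[in RHS]eE; field.
have : 0 <= (1 + kap) * (p * (e * w)) by rewrite mulr_ge0 //; lra.
by lra.
Unshelve. all: by end_near. Qed.

End recurrences.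

(** * Inner products and minimization in Hilbert spaces *)

Section dot_product.
Context {R : realType} {H : normedModType R} (dot : {dot H for idfun}).
Hypothesis hdot : induces_norm dot.
Implicit Types (x y z : H) (a b c : R).

Lemma dotC x y : dot x y = dot y x. Proof. by rewrite hermC expr0 mul1r. Qed.
Lemma dotDl x y z : dot (x + y) z = dot x z + dot y z. Proof. exact: linearDl. Qed.
Lemma dotDr x y z : dot z (x + y) = dot z x + dot z y. Proof. exact: linearDr. Qed.
Lemma dotNl x z : dot (- x) z = - dot x z. Proof. exact: linearNl. Qed.
Lemma dotNr x z : dot z (- x) = - dot z x. Proof. exact: linearNr. Qed.
Lemma dotZl a x z : dot (a *: x) z = a * dot x z. Proof. exact: linearZl_LR. Qed.
Lemma dotZr a x z : dot z (a *: x) = a * dot z x. Proof. exact: linearZr_LR. Qed.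
Lemma dot0l z : dot 0 z = 0. Proof. exact: linear0l. Qed.
Lemma dot0r z : dot z 0 = 0. Proof. exact: linear0r. Qed.

Definition dotE := (dotDl, dotDr, dotNl, dotNr, dotZl, dotZr, dot0l, dot0r).

Lemma dot_ge0 x : 0 <= dot x x. Proof. by rewrite hdot sqr_ge0. Qed.

Lemma dot_eq0 x : dot x x = 0 -> x = 0.
Proof. by rewrite hdot => /eqP; rewrite sqrf_eq0 normr_eq0 => /eqP. Qed.

(** Expansion of |a x - c y|^2 >= 0. The weights are tied by c^2 <= a b instead of a quotient, so
    that a = 0 is allowed (it forces c = 0) and powers of k can be matched by adding exponents. *)
Lemma dot_young a b c x y : 0 <= a -> 0 <= b -> c ^+ 2 <= a * b ->
  2 * c * dot x y <= a * dot x x + b * dot y y.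
Proof.
move=> a0 b0 cab; have X0 := dot_ge0 x; have Y0 := dot_ge0 y.
have [a_eq0|a_neq0] := eqVneq a 0.
  have -> : c = 0.
    by apply/eqP; rewrite -sqrf_eq0 eq_le sqr_ge0 andbT (le_trans cab) // a_eq0 mul0r.
  by rewrite mulr0 mul0r addr_ge0 // mulr_ge0.
have a_gt0 : 0 < a by rewrite lt_neqAle eq_sym a_neq0.
rewrite -subr_ge0 -(pmulr_rge0 _ a_gt0).
have := dot_ge0 (a *: x - c *: y); rewrite !dotE (dotC y x).
have : 0 <= (a * b - c ^+ 2) * dot y y by rewrite mulr_ge0 // subr_ge0.
by rewrite expr2; lra.
Qed.

Lemma dot_young_norm a b c x y : 0 <= a -> 0 <= b -> c ^+ 2 <= a * b ->
  2 * c * `|dot x y| <= a * dot x x + b * dot y y.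
Proof.
move=> a0 b0 cab; case: (ger0P (dot x y)) => _; first exact: dot_young.
by rewrite mulrN -mulNr -mulrN; apply: dot_young; rewrite ?sqrrN.
Qed.

Lemma dot_scaled_le a b s t x y : 0 <= a -> 0 <= b -> `|s| <= t -> t ^+ 2 <= a * b ->
  s * dot x y <= (a * dot x x + b * dot y y) / 2.
Proof.
move=> a0 b0 st tab; apply: (le_trans (ler_norm _)); rewrite normrM.
apply: (le_trans (ler_wpM2r (normr_ge0 _) st)).
by have := dot_young_norm x y a0 b0 tab; lra.
Qed.

Lemma dot_le_norm x y : `|dot x y| <= `|x| * `|y|.
Proof.
have aux u v : dot u v <= `|u| * `|v|.
  have [->|u0] := eqVneq u 0; first by rewrite dot0l normr0 mul0r.
  have [->|v0] := eqVneq v 0; first by rewrite dot0r normr0 mulr0.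
  have uv0 : 0 < 2 * (`|u| * `|v|) by rewrite !mulr_gt0 // normr_gt0.
  rewrite -(ler_pM2l uv0).
  apply: (le_trans (@dot_young (`|v| ^+ 2) (`|u| ^+ 2) _ u v _ _ _)).
  - exact: sqr_ge0.
  - exact: sqr_ge0.
  - by rewrite exprMn mulrC.
  - by rewrite !hdot !expr2; lra.
by rewrite ler_norml aux andbT lerNl -dotNl (le_trans (aux _ _)) // normrN.
Qed.

Lemma dot_sum_le x y : dot (x + y) (x + y) <= 2 * dot x x + 2 * dot y y.
Proof.
by have := dot_ge0 (x - y); rewrite !dotE (dotC y x); lra.
Qed.

End dot_product.

Section lower_semicontinuity.
Context {R : realType} {H : normedModType R}.
Implicit Types (f G : H -> \bar R) (h : H -> R).

Lemma lsc_add_continuous f h : (forall x, f x != -oo%E) ->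
  lower_semicontinuous f -> continuous h ->
  lower_semicontinuous (fun x => f x + (h x)%:E)%E.
Proof.
move=> fNy flsc hc x a afh.
have [b [ab bf]] : exists b : R, a - h x < b /\ (b%:E < f x)%E.
  move: (fNy x) afh; case: (f x) => [r| |] //= _.
    rewrite -EFinD lte_fin => H0; exists ((a - h x + r) / 2); rewrite lte_fin.
    by split; lra.
  by move=> _; exists (a - h x + 1); rewrite ltry; split => //; lra.
have [V Vx HV] := flsc _ _ bf.
have e0 : 0 < b - (a - h x) by lra.
have /cvgrPdist_lt /(_ _ e0) hU := hc x.
exists (V `&` [set y | `|h x - h y| < b - (a - h x)]); first exact: filterI.
move=> y [/HV bfy /= hy].
have : h x - h y < b - (a - h x) by rewrite (le_lt_trans _ hy) // ler_norm.
move=> hy'; apply: (@lt_trans _ _ (b + h y)%:E); first by rewrite lte_fin; lra.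
by rewrite EFinD lteD2rE.
Qed.

End lower_semicontinuity.

Section hilbert.
Context {R : realType} {H : completeNormedModType R} (dot : {dot H for idfun}).
Hypothesis hdot : induces_norm dot.
Implicit Types (x y z v : H) (G : H -> \bar R).

(** Midpoint strong convexity makes a minimizing sequence Cauchy, so existence follows from
    completeness and lower semicontinuity, without weak compactness. It yields both the proximal
    points and the Riesz representation. *)
Lemma strongly_convex_argmin G (mu m : R) : 0 < mu ->
  (exists x, (G x < +oo)%E) -> (forall x, (m%:E <= G x)%E) ->
  lower_semicontinuous G ->
  (forall x y (a b : R), G x = a%:E -> G y = b%:E ->
     (G (2^-1 *: (x + y)) <= ((a + b) / 2 - mu * dot (x - y) (x - y))%:E)%E) ->
  argmin G !=set0.
Proof.
move=> mu0 [x0 Gx0] mG Glsc Gsc.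
have Gfin x : (G x < +oo)%E -> G x = (fine (G x))%:E.
  by move=> Gx; rewrite fineK // fin_numElt Gx andbT (lt_le_trans (ltNyr m)).
pose i := ereal_inf (range G).
have iG x : (i <= G x)%E by apply: ereal_inf_lbound; exists x.
have mi : (m%:E <= i)%E by apply: le_ereal_inf_tmp => _ [x _ <-].
have ifin : i \is a fin_num.
  by rewrite fin_numElt (lt_le_trans (ltNyr m)) //= (le_lt_trans (iG x0)).
have [r ir] : exists r : R, i = r%:E by exists (fine i); rewrite fineK.
have approx n : exists x, (G x < (r + n.+1%:R^-1)%:E)%E.
  have [|_ [x _ <-] xH] := @lb_ereal_inf_adherent _ (range G) n.+1%:R^-1 _ ifin.
    by rewrite invr_gt0.
  by exists x; rewrite EFinD -ir.
have [x Hx] := choice approx.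
have Gx n : G (x n) = (fine (G (x n)))%:E by apply: Gfin; rewrite (lt_trans (Hx n)) ?ltry.
have Hx' n : fine (G (x n)) < r + n.+1%:R^-1 by rewrite -lte_fin -Gx.
have dist n p : mu * `|x n - x p| ^+ 2 <= (n.+1%:R^-1 + p.+1%:R^-1) / 2.
  have := Gsc _ _ _ _ (Gx n) (Gx p) => /(le_trans (iG _)).
  rewrite ir lee_fin hdot; have := Hx' n; have := Hx' p. move: (n.+1%:R^-1) (p.+1%:R^-1) => a b; lra.
have xcvg : cvgn x.
  apply/cauchy_cvgP/cauchy_exP => e e0.
  have me0 : 0 < mu * e ^+ 2 by rewrite mulr_gt0 // exprn_gt0.
  have [N _ HN] := near_infty_natSinv_lt (PosNum me0).
  exists (x N), N => // n Nn; rewrite /= -ball_normE /=.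
  suff : `|x N - x n| ^+ 2 < e ^+ 2 by rewrite ltr_pXn2r ?nnegrE ?normr_ge0 ?(ltW e0).
  rewrite -(ltr_pM2l mu0); apply: (le_lt_trans (dist _ _)).
  have := HN _ (leqnn N); have := HN _ Nn => /=.
  by move: (n.+1%:R^-1) (N.+1%:R^-1) => a b; lra.
exists (limn x) => y; apply: le_trans (iG y).
rewrite leNgt ir; apply/negP => rl.
have [a [ra al]] : exists a : R, r < a /\ (a%:E < G (limn x))%E.
  move: rl; case: (G (limn x)) => [s| |] //.
    by rewrite lte_fin => rs; exists ((r + s) / 2); rewrite lte_fin; split; lra.
  by move=> _; exists (r + 1); rewrite ltry; split => //; lra.
have [V Vl HV] := Glsc _ _ al.
have ar0 : 0 < a - r by lra.
near \oo => n.
have : (a%:E < G (x n))%E by apply: HV; near: n; exact: xcvg.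
rewrite Gx lte_fin; have := Hx' n.
have : n.+1%:R^-1 < a - r by near: n; exact: (near_infty_natSinv_lt (PosNum ar0)).
by move: (n.+1%:R^-1) => b; lra.
Unshelve. all: by end_near. Qed.

Lemma near_dist_lt x (e : R) : 0 < e -> \forall y \near x, `|x - y| < e.
Proof. by move=> e0; have /cvgrPdist_lt := @cvg_id _ (nbhs x); apply. Qed.

Lemma continuous_sqr_dist (c : R) v : continuous (fun y : H => c * `|y - v| ^+ 2).
Proof.
move=> y; apply: cvgM; first exact: cvg_cst.
have N : (fun y : H => `|y - v|) @ y --> `|y - v|.
  by apply: cvg_norm; apply: cvgB; [exact: cvg_id|exact: cvg_cst].
by rewrite expr2; under eq_fun do rewrite expr2; exact: cvgM.
Qed.

(** The representing vector is the minimizer of |y|^2 / 2 - l y, whose first-order condition is the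
    claim. *)
Lemma riesz (l : H -> R) (M : R) : (forall x y, l (x + y) = l x + l y) ->
  (forall a x, l (a *: x) = a * l x) -> (forall x, `|l x| <= M * `|x|) ->
  exists v, forall y, l y = dot v y.
Proof.
move=> lD lZ lM.
pose h y := 2^-1 * dot y y - l y.
have lB x y : l (x - y) = l x - l y by rewrite -scaleN1r lD lZ mulN1r.
have lc : continuous l.
  move=> x; apply/cvgrPdist_lt => e e0.
  have M0 : 0 < `|M| + 1 by rewrite ltr_wpDl.
  have eM : 0 < e / (`|M| + 1) by rewrite divr_gt0.
  near=> y; rewrite -lB; apply: (le_lt_trans (lM _)).
  have : `|x - y| < e / (`|M| + 1).
    by near: y; exact: near_dist_lt.
  rewrite ltr_pdivlMr //; apply: le_lt_trans; rewrite mulrC ler_wpM2l //.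
  by rewrite (le_trans (ler_norm _)) // lerDl.
have hc : continuous h.
  move=> y; apply: cvgB; last exact: lc.
  have E : (fun y => 2^-1 * dot y y) = (fun y => 2^-1 * `|y - 0| ^+ 2).
    by apply/funext => z; rewrite subr0 hdot.
  by rewrite E hdot -[in `|y| ^+ 2](subr0 y); exact: continuous_sqr_dist.
(* The zero summand gives the shape expected by [lsc_add_continuous]. The modulus 1/8 comes from the
   parallelogram identity for |y|^2 / 2, and the lower bound from completing the square. *)
have [] := @strongly_convex_argmin (fun y => 0 + (h y)%:E)%E 8^-1 (- (M ^+ 2 / 2)).
- by lra.
- by exists 0; rewrite add0e ltry.
- move=> y; rewrite add0e lee_fin /h hdot.
  have := lM y; rewrite ler_norml => /andP[_ ly].
  by have := sqr_ge0 (`|y| - M); rewrite !expr2; lra.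
- by apply: lsc_add_continuous => //; move=> x a; rewrite lte_fin => a0; exists setT => //; exact: filterT.
- move=> x y a b; rewrite !add0e => -[<-] -[<-]; rewrite lee_fin /h.
  by rewrite lZ lD !dotE (dotC dot y x); lra.
move=> v vmin; exists v => y; apply/eqP; rewrite -subr_eq0; apply/eqP.
set d := l y - dot v y.
(* The minimizer is perturbed along y by t = d / (|y|^2 + 1); the added 1 keeps the quotient
   meaningful for y = 0, and minimality forces t^2 <= 0. *)
have N0 := dot_ge0 hdot y.
have := vmin (v + (d / (dot y y + 1)) *: y).
rewrite !add0e lee_fin /h lD lZ !dotE (dotC dot y v).
have N1 : dot y y + 1 != 0 by rewrite gt_eqF // ltr_wpDl.
set t := d / _ => H0.
have td : t * (dot y y + 1) = d by rewrite /t divfK.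
have {}H0 : 0 <= t * (t * dot y y / 2 - t * (dot y y + 1)) by rewrite td /d; lra.
have t2 : t ^+ 2 <= 0.
  have : 0 <= t ^+ 2 * dot y y by rewrite mulr_ge0 // sqr_ge0.
  by rewrite expr2; lra.
have t0 : t = 0 by apply/eqP; rewrite -sqrf_eq0 eq_le sqr_ge0 andbT.
by rewrite -td t0 mul0r.
Unshelve. all: by end_near. Qed.

End hilbert.

(** * Proximal points and weak limits *)

Section proximal.
Context {R : realType} {H : completeNormedModType R} (dot : {dot H for idfun}).
Hypothesis hdot : induces_norm dot.
Context (f : H -> \bar R) (f_proper : proper_function f)
  (f_convex : convex_efunction f) (f_lsc : lower_semicontinuous f)
  (f_argmin : argmin f !=set0).
Implicit Types (x y z v u : H) (s : R).

Lemma proper_fine y : (f y < +oo)%E -> f y = (fine (f y))%:E.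
Proof.
move=> fy; rewrite fineK // fin_numElt fy andbT ltNye; exact: f_proper.1.
Qed.

Lemma argmin_fine z : argmin f z -> f z = (fine (f z))%:E.
Proof.
by move=> zmin; apply: proper_fine; have [y fy] := f_proper.2; exact: le_lt_trans fy.
Qed.

(** The proximal objective attains its minimum, so [prox] is never the default value of [xget]. The
    modulus k / 4 used below is the midpoint gain of k |y - v|^2. *)
Lemma prox_argmin s v : 0 < s ->
  argmin (fun y => f y + ((2 * s)^-1 * `|y - v| ^+ 2)%:E)%E (prox s f v).
Proof.
move=> s0; have k0 : 0 < (2 * s)^-1 by rewrite invr_gt0 mulr_gt0.
rewrite /prox; apply: xgetPex; move: (2 * s)^-1 k0 => k k0.
have [z zmin] := f_argmin; have fz := argmin_fine zmin.
apply: (@strongly_convex_argmin _ _ dot hdot _ (k / 4) (fine (f z))).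
- by rewrite divr_gt0.
- by exists z; rewrite fz -EFinD ltry.
- move=> x; apply: (@le_trans _ _ (f x)); first by rewrite -fz; exact: zmin.
  by rewrite leeDl // lee_fin mulr_ge0 ?sqr_ge0 // ltW.
- by apply: lsc_add_continuous; [exact: f_proper.1|done|exact: continuous_sqr_dist].
move=> x y a b fx fy.
have fE w c : (f w + (k * `|w - v| ^+ 2)%:E)%E = c%:E -> f w = (c - k * `|w - v| ^+ 2)%:E.
  move: (f_proper.1 w); case: (f w) => [r| |] //= _; rewrite -EFinD => -[<-].
  by rewrite addrK.
have := @f_convex x y 2^-1; rewrite (fE _ _ fx) (fE _ _ fy).
have -> : 1 - 2^-1 = 2^-1 :> R by lra.
rewrite -scalerDr -!EFinM -EFinD => /(_ _) le_mid.
apply: (le_trans (leeD2r _ (le_mid _))); first by apply/andP; split; lra.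
rewrite -EFinD lee_fin -!hdot.
rewrite !dotE !(dotC dot y x) !(dotC dot v x) !(dotC dot v y); lra.
Qed.

(** Minimality is tested on the segment from p to y. After division by t, convexity leaves the
    subgradient inequality up to an error t |y - p|^2 / (2 s). *)
Lemma prox_subdifferential s v : 0 < s ->
  subdifferential dot f (prox s f v) (s^-1 *: (v - prox s f v)).
Proof.
move=> s0; have := prox_argmin v s0; move: (prox s f v) => p pmin.
have [z zmin] := f_argmin; have fz := argmin_fine zmin.
have fp : f p = (fine (f p))%:E.
  apply: proper_fine; move: (pmin z); rewrite fz -EFinD.
  by move: (f_proper.1 p); case: (f p) => [r| |] //= _ _; rewrite ltry.
split; first by rewrite fp.
move=> y; have [fy|] := ltP (f y) +oo%E; last by rewrite leye_eq => /eqP ->; rewrite leey.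
have {}fy := proper_fine fy; rewrite fp fy -EFinD lee_fin.
move: (fine (f p)) (fine (f y)) fp fy => a b fp fy.
have key t : 0 < t -> t < 1 ->
    a + dot (s^-1 *: (v - p)) (y - p) - b <= t * ((2 * s)^-1 * dot (y - p) (y - p)).
  move=> t0 t1; have t01 : 0 <= t <= 1 by rewrite !ltW.
  have := @f_convex y p t t01; rewrite fy fp -!EFinM -EFinD => le_t.
  have := le_trans (pmin (t *: y + (1 - t) *: p)) (leeD2r _ le_t).
  rewrite fp -!EFinD lee_fin -!hdot invfM.
  have -> : t *: y + (1 - t) *: p - v = t *: (y - p) - (v - p).
    rewrite scalerBr scalerBl scale1r opprB !addrA; congr (_ + _).
    by rewrite -!addrA; congr (_ + _); rewrite addrC.
  have -> : p - v = - (v - p) by rewrite opprB.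
  move: (v - p) (y - p) => V Y; rewrite !dotE (dotC dot Y V) => H0.
  rewrite -(ler_pM2l t0); lra.
(* Instead of letting t tend to 0, a violation d > 0 is refuted with the explicit t = d / (2 (d + 2
   q)), which lies in ]0, 1[ and satisfies t q < d. *)
rewrite -subr_le0 leNgt; apply/negP => d0.
set d := (X in 0 < X) in d0; set q := (2 * s)^-1 * dot (y - p) (y - p) in key.
have q0 : 0 <= q by rewrite mulr_ge0 ?dot_ge0 // invr_ge0 mulr_ge0 // ltW.
have dq0 : 0 < d + 2 * q by rewrite ltr_wpDr // mulr_ge0.
have t0 : 0 < d / (2 * (d + 2 * q)) by rewrite divr_gt0 // mulr_gt0.
have t1 : d / (2 * (d + 2 * q)) < 1 by rewrite ltr_pdivrMr ?mulr_gt0 //; lra.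
have := key _ t0 t1; rewrite -/d mulrAC ler_pdivlMr ?mulr_gt0 // => H0.
have : 0 < d * d by rewrite mulr_gt0.
have : 0 <= d * q by rewrite mulr_ge0 // ltW.
lra.
Qed.

Lemma subdifferential_monotone x y u v : subdifferential dot f x u ->
  subdifferential dot f y v -> 0 <= dot (u - v) (x - y).
Proof.
move=> [fx Hx] [fy Hy]; have := Hx y; have := Hy x.
rewrite -(fineK fx) -(fineK fy) -!EFinD !lee_fin !dotE; lra.
Qed.

Lemma subdifferential0_argmin x : subdifferential dot f x 0 -> argmin f x.
Proof. by move=> [_ Hx] y; have := Hx y; rewrite dot0l adde0. Qed.

Lemma subdifferential_fine x u : subdifferential dot f x u ->
  forall y, f y = (fine (f y))%:E -> fine (f x) + dot u (y - x) <= fine (f y).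
Proof.
by move=> [fx Hx] y fy; have := Hx y; rewrite -(fineK fx) fy -EFinD lee_fin.
Qed.

End proximal.

Section weak_convergence.
Context {R : realType} {H : completeNormedModType R} (dot : {dot H for idfun}).
Hypothesis hdot : induces_norm dot.
Implicit Types (x : nat -> H) (y z : H).

Lemma ultra_cvg_segment (U : set_system nat) (a : nat -> R) (M : R) :
  UltraFilter U -> (\forall k \near U, `|a k| <= M) -> exists l : R, a @ U --> l.
Proof.
move=> UU aM.
have FU : UltraFilter (a @ U).
  split; first exact: fmap_proper_filter.
  move=> G GG sUG; apply/seteqP; split => // A GA.
  have [//|nA] := in_ultra_setVsetC (a @^-1` A) UU.
  have : G (A `&` ~` A) by apply: filterI => //; exact: sUG.
  by rewrite setICr => /filter_not_empty.
have := @segment_compact R (- M) M; rewrite compact_ultra => /(_ _ FU) [].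
  by apply: filterS aM => k; rewrite /= in_itv /= ler_norml.
by move=> l [_ al]; exists l.
Qed.

(** Weak compactness of balls. Along an ultrafilter all the bounded scalar sequences [dot (x k) y]
    converge at once, so no diagonal extraction or separability is involved; the limit is linear and
    bounded in y, and [riesz] represents it. *)
Lemma ultra_weak_limit x (M : R) (U : set_system nat) : UltraFilter U ->
  (\forall k \near U, `|x k| <= M) ->
  exists v, forall y, (fun k => dot (x k) y) @ U --> dot v y.
Proof.
move=> UU xM.
have bnd y : \forall k \near U, `|dot (x k) y| <= M * `|y|.
  apply: filterS xM => k xk; apply: (le_trans (dot_le_norm hdot _ _)).
  by rewrite ler_wpM2r.
have [l Hl] := choice (fun y => ultra_cvg_segment UU (bnd y)).
have [||| v Hv] := @riesz _ _ dot hdot l M.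
- move=> y z; have E := cvgD (Hl y) (Hl z).
  have {}E : (fun k => dot (x k) (y + z)) @ U --> l y + l z.
    have -> : (fun k => dot (x k) (y + z)) = (fun k => dot (x k) y) \+ (fun k => dot (x k) z).
      by apply/funext => k; rewrite dotDr.
    exact: E.
  exact: (cvg_unique _ (Hl _) E).
- move=> a y; have E := cvgM (cvg_cst a) (Hl y).
  have {}E : (fun k => dot (x k) (a *: y)) @ U --> a * l y.
    have -> : (fun k => dot (x k) (a *: y)) = (fun k => a * dot (x k) y).
      by apply/funext => k; rewrite dotZr.
    exact: E.
  exact: (cvg_unique _ (Hl _) E).
- move=> y; have Hn := cvg_norm (Hl y).
  exact: (closed_cvg (fun r : R => r <= M * `|y|) (@closed_le _ _) (bnd y) _ (Hn _)).
by exists v => y; rewrite -Hv.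
Qed.

(* Opial's argument along ultrafilters: two weak cluster points coincide
   because the limits of the distances determine the limits of [dot (x k)]. *)
Lemma opial x (S : set H) (M : R) : (\forall k \near \oo, `|x k| <= M) ->
  (forall z, S z -> cvgn (fun k => dot (x k - z) (x k - z))) ->
  (forall (U : set_system nat) v, UltraFilter U -> \oo `<=` U ->
     (forall y, (fun k => dot (x k) y) @ U --> dot v y) -> S v) ->
  exists2 v, S v & weak_cvg dot x v.
Proof.
move=> xM xS xU.
have [U [UU oU]] := ultraFilterLemma eventually_filter.
have [v Hv] := ultra_weak_limit UU (oU _ xM).
have Sv := xU _ _ UU oU Hv; exists v => // y.
have uniq U' w : UltraFilter U' -> \oo `<=` U' ->
    (forall y, (fun k => dot (x k) y) @ U' --> dot w y) -> w = v.
  move=> UU' oU' Hw; have Sw := xU _ _ UU' oU' Hw.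
  apply/eqP; rewrite -subr_eq0; apply/eqP/(dot_eq0 hdot).
  have cx : cvgn (fun k => dot (x k) (w - v)).
    have -> : (fun k => dot (x k) (w - v)) = (fun k => 2^-1 *
        (dot (x k - v) (x k - v) - dot (x k - w) (x k - w) + (dot w w - dot v v))).
      apply/funext => k; rewrite !dotE (dotC dot v) (dotC dot w (x k)); lra.
    apply: is_cvgM; first exact: is_cvg_cst.
    apply: is_cvgD; last exact: is_cvg_cst.
    by apply: is_cvgB; exact: xS.
  set L := limn (fun k => dot (x k) (w - v)) in cx.
  have cU (G : set_system nat) : \oo `<=` G -> (fun k => dot (x k) (w - v)) @ G --> L.
    by move=> oG; exact: cvg_trans (cvg_app _ oG) cx.
  have E1 : dot w (w - v) = L by exact: (cvg_unique _ (Hw _) (cU _ oU')).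
  have E2 : dot v (w - v) = L by exact: (cvg_unique _ (Hv _) (cU _ oU)).
  by rewrite dotDl dotNl E1 E2 subrr.
apply: contrapT => /cvgrPdist_lt/existsNP[e /not_implyP[e0 He]].
(* If weak convergence fails at y, the bad indices are unbounded and carry an ultrafilter finer than
   the filter at infinity. Its weak limit is again v, so it also contains the good indices, a
   contradiction. *)
pose B := [set k | `|dot v y - dot (x k) y| < e].
have PF : ProperFilter (within (~` B) \oo).
  apply: Build_ProperFilter_ex => A /= HA; apply: contrapT => nA; apply: He.
  move: HA => [N _ HN]; exists N => // k /HN BA.
  by apply: contrapT => nB; apply: nA; exists k; exact: BA.
have [U' [UU' wU']] := ultraFilterLemma PF.
have oU' : \oo `<=` U'.
  by move=> A oA; apply: wU'; exact: (filterS (fun k Ak _ => Ak) oA).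
have nB : U' (~` B) by apply: wU'; exists 0%N.
have [w Hw] := ultra_weak_limit UU' (oU' _ xM).
have wv := uniq _ _ UU' oU' Hw.
have UB : U' B by have /cvgrPdist_lt /(_ _ e0) := Hw y; rewrite wv.
have : U' (B `&` ~` B) by exact: filterI.
by rewrite setICr => /filter_not_empty.
Qed.

End weak_convergence.

(** * The weighted energy *)

Section one_step.
Context {R : realType} {H : normedModType R} (dot : {dot H for idfun}).
Hypothesis hdot : induces_norm dot.
Implicit Types (x d u y z : H) (a c w : R).

(** Polarization of [dot d d'] and [dot x d']. The error c / 2 |d'|^2 is the price of taking the
    Tikhonov term at x instead of x + d'. *)
Lemma energy_step x d d' u' a c (F F' : R) : u' = a *: d - d' - c *: x ->
  F' - F <= dot u' d' ->
  F' + dot d' d' / 2 + c / 2 * dot (x + d') (x + d') <=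
  F + dot d d / 2 + c / 2 * dot x x - (1 - a) / 2 * (dot d d + dot d' d')
  + c / 2 * dot d' d' - a / 2 * dot (d' - d) (d' - d).
Proof.
move=> ->; rewrite !dotE (dotC dot d' x) (dotC dot d' d); lra.
Qed.

(** The friction acting on [dot d (x - y)] is a difference of squared distances, which telescopes.
    Polarizing c [dot (x + d') (x + d' - y)] gives the Tikhonov values at x + d' and y together with
    - c / 2 |x + d' - y|^2; half of the latter pays for replacing x by x + d'. *)
Lemma correlation_step x d d' u' y a c (F' Fy : R) : 0 <= a <= 1 -> 0 <= c ->
  u' = a *: d - d' - c *: x -> F' - Fy <= dot u' (x + d' - y) ->
  dot d' (x + d' - y) - dot d (x - y) <=
  - ((1 - a) * (dot (x - y) (x - y) / 2 - dot (x - d - y) (x - d - y) / 2))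
  + dot d d / 2 + (2^-1 + c) * dot d' d'
  - (F' + c / 2 * dot (x + d') (x + d') - Fy - c / 2 * dot y y)
  - c / 4 * dot (x + d' - y) (x + d' - y).
Proof.
move=> /andP[a0 a1] c0 uE HF.
have Y1 : c * dot d' (x + d' - y) <= c * dot d' d' + c / 4 * dot (x + d' - y) (x + d' - y).
  have := dot_young hdot (a := 2) (b := 2^-1) (c := 1) d' (x + d' - y).
  move=> /(_ _ _ _) Y; have {}Y : 2 * 1 * dot d' (x + d' - y) <=
      2 * dot d' d' + 2^-1 * dot (x + d' - y) (x + d' - y) by apply: Y; lra.
  have := ler_wpM2l c0 Y; lra.
have Y2 : a * dot d d' <= dot d d / 2 + dot d' d' / 2.
  have Y : 2 * a * dot d d' <= 1 * dot d d + 1 * dot d' d'.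
    by apply: dot_young => //; rewrite mulr1 expr_le1.
  lra.
have Y3 : 0 <= (1 - a) * dot d d by rewrite mulr_ge0 ?dot_ge0 // subr_ge0.
move: HF Y1 Y2 Y3; rewrite {}uE !dotE ?(dotC dot d' x) ?(dotC dot d x).
rewrite ?(dotC dot y x) ?(dotC dot y d) ?(dotC dot y d'); lra.
Qed.

(* The weights are T = k^r, S = k^(r-1), s2 = k^(r-2), s3 = k^(r-3), w = alpha k^-q;
   primed quantities belong to the index k + 1. *)
Lemma weighted_step x d d' u' z (a c c' w w' F F' T T' S S' s2 s3 C1 C2 b : R) :
  a = 1 - w -> 0 <= w <= 2^-1 -> 0 <= c' -> c' <= c -> c <= w / 8 ->
  u' = a *: d - d' - c *: x -> F' - F <= dot u' d' -> F' <= dot u' (x + d' - z) ->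
  0 <= F' -> 0 <= T -> T' - T <= C1 * S -> 0 <= C1 -> 0 <= S -> 0 <= s3 -> s3 <= S ->
  `|S' - S| <= C2 * s2 -> 0 <= C2 -> 0 <= s2 -> s2 ^+ 2 <= S * s3 -> S' * w' <= S * w ->
  b = C1 + 1 -> 8 * (C1 + b + b * C2) * S <= T * w ->
  T' * (F' + dot d' d' / 2 + c' / 2 * dot (x + d') (x + d'))
  + b * (S' * dot d' (x + d' - z) + S' * w' * (dot (x - z) (x - z) / 2))
  + (S * (F' + c / 2 * dot (x + d') (x + d')) + T * w / 4 * (dot d d + dot d' d')
     + T / 4 * dot (d' - d) (d' - d)) <=
  T * (F + dot d d / 2 + c / 2 * dot x x)
  + b * (S * dot d (x - z) + S * w * (dot (x - d - z) (x - d - z) / 2))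
  + 2 * b * C2 * s3 * dot (x - d - z) (x - d - z) + b * S * c / 2 * dot z z.
Proof.
move=> aE /andP[w0 w2] c'0 c'c cw uE HF HFz F'0 T0 TT C10 S0 s30 s3S SS C20 s20 s2S Sw bE big.
have a01 : 0 <= a <= 1 by rewrite aE; apply/andP; split; lra.
have c0 : 0 <= c by exact: le_trans c'c.
have b0 : 0 <= b by lra.
have c1 : c <= 1 by lra.
have En := ler_wpM2l T0 (energy_step uE HF).
have := @correlation_step x d d' u' z a c F' 0 a01 c0 uE.
rewrite subr0 => /(_ HFz) /(ler_wpM2l (mulr_ge0 b0 S0)) Co.
have N0 := dot_ge0 hdot d; have N'0 := dot_ge0 hdot d'; have e0 := dot_ge0 hdot (d' - d).
have X'0 := dot_ge0 hdot (x + d'); have B0 := dot_ge0 hdot (x - d - z).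
have A0 := dot_ge0 hdot (x + d' - z); have B'0 := dot_ge0 hdot (x - z).
(* The lower bound of the energy only controls the distance from x - d to z, so the new distance is
   traced back over the two steps d and d'. *)
have A_le : dot (x + d' - z) (x + d' - z) <=
    2 * dot d' d' + 4 * dot d d + 4 * dot (x - d - z) (x - d - z).
  have := dot_sum_le hdot d' (x - z); have := dot_sum_le hdot d (x - d - z).
  have -> : d + (x - d - z) = x - z by rewrite addrA subrKC.
  have -> : d' + (x - z) = x + d' - z by rewrite addrA (addrC d').
  lra.
(* The change of weight C2 s2 is split by s2^2 <= S s3: the S part joins the kinetic errors, and the
   s3 part is left to the Gronwall argument. *)
have P_le : (S' - S) * dot d' (x + d' - z) <=
    C2 / 2 * (S * dot d' d' + s3 * dot (x + d' - z) (x + d' - z)).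
  have CS0 : 0 <= C2 * S by rewrite mulr_ge0.
  have Cs0 : 0 <= C2 * s3 by rewrite mulr_ge0.
  have Cs2 : (C2 * s2) ^+ 2 <= C2 * S * (C2 * s3).
    by rewrite exprMn [leRHS]mulrACA -expr2 ler_wpM2l ?sqr_ge0.
  apply: (le_trans (dot_scaled_le hdot d' (x + d' - z) CS0 Cs0 SS Cs2)).
  by rewrite le_eqVlt; apply/orP; left; apply/eqP; ring.
move: (dot d' (x + d' - z)) (dot d (x - z)) (dot (x + d' - z) (x + d' - z))
  (dot (x - d - z) (x - d - z)) (dot (x - z) (x - z)) (dot (x + d') (x + d'))
  (dot d d) (dot d' d') (dot (d' - d) (d' - d)) (dot x x) (dot z z)
  En Co N0 N'0 e0 X'0 B0 A0 B'0 A_le P_le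
  => P' P A B B' X' N N' e X Z En Co N0 N'0 e0 X'0 B0 A0 B'0 A_le P_le.
have W'0 : 0 <= F' + N' / 2 + c' / 2 * X' by rewrite !addr_ge0 ?mulr_ge0 //; lra.
have TW : (T' - T) * (F' + N' / 2 + c' / 2 * X') <= C1 * S * (F' + N' / 2 + c / 2 * X').
  apply: (le_trans (ler_wpM2r W'0 TT)); apply: ler_wpM2l; first exact: mulr_ge0.
  by rewrite lerD2l ler_wpM2r //; lra.
have TcX : T * (c' * X') <= T * (c * X') by rewrite ler_wpM2l // ler_wpM2r.
have TcN : T * (c * N') <= T * w / 8 * N'.
  by have := ler_wpM2l T0 (ler_wpM2r N'0 cw); lra.
have TeE : T * (w * e) <= T * e / 2.
  by have := ler_wpM2l T0 (ler_wpM2r e0 w2); lra.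
have bP := ler_wpM2l b0 P_le.
have bA : b * (C2 * (s3 * A)) <= b * (C2 * (s3 * (2 * N' + 4 * N + 4 * B))).
  by rewrite !ler_wpM2l.
have SB : b * (S' * w' * B') <= b * (S * w * B') by rewrite ler_wpM2l // ler_wpM2r.
have bN := ler_wpM2r N0 big; have bN' := ler_wpM2r N'0 big.
have s3N : b * (C2 * (s3 * N)) <= b * (C2 * (S * N)) by rewrite !ler_wpM2l // ler_wpM2r.
have s3N' : b * (C2 * (s3 * N')) <= b * (C2 * (S * N')) by rewrite !ler_wpM2l // ler_wpM2r.
have cSN' : b * (S * (c * N')) <= b * (S * N').
  by rewrite ler_wpM2l // ler_wpM2l // ler_piMl.
have SA0 : 0 <= b * (S * (c * A)) by rewrite !mulr_ge0.
have p1 : 0 <= C1 * (S * N') by rewrite !mulr_ge0.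
have p2 : 0 <= b * (S * N') by rewrite !mulr_ge0.
have p3 : 0 <= b * (S * N) by rewrite !mulr_ge0.
have p4 : 0 <= C1 * (S * N) by rewrite !mulr_ge0.
have p5 : 0 <= b * (C2 * (S * N)) by rewrite !mulr_ge0.
have p6 : 0 <= b * (C2 * (S * N')) by rewrite !mulr_ge0.
(* The choice b = C1 + 1 pays the cost C1 S of the growing weight and leaves one copy of S F' and S
   c X' as summable gain. *)
have bS1 : b * (S * F') = C1 * (S * F') + S * F' by rewrite bE; ring.
have bS2 : b * (S * (c * X')) = C1 * (S * (c * X')) + S * (c * X') by rewrite bE; ring.
rewrite aE in En Co.
move: En Co bP bN bN'; clear - TW TcX TcN TeE bA SB s3N s3N' cSN' SA0 p1 p2 p3 p4 p5 p6 bS1 bS2.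
by move=> *; lra.
Qed.

End one_step.

Section lower_bound.
Context {R : realType} {H : normedModType R} (dot : {dot H for idfun}).
Hypothesis hdot : induces_norm dot.

(** With y = x - d - z, the correlation is S |d|^2 + S [dot d y]. Young with weights 2 S / w and S w
    / 2 spends half of the anchor term, and 4 b S <= T w lets half of the kinetic energy cover the
    rest. *)
Lemma weighted_lower_bound (x d z : H) (w c F T S b : R) : 0 < w -> 0 <= c ->
  0 <= T -> 0 <= S -> 0 <= b -> 4 * b * S <= T * w ->
  T * F + T / 4 * dot d d + b * (S * w) / 4 * dot (x - d - z) (x - d - z) <=
  T * (F + dot d d / 2 + c / 2 * dot x x)
  + b * (S * dot d (x - z) + S * w * (dot (x - d - z) (x - d - z) / 2)).
Proof.
move=> w0 c0 T0 S0 b0 big.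
have -> : x - z = d + (x - d - z) by rewrite addrA subrKC.
move: (x - d - z) => y; rewrite dotDr.
have wS : (2 * (S / w)) * (S * w / 2) = S ^+ 2 by field; rewrite gt_eqF.
have := dot_young hdot (a := 2 * (S / w)) (b := S * w / 2) (c := - S) d y.
rewrite sqrrN wS => /(_ _ _ (lexx _)) Y.
have {}Y : 2 * - S * dot d y <= 2 * (S / w) * dot d d + S * w / 2 * dot y y.
  by apply: Y; rewrite ?mulr_ge0 ?invr_ge0 //; lra.
have N0 := dot_ge0 hdot d; have B0 := dot_ge0 hdot y; have X0 := dot_ge0 hdot x.
have bSw : b * (S / w) <= T / 4.
  rewrite mulrA ler_pdivrMr //; lra.
have := ler_wpM2r N0 bSw.
have := ler_wpM2l b0 Y.
have : 0 <= b * (S * dot d d) by rewrite !mulr_ge0.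
have : 0 <= T * (c * dot x x) by rewrite !mulr_ge0.
move: {bSw Y wS}(S / w) => Q; lra.
Qed.

End lower_bound.

Section order_facts.
Context {R : realDomainType}.
Implicit Types a b c d e m : R.

Lemma le_five_parts a b c d e : [/\ 0 <= a, 0 <= b, 0 <= c, 0 <= d & 0 <= e] ->
  [/\ a <= a + b + (c + d) + e, b <= a + b + (c + d) + e,
      c <= a + b + (c + d) + e & e <= a + b + (c + d) + e].
Proof. by move=> [*]; split; lra. Qed.

Lemma le_three_parts a b c e m : [/\ 0 <= a, 0 <= b & 0 <= c] ->
  a + b + c <= e -> e <= m -> [/\ a <= m, b <= m & c <= m].
Proof. by move=> [*]; split; lra. Qed.

End order_facts.

(** * Rates and sums for a fixed minimizer *)

Section inertial_sequence.
Context {R : realType} {H : normedModType R} (dot : {dot H for idfun}).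
Hypothesis hdot : induces_norm dot.
Context (q alpha c p : R) (q_gt0 : 0 < q) (q_lt1 : q < 1) (alpha_gt0 : 0 < alpha)
  (c_gt0 : 0 < c) (p_gt1 : 1 < p) (x u : nat -> H) (F : nat -> R).

Definition step (y : nat -> H) k := y k - y k.-1.
Local Notation d := (step x).
Local Notation w k := (alpha * pw (- q) k).
Local Notation eps k := (c * pw (- p) k).

Hypothesis uE : forall k, (1 <= k)%N ->
  u k.+1 = (1 - w k) *: d k - d k.+1 - eps k *: x k.
Hypothesis F_ge0 : forall k, (2 <= k)%N -> 0 <= F k.
Hypothesis F_dec : forall k, (2 <= k)%N -> F k.+1 - F k <= dot (u k.+1) (d k.+1).

Let xS k : x k.+1 = x k + d k.+1. Proof. by rewrite /step /= subrKC. Qed.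
Let xP k : x k.-1 = x k - d k. Proof. by rewrite /step subKr. Qed.

Lemma bsum_le_of_near (a b : nat -> R) (C : R) : 0 < C ->
  (\forall k \near \oo, a k <= C * b k) -> bsum b -> bsum a.
Proof. by move=> C0 ab bb; apply: bsum_near ab _; apply: bsumZ => //; exact: ltW. Qed.

Lemma near_coefficients (e : R) : 0 < e ->
  \forall k \near \oo, [/\ (2 <= k)%N, 0 < w k, w k <= e & eps k <= w k / 8].
Proof.
move: (q_lt1) (p_gt1) => q1 p1 e0; near=> k; have k2 : (2 <= k)%N by near: k; exact: nbhs_infty_ge.
have k0 : (0 < k)%N by exact: leq_trans k2.
split => //; first by rewrite mulr_gt0 // pw_gt0.
- have : pw (- q) k <= e / alpha * pw 0 k.
    near: k; apply: pw_small; first by rewrite oppr_lt0.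
    by rewrite divr_gt0.
  rewrite pw0 mulr1 ler_pdivlMr // mulrC; exact.
- have : pw (- p) k <= alpha / (8 * c) * pw (- q) k.
    near: k; apply: pw_small; first by lra.
    by rewrite divr_gt0 // mulr_gt0.
  move/(ler_wpM2l (ltW c_gt0)); rewrite mulrA.
  have -> : c * (alpha / (8 * c)) = alpha / 8 by field; rewrite gt_eqF.
  by rewrite mulrAC.
Unshelve. all: by end_near. Qed.

(** [weighted_step] with T = k^r, [weighted_lower_bound] and [gronwall]. The remaining error k^(r-3)
    |x_(k-1) - z|^2 is k^(q-2) times the anchor part of the energy, a summable factor because q <
    1. *)
Lemma weighted_estimates (r : R) (z : H) : r <= q + 1 -> r < p -> 0 < r ->
  (forall k, (2 <= k)%N -> F k <= dot (u k) (x k - z)) ->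
  [/\ bsum (fun k => pw (r - 1) k * F k.+1),
      bsum (fun k => pw (r - 1 - p) k * dot (x k.+1) (x k.+1)),
      bsum (fun k => pw (r - q) k * dot (d k) (d k)),
      bsum (fun k => pw r k * dot (d k.+1 - d k) (d k.+1 - d k)) &
      exists M, \forall k \near \oo, [/\ pw r k * F k <= M,
        pw r k * dot (d k) (d k) <= M &
        pw (r - 1 - q) k * dot (x k.-1 - z) (x k.-1 - z) <= M]].
Proof.
move: (q_gt0) (q_lt1) (p_gt1) => q0 q1 p1 rq rp r0 Fz.
have qN : - q <= 0 by lra.
have pN : - p <= 0 by lra.
have s3_S : r - 3 <= r - 1 by lra.
have s2_E : r - 1 - 1 = r - 2 by lra.
have s2_sq : r - 2 + (r - 2) = r - 1 + (r - 3) by lra.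
have D_exp : r - 1 - q <= 0 by lra.
have s3_E : r - 3 = (q - 2) + (r - 1 - q) by lra.
have big_exp : r - 1 < r + - q by lra.
have [C1 C10 HC1] := pw_diff r (R := R).
have [C2 C20 HC2] := pw_diff (r - 1) (R := R).
have [b bE] : exists b, b = C1 + 1 by exists (C1 + 1).
have b0 : 0 < b by lra.
(* The threshold required by [weighted_step]; it is eventually met because k^(r-1) is negligible
   against k^(r-q). *)
have [M0 M0E] : exists M0, M0 = 8 * (C1 + b + b * C2) by eexists.
have bC2 : 0 <= b * C2 by rewrite mulr_ge0 // ltW.
have M00 : 0 < M0 by lra.
pose S k : R := pw (r - 1) k; pose T k : R := pw r k; pose s3 k : R := pw (r - 3) k.
pose W k := F k + dot (d k) (d k) / 2 + eps k / 2 * dot (x k) (x k).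
pose B k := dot (x k.-1 - z) (x k.-1 - z).
pose E k := T k * W k + b * (S k * dot (d k) (x k - z) + S k * w k * (B k / 2)).
pose G k := S k * (F k.+1 + eps k / 2 * dot (x k.+1) (x k.+1))
  + T k * w k / 4 * (dot (d k) (d k) + dot (d k.+1) (d k.+1))
  + T k / 4 * dot (d k.+1 - d k) (d k.+1 - d k).
have Sw k : (0 < k)%N -> S k * w k = alpha * pw (r - 1 - q) k.
  by move=> k0; rewrite /S (pwD (r - 1) (- q)) // mulrCA.
have near_scalar : \forall k \near \oo, [/\ (2 <= k)%N, 0 < w k, w k <= 2^-1,
    eps k <= w k / 8 & M0 * S k <= T k * w k].
  near=> k; have [k2 w0 w2 ew] : [/\ (2 <= k)%N, 0 < w k, w k <= 2^-1 & eps k <= w k / 8].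
    by near: k; apply: near_coefficients; rewrite invr_gt0.
  split => //; rewrite mulrCA /S /T -pwD; last exact: leq_trans k2.
  rewrite -ler_pdivlMl // mulrA.
  near: k; apply: pw_small => //.
  by rewrite mulr_gt0 // invr_gt0.
have main : \forall k \near \oo, E k.+1 + G k <= E k + 2 * b * C2 * s3 k * B k
    + b * c / 2 * dot z z * pw (r - 1 - p) k.
  near=> k.
  have [k2 w0 w2 ew big] : [/\ (2 <= k)%N, 0 < w k, w k <= 2^-1, eps k <= w k / 8 &
    M0 * S k <= T k * w k] by near: k.
  have k0 : (0 < k)%N by exact: leq_trans k2.
  have := @weighted_step R H dot hdot (x k) (d k) (d k.+1) (u k.+1) z (1 - w k) (eps k)
    (eps k.+1) (w k) (w k.+1) (F k) (F k.+1) (T k) (T k.+1) (S k) (S k.+1)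
    (pw (r - 2) k) (s3 k) C1 C2 b erefl.
  rewrite -xS => H0.
  have {}H0 := H0 _ _ _ ew (uE k0) (F_dec k2) (Fz _ (leqW k2)) (F_ge0 (leqW k2)).
  rewrite /E /G /W /B /= !(xP k).
  apply: (le_trans (H0 _ _ _ _ _ _ _ _ _ _ _ _ _ _ bE _)).
  - by rewrite w2 andbT ltW.
  - by rewrite mulr_ge0 ?pw_ge0 // ltW.
  - by rewrite ler_pM2l // pw_anti.
  - exact: pw_ge0.
  - by apply: (le_trans (ler_norm _)); exact: HC1.
  - by [].
  - exact: pw_ge0.
  - exact: pw_ge0.
  - exact: pw_le.
  - by have := HC2 _ k0; rewrite s2_E.
  - by [].
  - exact: pw_ge0.
  - by rewrite expr2 -!pwD // s2_sq.
  - by rewrite !Sw // ler_pM2l // pw_anti.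
  - by rewrite -M0E.
  rewrite /S (pwD (r - 1) (- p)) // le_eqVlt; apply/orP; left; apply/eqP; ring.
have low : \forall k \near \oo, T k * F k + T k / 4 * dot (d k) (d k)
    + b * (S k * w k) / 4 * B k <= E k.
  near=> k.
  have [k2 w0 w2 ew big] : [/\ (2 <= k)%N, 0 < w k, w k <= 2^-1, eps k <= w k / 8 &
    M0 * S k <= T k * w k] by near: k.
  rewrite /E /B (xP k); apply: weighted_lower_bound => //.
  - by rewrite mulr_ge0 ?pw_ge0 // ltW.
  - exact: pw_ge0.
  - exact: pw_ge0.
  - exact: ltW.
  - apply: le_trans big; rewrite ler_wpM2r ?pw_ge0 // M0E.
    by lra.
have parts_ge0 k : (2 <= k)%N -> [/\ 0 <= T k * F k, 0 <= T k / 4 * dot (d k) (d k) &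
    0 <= b * (S k * w k) / 4 * B k].
  move=> k2; have N0 := dot_ge0 hdot (d k); have B0 := dot_ge0 hdot (x k.-1 - z).
  have w0 : 0 <= w k by rewrite mulr_ge0 ?pw_ge0 // ltW.
  have bSw : 0 <= b * (S k * w k) by rewrite !mulr_ge0 ?pw_ge0 // ltW.
  have T0 : 0 <= T k by exact: pw_ge0.
  by split; [apply: mulr_ge0 => //; exact: F_ge0|apply: mulr_ge0 => //; exact: divr_ge0|
    apply: mulr_ge0 => //; exact: divr_ge0].
have E0 : \forall k \near \oo, 0 <= E k.
  near=> k; have [t1 t2 t3] : [/\ 0 <= T k * F k, 0 <= T k / 4 * dot (d k) (d k) &
    0 <= b * (S k * w k) / 4 * B k] by apply: parts_ge0; near: k; exact: nbhs_infty_ge.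
  have L : T k * F k + T k / 4 * dot (d k) (d k) + b * (S k * w k) / 4 * B k <= E k by near: k.
  by apply: le_trans L; rewrite !addr_ge0.
have G_parts k : (2 <= k)%N -> [/\ 0 <= S k * F k.+1,
    0 <= S k * (eps k / 2 * dot (x k.+1) (x k.+1)),
    0 <= T k * w k / 4 * dot (d k) (d k), 0 <= T k * w k / 4 * dot (d k.+1) (d k.+1) &
    0 <= T k / 4 * dot (d k.+1 - d k) (d k.+1 - d k)].
  move=> k2; have w0 : 0 <= w k by rewrite mulr_ge0 ?pw_ge0 // ltW.
  have e0 : 0 <= eps k by rewrite mulr_ge0 ?pw_ge0 // ltW.
  have T0 : 0 <= T k by exact: pw_ge0.
  have S0 : 0 <= S k by exact: pw_ge0.
  have D0 y : 0 <= dot y y by exact: dot_ge0.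
  have F0 : 0 <= F k.+1 by exact: F_ge0 (leqW k2).
  have al0 : 0 <= alpha by exact: ltW.
  have cc0 : 0 <= c by exact: ltW.
  by split; rewrite !(mulr_ge0, invr_ge0, pw_ge0).
have G_ge k : (2 <= k)%N -> [/\ S k * F k.+1 <= G k,
    S k * (eps k / 2 * dot (x k.+1) (x k.+1)) <= G k,
    T k * w k / 4 * dot (d k) (d k) <= G k &
    T k / 4 * dot (d k.+1 - d k) (d k.+1 - d k) <= G k].
  by move=> /G_parts /le_five_parts; rewrite /G !mulrDr.
have [[M M_ge0 EM] bG] : (exists2 M, 0 <= M & \forall k \near \oo, E k <= M) /\ bsum G.
  (* The factor 8 C2 / alpha is the ratio of the error coefficient 2 b C2 to the coefficient b alpha
     / 4 of the anchor in the lower bound. *)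
  apply: (@gronwall _ E G (fun k => 8 * C2 / alpha * pw (q - 2) k)
     (fun k => b * c / 2 * dot z z * pw (r - 1 - p) k)) => //.
  - by apply: bsumZ; [rewrite divr_ge0 ?mulr_ge0 // ltW|apply: bsum_pw; lra].
  - apply: bsumZ; last by apply: bsum_pw; lra.
    by rewrite !mulr_ge0 ?invr_ge0 ?(dot_ge0 hdot) // ltW.
  - near=> k; have [] : [/\ 0 <= S k * F k.+1,
      0 <= S k * (eps k / 2 * dot (x k.+1) (x k.+1)),
      0 <= T k * w k / 4 * dot (d k) (d k), 0 <= T k * w k / 4 * dot (d k.+1) (d k.+1) &
      0 <= T k / 4 * dot (d k.+1 - d k) (d k.+1 - d k)].
      by apply: G_parts; near: k; exact: nbhs_infty_ge.
    by rewrite /G; lra.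
  - by apply: nearW => k; rewrite mulr_ge0 ?pw_ge0 // divr_ge0 ?mulr_ge0 // ltW.
  - apply: nearW => k; rewrite mulr_ge0 ?pw_ge0 //.
    by rewrite !mulr_ge0 ?invr_ge0 ?(dot_ge0 hdot) // ltW.
  near=> k; have k2 : (2 <= k)%N by near: k; exact: nbhs_infty_ge.
  have k0 : (0 < k)%N by exact: leq_trans k2.
  apply: (le_trans (_ : _ <= E k + 2 * b * C2 * s3 k * B k
    + b * c / 2 * dot z z * pw (r - 1 - p) k)); first by near: k.
  suff : 2 * b * C2 * s3 k * B k <= 8 * C2 / alpha * pw (q - 2) k * E k.
    by move=> sE; rewrite [(1 + _) * E k]mulrDl mul1r lerD2r lerD2l.
  have [t1 t2 _] := parts_ge0 _ k2.
  have L : T k * F k + T k / 4 * dot (d k) (d k) + b * (S k * w k) / 4 * B k <= E k by near: k.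
  apply: (le_trans _ (ler_wpM2l _ (le_trans _ L : b * (S k * w k) / 4 * B k <= _))).
  - rewrite Sw // /s3.
    rewrite s3_E pwD // le_eqVlt; apply/orP; left; apply/eqP; field.
    by rewrite gt_eqF.
  - by rewrite mulr_ge0 ?pw_ge0 // divr_ge0 ?mulr_ge0 // ltW.
  - by lra.
have extract (a : nat -> R) (C : R) : 0 < C ->
    (forall k, (2 <= k)%N -> a k <= C * G k) -> bsum a.
  move=> C0 aG; apply: (bsum_le_of_near C0 _ bG).
  by near=> k; apply: aG; near: k; exact: nbhs_infty_ge.
have Twq k : (2 <= k)%N -> T k * w k = alpha * pw (r - q) k.
  move=> k2; have k0 : (0 < k)%N by exact: leq_trans k2.
  by rewrite /T (pwD r (- q) k0) mulrCA.
split.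
- by apply: (extract _ 1) => // k /G_ge[]; rewrite mul1r.
- apply: (extract _ (2 / c)); first by rewrite divr_gt0.
  move=> k k2; have [_ h2 _ _] := G_ge _ k2.
  have k0 : (0 < k)%N by exact: leq_trans k2.
  apply: (@le_trans _ _ (2 / c * (S k * (eps k / 2 * dot (x k.+1) (x k.+1))))).
    rewrite /S (pwD (r - 1) (- p)) // le_eqVlt; apply/orP; left; apply/eqP; field.
    by rewrite gt_eqF.
  by rewrite ler_pM2l // divr_gt0.
- apply: (extract _ (4 / alpha)); first by rewrite divr_gt0.
  move=> k k2; have [_ _ h2 _] := G_ge _ k2.
  apply: (@le_trans _ _ (4 / alpha * (T k * w k / 4 * dot (d k) (d k)))).
    rewrite Twq // le_eqVlt; apply/orP; left; apply/eqP; field.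
    by rewrite gt_eqF.
  by rewrite ler_pM2l // divr_gt0.
- apply: (extract _ 4) => // k /G_ge[_ _ _ h2].
  by rewrite -ler_pdivrMl // mulrA [4^-1 * _]mulrC.
have ba0 : 0 < b * alpha by rewrite mulr_gt0.
have K0 : 0 < 4 / (b * alpha) by rewrite divr_gt0.
exists (M + 4 * M + 4 / (b * alpha) * M); near=> k.
have k2 : (2 <= k)%N by near: k; exact: nbhs_infty_ge.
have k0 : (0 < k)%N by exact: leq_trans k2.
have L : T k * F k + T k / 4 * dot (d k) (d k) + b * (S k * w k) / 4 * B k <= E k by near: k.
have EkM : E k <= M by near: k.
have [l1 l2 l3] := le_three_parts (parts_ge0 _ k2) L EkM.
have m1 : 0 <= 4 * M by rewrite mulr_ge0.
have m2 : 0 <= 4 / (b * alpha) * M by rewrite mulr_ge0 // ltW.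
split.
- by rewrite (le_trans l1) // -addrA lerDl addr_ge0.
- apply: (@le_trans _ _ (4 * M)); last by rewrite addrAC lerDr addr_ge0.
  by rewrite -ler_pdivrMl // mulrA [4^-1 * _]mulrC.
apply: (@le_trans _ _ (4 / (b * alpha) * M)); last by rewrite lerDr addr_ge0.
rewrite -ler_pdivrMl // invf_div.
apply: le_trans l3; rewrite Sw // le_eqVlt /B; apply/orP; left; apply/eqP; field.
Unshelve. all: by end_near. Qed.

End inertial_sequence.

Lemma sub3_oppr (V : zmodType) (a b c e : V) : a - b - c - e = - ((c - a) + (b + e)).
Proof. by rewrite opprD opprB opprD addrA (addrAC a). Qed.

Lemma dot_sum3_le (R : realType) (H : normedModType R) (dot : {dot H for idfun})
    (x y z : H) (a b : R) : induces_norm dot ->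
  dot (x + (a *: y + b *: z)) (x + (a *: y + b *: z)) <=
  2 * dot x x + 4 * (a ^+ 2 * dot y y) + 4 * (b ^+ 2 * dot z z).
Proof.
move=> hdot; have := dot_sum_le hdot x (a *: y + b *: z).
have := dot_sum_le hdot (a *: y) (b *: z); rewrite !dotZl !dotZr !expr2; lra.
Qed.

(** Arithmetic for [distance_cvg], where S = k^q. Then S w is the constant al, so the squared
    distance enters with a constant weight and can have a limit. *)
Lemma correlation_sum_step (R : realFieldType)
    (al w e ce S S' s3 C F P P' N N' B B' X' A Z M : R) :
  0 <= e -> e <= 1 -> 0 <= F -> 0 <= S -> 0 <= s3 -> 0 <= C ->
  (S' - S) * P' <= (C * S * N' + C * s3 * A) / 2 ->
  S * w = al -> S * e = ce -> 0 <= N' -> 0 <= X' -> 0 <= A -> A <= M ->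
  S * (P' - P) <= S * (- ((1 - (1 - w)) * (B' / 2 - B / 2)) + N / 2 + (2^-1 + e) * N'
    - (F + e / 2 * X' - 0 - e / 2 * Z) - e / 4 * A) ->
  S' * P' + al / 2 * B' <= S * P + al / 2 * B + (2^-1 * (S * N)
    + (3 / 2 + C / 2) * (S * N') + (ce / 2 * Z + C / 2 * M * s3)).
Proof.
move=> e0 e1 F0 S0 s30 C0 P_le <- <- N'0 X'0 A0 AM Co.
have h1 : C * (s3 * A) <= C * (s3 * M) by rewrite !ler_wpM2l.
have h2 : S * (e * N') <= S * N' by rewrite ler_wpM2l // ler_piMl.
have h3 : 0 <= S * F by rewrite mulr_ge0.
have h4 : 0 <= S * (e * X') by rewrite !mulr_ge0.
have h5 : 0 <= S * (e * A) by rewrite !mulr_ge0.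
lra.
Qed.

(** * Summability of the subgradients and convergence of the distances *)

Section inertial_sequence.
Context {R : realType} {H : normedModType R} (dot : {dot H for idfun}).
Hypothesis hdot : induces_norm dot.
Context (q alpha c p : R) (q_gt0 : 0 < q) (q_lt1 : q < 1) (alpha_gt0 : 0 < alpha)
  (c_gt0 : 0 < c) (p_gt1 : 1 < p) (x u : nat -> H) (F : nat -> R).

Local Notation d := (step x).
Local Notation w k := (alpha * pw (- q) k).
Local Notation eps k := (c * pw (- p) k).

Hypothesis uE : forall k, (1 <= k)%N ->
  u k.+1 = (1 - w k) *: d k - d k.+1 - eps k *: x k.
Hypothesis F_ge0 : forall k, (2 <= k)%N -> 0 <= F k.

Let xS k : x k.+1 = x k + d k.+1. Proof. by rewrite /step /= subrKC. Qed.
Let xP k : x k.-1 = x k - d k. Proof. by rewrite /step subKr. Qed.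

Lemma pw_cvg0 (r : R) : r < 0 -> pw r @ \oo --> (0 : R).
Proof.
move=> r0; apply/cvgrPdist_le => e e0; near=> k.
rewrite sub0r normrN ger0_norm ?pw_ge0 // -[e]mulr1 -(pw0 k).
by near: k; exact: pw_small.
Unshelve. all: by end_near. Qed.

Lemma bsum_pw_shift (r : R) (a : nat -> R) : (\forall k \near \oo, 0 <= a k) ->
  bsum (fun k => pw r k * a k.+1) -> bsum (fun k => pw r k * a k).
Proof.
move=> a0 bs; have [C C1 HC] := pw_succ_le r (R := R); apply: bsumS_inv.
apply: (bsum_le_of_near (C := C) _ _ bs); first exact: lt_le_trans C1.
near=> k; rewrite mulrA ler_wpM2r //.
  by near: k; exact: (near_succ a0).
by apply: (HC k _).1; near: k; exact: nbhs_infty_gt.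
Unshelve. all: by end_near. Qed.

(** Up to sign, u_(k+1) is the second difference plus w d_k plus eps x_k. Squaring loses nothing:
    k^(r-2q) <= k^(r-q) and, since p > 1, k^(r-2p) <= k^(r-1-p). *)
Lemma gradient_sum (r : R) : q < 1 ->
  bsum (fun k => pw (r - 1 - p) k * dot (x k.+1) (x k.+1)) ->
  bsum (fun k => pw (r - q) k * dot (d k) (d k)) ->
  bsum (fun k => pw r k * dot (d k.+1 - d k) (d k.+1 - d k)) ->
  bsum (fun k => pw r k * dot (u k) (u k)).
Proof.
move: (q_gt0) (p_gt1) => q0 p1 q1 bX bN be.
apply: bsum_pw_shift; first by apply: nearW => k; exact: dot_ge0.
have {}bX : bsum (fun k => pw (r - 1 - p) k * dot (x k) (x k)).
  by apply: bsum_pw_shift bX; apply: nearW => k; exact: dot_ge0.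
have al0 : 0 <= alpha ^+ 2 by exact: sqr_ge0.
have cc0 : 0 <= c ^+ 2 by exact: sqr_ge0.
have al4 : 0 <= 4 * alpha ^+ 2 by exact: mulr_ge0.
have cc4 : 0 <= 4 * c ^+ 2 by exact: mulr_ge0.
apply: bsum_near (bsumD (bsumZ (ler0n _ 2) be) (bsumD (bsumZ al4 bN) (bsumZ cc4 bX))).
near=> k; have k0 : (0 < k)%N by near: k; exact: nbhs_infty_gt.
have uE' : u k.+1 = - ((d k.+1 - d k) + (w k *: d k + eps k *: x k)).
  by rewrite uE // scalerBl scale1r sub3_oppr.
have N0 := dot_ge0 hdot (d k); have X0 := dot_ge0 hdot (x k).
have l1 : dot (u k.+1) (u k.+1) <= 2 * dot (d k.+1 - d k) (d k.+1 - d k)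
    + 4 * (w k ^+ 2 * dot (d k) (d k)) + 4 * (eps k ^+ 2 * dot (x k) (x k)).
  by rewrite uE' dotNl dotNr opprK; exact: dot_sum3_le.
apply: (le_trans (ler_wpM2l (pw_ge0 r k) l1)).
have l2 : pw r k * w k ^+ 2 <= alpha ^+ 2 * pw (r - q) k.
  rewrite exprMn mulrCA ler_wpM2l // -pwX2 -pwD // pw_le //; lra.
have l3 : pw r k * eps k ^+ 2 <= c ^+ 2 * pw (r - 1 - p) k.
  rewrite exprMn mulrCA ler_wpM2l // -pwX2 -pwD // pw_le //; lra.
have := ler_wpM2r N0 l2; have := ler_wpM2r X0 l3.
move: (w k ^+ 2) (eps k ^+ 2) (alpha ^+ 2) (c ^+ 2) => *; lra.
Unshelve. all: by end_near. Qed.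

(* [alpha / 2 * |x (k-1) - z|^2 + k^q * dot (d k) (x k - z)] decreases up to a
   summable error, and its second term vanishes in the limit. *)
Lemma distance_cvg (z : H) (M : R) : q + 1 < p ->
  (forall k, (2 <= k)%N -> F k <= dot (u k) (x k - z)) ->
  bsum (fun k => pw 1 k * dot (d k) (d k)) ->
  (\forall k \near \oo, pw (q + 1) k * dot (d k) (d k) <= M) ->
  (\forall k \near \oo, dot (x k.-1 - z) (x k.-1 - z) <= M) ->
  cvgn (fun k => dot (x k - z) (x k - z)).
Proof.
move: (q_gt0) (q_lt1) (p_gt1) => q0 q1 p1 qp Fz bN NM BM.
have [C C0 HC] := pw_diff q (R := R).
pose P k := dot (d k) (x k - z); pose B k := dot (x k.-1 - z) (x k.-1 - z).
have BM1 : \forall k \near \oo, dot (x k - z) (x k - z) <= M := near_succ BM.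
have BM2 : \forall k \near \oo, dot (x k.+1 - z) (x k.+1 - z) <= M := near_succ BM1.
have qP0 : (fun k => pw q k * P k) @ \oo --> (0 : R).
  (* Young with weights k^s and k^-s leaves the factors k^(s-1) and k^(q-s) on two bounded
     quantities. This s is the midpoint of q and 1, so both exponents are negative. *)
  pose s : R := (q + 1) / 2.
  have b0 : (fun k => 2^-1 * M * (pw (s - 1) k + pw (q - s) k)) @ \oo --> (0 : R).
    rewrite -[0](mulr0 (2^-1 * M)); apply: cvgM; first exact: cvg_cst.
    rewrite -[0](addr0 0); apply: cvgD; apply: pw_cvg0; rewrite /s; lra.
  apply/norm_cvg0P; apply: (squeeze_cvgr (f := fun=> 0)) b0; last exact: cvg_cst.
  near=> k; have k0 : (0 < k)%N by near: k; exact: nbhs_infty_gt.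
  rewrite normr_ge0 /= normrM ger0_norm ?pw_ge0 //.
  have NMk : pw (q + 1) k * dot (d k) (d k) <= M by near: k.
  have BMk : dot (x k - z) (x k - z) <= M by near: k.
  have ss : 1 <= pw s k * pw (- s) k by rewrite -pwD // subrr pw0.
  have P2 : 2 * `|P k| <= pw s k * dot (d k) (d k) + pw (- s) k * dot (x k - z) (x k - z).
    have h1 : (1 : R) ^+ 2 <= pw s k * pw (- s) k by rewrite expr1n.
    have := dot_young_norm hdot (d k) (x k - z) (pw_ge0 _ _) (pw_ge0 _ _) h1.
    by rewrite mulr1.
  have := ler_wpM2l (pw_ge0 q k) P2; rewrite mulrDr !mulrA -!pwD //.
  have -> : pw (q + s) k = pw (s - 1) k * pw (q + 1) k.
    by rewrite -pwD //; congr pw; lra.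
  have e1 := ler_wpM2l (pw_ge0 (s - 1) k) NMk.
  have e2 := ler_wpM2l (pw_ge0 (q - s) k) BMk.
  rewrite -[_ * pw (q + 1) k * _]mulrA => e3.
  rewrite -(ler_pM2l (_ : 0 < 2 :> R)) // [leLHS]mulrCA mulrA; lra.
pose Y k := pw q k * P k + alpha / 2 * B k.
(* The Tikhonov value at z contributes k^(q-p), summable because p > q + 1; the variation of k^q
   contributes k^(q-2), summable because q < 1. *)
pose zeta k := 2^-1 * (pw q k * dot (d k) (d k))
  + (3 / 2 + C / 2) * (pw q k * dot (d k.+1) (d k.+1))
  + (c / 2 * dot z z * pw (q - p) k + C / 2 * `|M| * pw (q - 2) k).
have zeta0 k : 0 <= zeta k.
  have Z0 := dot_ge0 hdot z; have N0 := dot_ge0 hdot (d k).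
  have N'0 := dot_ge0 hdot (d k.+1); have c0 := ltW c_gt0.
  by rewrite /zeta !addr_ge0 // !(mulr_ge0, pw_ge0, addr_ge0, invr_ge0).
have bzeta : bsum zeta.
  have bqN : bsum (fun k => pw q k * dot (d k) (d k)).
    apply: bsum_near bN; near=> k; rewrite ler_wpM2r ?(dot_ge0 hdot) // pw_le //; last by lra.
    by near: k; exact: nbhs_infty_gt.
  have bqN' : bsum (fun k => pw q k * dot (d k.+1) (d k.+1)).
    apply: bsum_near (bsumS bqN); apply: nearW => k.
    by rewrite ler_wpM2r ?(dot_ge0 hdot) // pw_mono //; lra.
  have k1 : 0 <= 2^-1 :> R by rewrite invr_ge0.
  have k2 : 0 <= 3 / 2 + C / 2 by rewrite addr_ge0 // divr_ge0.
  have k3 : 0 <= c / 2 * dot z z by rewrite mulr_ge0 ?(dot_ge0 hdot) // divr_ge0 // ltW.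
  have k4 : 0 <= C / 2 * `|M| by rewrite mulr_ge0 // divr_ge0.
  apply: bsumD (bsumD (bsumZ k1 bqN) (bsumZ k2 bqN')) (bsumD (bsumZ k3 _) (bsumZ k4 _));
    apply: bsum_pw; lra.
have Ylow : \forall k \near \oo, - 1 <= Y k.
  have : \forall k \near \oo, `|0 - pw q k * P k| < 1 by move/cvgrPdist_lt: qP0; apply.
  move=> H1; near=> k.
  have : `|0 - pw q k * P k| < 1 by near: k.
  rewrite sub0r normrN ltr_norml => /andP[h _].
  have : 0 <= alpha / 2 * B k.
    by rewrite mulr_ge0 ?(dot_ge0 hdot) // divr_ge0 // ltW.
  rewrite /Y; lra.
have Ystep : \forall k \near \oo, Y k.+1 <= Y k + zeta k.
  near=> k.
  have [k2 w0 w2 ew] : [/\ (2 <= k)%N, 0 < w k, w k <= 2^-1 & eps k <= w k / 8].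
    by near: k; apply: (near_coefficients q_gt0 q_lt1 alpha_gt0 c_gt0 p_gt1); rewrite invr_gt0.
  have k0 : (0 < k)%N by exact: leq_trans k2.
  have e0 : 0 <= eps k by rewrite mulr_ge0 ?pw_ge0 // ltW.
  have a01 : 0 <= 1 - w k <= 1 by apply/andP; split; lra.
  have := @correlation_step R H dot hdot (x k) (d k) (d k.+1) (u k.+1) z _ _ (F k.+1) 0
    a01 e0 (uE k0).
  rewrite -xS -xP subr0 => /(_ (Fz _ (leqW k2))) /(ler_wpM2l (pw_ge0 q k)).
  have A_le : dot (x k.+1 - z) (x k.+1 - z) <= `|M|.
    by apply: (@le_trans _ _ M); [near: k | exact: ler_norm].
  move=> Co; have F0 := F_ge0 (leqW k2).
  have S0 := pw_ge0 q k.
  have SS := HC _ k0.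
  have Sw : pw q k * w k = alpha by rewrite mulrCA -pwD // subrr pw0 mulr1.
  have Se : pw q k * eps k = c * pw (q - p) k by rewrite mulrCA -pwD.
  have s2S : pw (q - 1) k ^+ 2 <= pw q k * pw (q - 2) k.
    by rewrite -pwX2 -pwD // le_eqVlt; apply/orP; left; apply/eqP; congr pw; lra.
  have Cs2S : (C * pw (q - 1) k) ^+ 2 <= C * pw q k * (C * pw (q - 2) k).
    by rewrite exprMn [leRHS]mulrACA -expr2 ler_wpM2l ?sqr_ge0.
  have P_le := dot_scaled_le hdot (d k.+1) (x k.+1 - z) (mulr_ge0 C0 S0)
    (mulr_ge0 C0 (pw_ge0 (q - 2) k)) SS Cs2S.
  have X'0 := dot_ge0 hdot (x k.+1); have N'0 := dot_ge0 hdot (d k.+1).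
  have A0 := dot_ge0 hdot (x k.+1 - z); have Z0 := dot_ge0 hdot z.
  rewrite /Y /zeta /B /P /=.
  have e1 : eps k <= 1 by lra.
  have pc : c / 2 * dot z z * pw (q - p) k = c * pw (q - p) k / 2 * dot z z by ring.
  rewrite pc.
  exact: (correlation_sum_step e0 e1 F0 S0 (pw_ge0 _ k) C0 P_le Sw Se N'0 X'0 A0 A_le Co).
have cY : cvgn Y by exact: (quasi_decreasing_cvg bzeta (nearW _ zeta0) Ylow Ystep).
have cB : cvgn B.
  have -> : B = (fun k => 2 / alpha * (Y k - pw q k * P k)).
    apply/funext => k; rewrite /Y; field; rewrite gt_eqF //.
  apply/cvg_ex; exists (2 / alpha * (limn Y - 0)).
  by apply: cvgM; [exact: cvg_cst|apply: (cvgB cY qP0)].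
apply/cvg_ex; exists (limn B).
by have := cB; rewrite -cvg_shiftS.
Unshelve. all: by end_near. Qed.

End inertial_sequence.

(** * The energy with a moving target *)

Section moving_target_step.
Context {R : realType} {H : normedModType R} (dot : {dot H for idfun}).
Hypothesis hdot : induces_norm dot.
Implicit Types (x d u y z : H).

(* Here S = k^-q, the targets at k and k + 1 are y and y', and the weight al / 16 is
   small enough for the damping al * S / 2 to absorb the kinetic error terms. *)
Lemma moving_target_step x d d' u' y y' (al e e' F F' Fy m m' S S' t s1 : R) :
  0 < al -> 0 < S -> al * S <= 2^-1 -> 0 < e -> e <= al * S / 8 -> e' <= e ->
  0 <= S' -> S' <= S -> `|S' - S| <= t -> t ^+ 2 <= (S / 16) * (S * e / 16) ->
  u' = (1 - al * S) *: d - d' - e *: x ->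
  F' - F <= dot u' d' -> F' - Fy <= dot u' (x + d' - y) ->
  m = Fy + e / 2 * dot y y -> m - m' <= s1 ->
  F' + e' / 2 * dot (x + d') (x + d') - m' + dot d' d' / 2
  + al / 16 * (S' * dot d' (x + d' - y') + S' * (al * S') * (dot (x - y') (x - y') / 2))
  + (al * S / 4 * (dot d d + dot d' d')
     + al / 16 * S * (F' + e / 2 * dot (x + d') (x + d') - m)
     + al / 16 * S * (e / 8) * dot (x + d' - y) (x + d' - y)) <=
  F + e / 2 * dot x x - m + dot d d / 2
  + al / 16 * (S * dot d (x - y) + S * (al * S) * (dot (x - d - y) (x - d - y) / 2))
  + s1 + al / 16 * S * dot (y' - y) (y' - y)
  + al / 2 * S * ((al * S) ^+ 2 / e) * dot (y' - y) (y' - y).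
Proof.
move=> al0 S0 w2 e0 ew e'e S'0 S'S SS tS uE HF HFy mE ms.
have w0 : 0 < al * S by rewrite mulr_gt0.
have a01 : 0 <= 1 - al * S <= 1 by apply/andP; split; lra.
have e1 : e <= 16^-1 by lra.
have En := energy_step uE HF.
have Co := @correlation_step R H dot hdot x d d' u' y _ _ F' Fy a01 (ltW e0) uE HFy.
have Al0 : 0 <= al / 16 * S by rewrite mulr_ge0 ?divr_ge0 // ltW.
move/(ler_wpM2l Al0): Co => Co.
(* Everything is expressed with the old target y, for which [correlation_step] holds; the target
   shift y' - y is then estimated separately. *)
have -> : x + d' - y' = (x + d' - y) - (y' - y) by rewrite opprB addrA subrK.
have -> : x - y' = (x - y) - (y' - y) by rewrite opprB addrA subrK.
have N0 := dot_ge0 hdot d; have N'0 := dot_ge0 hdot d'.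
have X'0 := dot_ge0 hdot (x + d').
have A0 := dot_ge0 hdot (x + d' - y); have D0 := dot_ge0 hdot (x - y).
have D_le : dot (x - y) (x - y) <=
    2 * dot d' d' + 2 * dot (x + d' - y) (x + d' - y).
  have := dot_sum_le hdot (- d') (x + d' - y).
  have -> : - d' + (x + d' - y) = x - y by rewrite addrA addrCA addNr addr0.
  by rewrite dotNl dotNr opprK.
have p1 : (S' - S) * dot d' (x + d' - y) <=
    (S / 16 * dot d' d' + S * e / 16 * dot (x + d' - y) (x + d' - y)) / 2.
  have c1 : 0 <= S / 16 by rewrite divr_ge0 // ltW.
  have c2 : 0 <= S * e / 16 by rewrite divr_ge0 // mulr_ge0 // ltW.
  exact: (dot_scaled_le hdot d' (x + d' - y) c1 c2 SS tS).
rewrite [dot d' (_ - (y' - y))]dotDr [dot (x - y - _) _]dotDl [dot (x - y) (_ - _)]dotDr.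
rewrite [dot (- (y' - y)) (_ - _)]dotDr !(dotNl dot (y' - y)) !(dotNr dot (y' - y)).
rewrite (dotC dot (y' - y) (x - y)).
have DD0 := dot_ge0 hdot (y' - y).
have p2 : S' * - dot d' (y' - y) <= S / 2 * (dot d' d' + dot (y' - y) (y' - y)).
  have SS' : `|- S'| <= S by rewrite normrN ger0_norm.
  have S2 : S ^+ 2 <= S * S by rewrite expr2.
  have := dot_scaled_le hdot d' (y' - y) (ltW S0) (ltW S0) SS' S2.
  rewrite mulNr mulrN => h; apply: (le_trans h).
  by rewrite le_eqVlt; apply/orP; left; apply/eqP; ring.
have S'w' : S' * (al * S') <= S * (al * S).
  by rewrite ler_pM ?mulr_ge0 ?(ltW al0) // ler_wpM2l // ltW.
have S'w'0 : 0 <= S' * (al * S') by rewrite !mulr_ge0 // ltW.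
(* The cross term of the anchor with the target shift is charged to the strong convexity e |x -
   y|^2. This costs the factor (al S)^2 / e in front of the squared shift. *)
have p3 : S' * (al * S') * - dot (x - y) (y' - y) <=
   S * ((e / 16 * dot (x - y) (x - y)
     + 16 * ((al * S) ^+ 2 / e) * dot (y' - y) (y' - y)) / 2).
  have c1 : 0 <= S * (e / 16) by rewrite mulr_ge0 ?divr_ge0 // ltW.
  have c2 : 0 <= S * (16 * ((al * S) ^+ 2 / e)).
    have Q0 : 0 <= (al * S) ^+ 2 / e by apply: divr_ge0; [exact: sqr_ge0|exact: ltW].
    exact: mulr_ge0 (ltW S0) (mulr_ge0 (ler0n _ 16) Q0).
  have c3 : (S * (al * S)) ^+ 2 <= S * (e / 16) * (S * (16 * ((al * S) ^+ 2 / e))).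
    rewrite le_eqVlt; apply/orP; left; apply/eqP; field.
    by rewrite gt_eqF.
  have c4 : `|- (S' * (al * S'))| <= S * (al * S) by rewrite normrN ger0_norm.
  have := dot_scaled_le hdot (x - y) (y' - y) c1 c2 c4 c3.
  rewrite mulNr mulrN => h; apply: (le_trans h).
  by move: (_ / e) => Q; rewrite le_eqVlt; apply/orP; left; apply/eqP; ring.
have p4 : S' * (al * S') * dot (x - y) (x - y) <= S * (al * S) * dot (x - y) (x - y).
  by rewrite ler_wpM2r.
have p5 : S' * (al * S') * dot (y' - y) (y' - y) <= S * dot (y' - y) (y' - y) / 2.
  apply: (le_trans (ler_wpM2r DD0 S'w')).
  have := ler_wpM2l (mulr_ge0 (ltW S0) DD0) w2; lra.
have p6 : e' / 2 * dot (x + d') (x + d') <= e / 2 * dot (x + d') (x + d').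
  by rewrite ler_wpM2r // ler_pM2r // invr_gt0.
have p7 : e * dot d' d' <= al * S / 8 * dot d' d' by rewrite ler_wpM2r.
move: ((al * S) ^+ 2 / e) p3 => Q p3.
move: (dot d' (x + d' - y)) (dot d (x - y)) (dot (x + d' - y) (x + d' - y))
  (dot (x - d - y) (x - d - y)) (dot (x - y) (x - y)) (dot (x + d') (x + d'))
  (dot d d) (dot d' d') (dot (d' - d) (d' - d)) (dot x x) (dot y y)
  (dot (y' - y) (y' - y)) (dot d' (y' - y)) (dot (x - y) (y' - y)) (dot_ge0 hdot (d' - d))
  mE En Co N0 N'0 X'0 A0 D0 D_le p1 p2 p3 p4 p5 p6 p7 DD0
  => P' P A B B' X' N N' E X Y D2 dD xD E0 mE En Co N0 N'0 X'0 A0 D0 D_le p1 p2 p3 p4 p5 p6 p7 DD0.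
have al16 : 0 <= al / 16 by rewrite divr_ge0 // ltW.
have q1 := ler_wpM2l al16 p1; have q2 := ler_wpM2l al16 p2; have q3 := ler_wpM2l al16 p3.
have q4 := ler_wpM2l al16 p4; have q5 := ler_wpM2l al16 p5.
have q6 := ler_wpM2l Al0 (ler_wpM2l (ltW e0) D_le).
have q7 := ler_wpM2l Al0 (ler_wpM2r N'0 e1).
have q8 : 0 <= (1 - al * S) * E by rewrite mulr_ge0 //; case/andP: a01.
have q9 : 0 <= al * S * N by rewrite mulr_ge0 // ltW.
have q10 : 0 <= al * S * N' by rewrite mulr_ge0 // ltW.
have q11 : 0 <= al * S * (e * A) by rewrite !mulr_ge0 // ltW.
have q12 : 0 <= al * S * D2 by rewrite mulr_ge0 // ltW.
subst m; clear -ms En Co q1 q2 q3 q4 q5 q6 q7 q8 q9 q10 q11 q12 p6 p7.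
lra.
Qed.

End moving_target_step.

Section moving_target_bounds.
Context {R : realType} {H : normedModType R} (dot : {dot H for idfun}).
Hypothesis hdot : induces_norm dot.
Implicit Types (d r g : H).

(** Every term on the right has a counterpart in the dissipation of [moving_target_step] or in its
    source; this is what turns that dissipation into a contraction. Here r is the distance vector to
    the old target and g the target shift. *)
Lemma moving_target_upper_bound d r g (al S S' : R) : 0 < al -> 0 <= S' -> S' <= S -> S <= 1 ->
  dot d d / 2 + al / 16 * (S' * dot d (r - g)
    + S' * (al * S') * (dot (r - g - d) (r - g - d) / 2)) <=
  (1 + al / 16 * (1 + 2 * al)) * dot d d
  + (1 + al / 16 * (1 + 2 * al)) * (S ^+ 2 * dot r r)
  + (1 + al / 16 * (1 + 2 * al)) * (S ^+ 2 * dot g g).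
Proof.
move=> al0 S'0 S'S S1.
have N0 := dot_ge0 hdot d; have r0 := dot_ge0 hdot r; have g0 := dot_ge0 hdot g.
have rg := dot_sum_le hdot r (- g); rewrite (dotNl dot g) (dotNr dot g) opprK in rg.
have rgd := dot_sum_le hdot (r - g) (- d); rewrite (dotNl dot d) (dotNr dot d) opprK in rgd.
have P := @dot_young R H dot hdot 1 (S' ^+ 2) S' d (r - g) ler01 (sqr_ge0 _).
rewrite mul1r in P; have {}P := P (lexx _).
have SS : S' ^+ 2 <= S ^+ 2 by rewrite lerXn2r // nnegrE (le_trans S'0).
have SS1 : S ^+ 2 <= 1 by rewrite exprn_ile1 // (le_trans S'0).
have S'al : S' * (al * S') = al * S' ^+ 2 by rewrite expr2; ring.
rewrite S'al; have S20 := sqr_ge0 S'.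
move: (S' ^+ 2) (S ^+ 2) (dot (r - g) (r - g)) (dot (r - g - d) (r - g - d)) (dot d (r - g))
  (dot d d) (dot r r) (dot g g) P rg rgd N0 r0 g0 SS SS1 S20 (dot_ge0 hdot (r - g)) {S'al}
  => T' T Y B P' N r1 g1 P rg rgd N0 r0 g0 SS SS1 T'0 Y0.
have b0 : 0 <= al / 16 by rewrite divr_ge0 // ltW.
have h1 := ler_wpM2l (mulr_ge0 b0 T'0) rg.
have h2 := ler_wpM2l (mulr_ge0 (mulr_ge0 b0 (ltW al0)) T'0) rgd.
have h3 := ler_wpM2l (mulr_ge0 (mulr_ge0 b0 (ltW al0)) T'0) rg.
have h4 := ler_wpM2l b0 P.
have k1 : T' * r1 <= T * r1 by rewrite ler_wpM2r.
have k2 : T' * g1 <= T * g1 by rewrite ler_wpM2r.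
have k3 : T' * N <= N by rewrite ler_piMl // (le_trans SS).
have k4 := ler_wpM2l b0 k1; have k5 := ler_wpM2l b0 k2.
have b1 : 0 <= al / 16 * al by rewrite mulr_ge0 // ltW.
have k6 := ler_wpM2l b1 k1; have k7 := ler_wpM2l b1 k2; have k8 := ler_wpM2l b1 k3.
have T0 : 0 <= T by exact: le_trans SS.
have m1 : 0 <= T * r1 by rewrite mulr_ge0.
have m2 : 0 <= T * g1 by rewrite mulr_ge0.
have m3 : 0 <= al / 16 * N by rewrite mulr_ge0.
have m4 : 0 <= al / 16 * al * N by rewrite mulr_ge0.
clear -h1 h2 h3 h4 k4 k5 k6 k7 k8 m1 m2 m3 m4 N0; lra.
Qed.

(** Young with weights 4 / al and al S^2 / 4 charges the correlation to a quarter of |d|^2 and to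
    part of the anchor; al S <= 1/2 controls the loss from r - d to r. *)
Lemma moving_target_lower_bound d r (al S : R) : 0 < al -> 0 < S -> al * S <= 2^-1 ->
  dot d d / 4 + al ^+ 2 / 128 * (S ^+ 2 * dot r r) <=
  dot d d / 2 + al / 16 * (S * dot d r + S * (al * S) * (dot (r - d) (r - d) / 2)).
Proof.
move=> al0 S0 w2; have N0 := dot_ge0 hdot d; have r0 := dot_ge0 hdot r.
have := dot_sum_le hdot (r - d) d; rewrite subrK => rd.
have c1 : 0 <= 4 / al by rewrite divr_ge0 // ltW.
have c2 : 0 <= al * S ^+ 2 / 4 by rewrite divr_ge0 // mulr_ge0 ?sqr_ge0 // ltW.
have c3 : (- S) ^+ 2 <= 4 / al * (al * S ^+ 2 / 4).
  by rewrite sqrrN le_eqVlt; apply/orP; left; apply/eqP; field; rewrite gt_eqF.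
have Y := dot_young hdot d r c1 c2 c3.
have b0 : 0 <= al / 16 by rewrite divr_ge0 // ltW.
have := ler_wpM2l b0 Y.
have -> : al / 16 * (4 / al * dot d d + al * S ^+ 2 / 4 * dot r r) =
  dot d d / 4 + al ^+ 2 / 64 * (S ^+ 2 * dot r r) by field; rewrite gt_eqF.
have s0 : 0 <= al / 16 * (al * S ^+ 2) by rewrite mulr_ge0 // mulr_ge0 ?sqr_ge0 // ltW.
have := ler_wpM2l s0 rd.
have w4 : (al * S) ^+ 2 <= 4^-1.
  have -> : 4^-1 = 2^-1 ^+ 2 :> R by rewrite expr2; lra.
  have wS0 : 0 <= al * S by rewrite mulr_ge0 // ltW.
  by rewrite !expr2 ler_pM.
have := ler_wpM2r N0 w4.
rewrite !expr2; move: (dot (r - d) (r - d)) (dot d r) (dot d d) (dot r r) N0 r0 => B P N r1 N0 r0.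
clear -N0; lra.
Qed.

(** Here z = k^-om. The upper bound on V', multiplied by kap z, is absorbed term by term: z <= S
    handles the gap and the kinetic part, and the bound of z S^2 by a multiple of S e handles the
    distance A. *)
Lemma decay_step_arith (al S e z kap C G N N' A D2 s1 V V' r : R) :
  0 < al -> 0 <= S -> S <= 1 -> 0 <= z -> z <= S -> 0 <= kap -> kap <= 1 -> kap <= al / 16 ->
  1 <= C -> kap * C <= al / 4 -> kap * C <= 1 ->
  kap * C * (z * S ^+ 2) <= al / 16 * S * (e / 8) ->
  0 <= G -> 0 <= N -> 0 <= N' -> 0 <= A -> 0 <= D2 -> 0 <= s1 ->
  V' + (al * S / 4 * (N + N') + al / 16 * S * G + al / 16 * S * (e / 8) * A) <= V + r ->
  V' <= G + C * N' + C * (S ^+ 2 * A) + C * (S ^+ 2 * D2) + s1 ->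
  V' + kap * z * V' <= V + (r + S * D2 + s1).
Proof.
move=> al0 S0 S1 z0 zS k0 k1 kal C1 kC kC1 kA G0 N0 N'0 A0 D20 s10 Hs Hu.
have z1 : z <= 1 by exact: le_trans S1.
have kC0 : 0 <= kap * C by rewrite mulr_ge0 // (le_trans ler01).
have kz0 : 0 <= kap * z by rewrite mulr_ge0.
have kzle : kap * z <= al / 16 * S by exact: ler_pM.
have h0 := ler_wpM2l kz0 Hu.
have h1 : kap * z * G <= al / 16 * S * G by rewrite ler_wpM2r.
have h2 : kap * C * (z * N') <= al / 4 * (S * N').
  exact: ler_pM kC0 (mulr_ge0 z0 N'0) kC (ler_wpM2r N'0 zS).
have h3 : kap * C * (z * S ^+ 2) * A <= al / 16 * S * (e / 8) * A by rewrite ler_wpM2r.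
have S2 : S ^+ 2 <= S by rewrite expr2 ler_piMr.
have h4 : kap * C * (z * (S ^+ 2 * D2)) <= 1 * (1 * (S * D2)).
  have SD0 := mulr_ge0 (sqr_ge0 S) D20.
  exact: ler_pM kC0 (mulr_ge0 z0 SD0) kC1 (ler_pM z0 SD0 z1 (ler_wpM2r D20 S2)).
have h5 : kap * z * s1 <= 1 * s1.
  by rewrite ler_wpM2r // -[leRHS](mulr1 1) ler_pM.
have h6 : 0 <= al * S * N by rewrite !mulr_ge0 // ltW.
clear -h0 h1 h2 h3 h4 h5 h6 Hs; move: (S ^+ 2) h0 h3 h4 => T h0 h3 h4; lra.
Qed.

End moving_target_bounds.

Lemma source_arith (R : realFieldType) (a b s S D Q g C1 C2 C3 : R) :
  0 <= a -> 0 <= b -> s <= C1 * g -> S * D <= C2 * g -> S * Q * D <= C3 * g ->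
  s + a * S * D + b * S * Q * D + S * D + s <= (2 * C1 + (a + 1) * C2 + b * C3) * g.
Proof.
move=> a0 b0 h1 h2 h3; have := ler_wpM2l a0 h2; have := ler_wpM2l b0 h3; lra.
Qed.

Section arithmetic.
Context {R : realFieldType}.
Implicit Types a b c e m s t : R.

(** A root-free substitute for sqrt c / 16. The value c / 256 is the coefficient of (S / 16) (S e /
    16) when e = c k^-p. *)
Lemma small_square c : 0 < c -> exists2 t, 0 < t & t ^+ 2 <= c / 256.
Proof.
move=> c0; have c10 : 0 < 16 * (c + 1) by lra.
exists (c / (16 * (c + 1))); first exact: divr_gt0.
rewrite expr_div_n ler_pdivrMr ?exprn_gt0 // -mulrA ler_pM2l // exprMn.
have : 16 ^+ 2 = 256 :> R by rewrite expr2; lra.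
move=> ->; rewrite mulrA mulVf ?mul1r; last by rewrite gt_eqF //; lra.
by rewrite expr2; nra.
Qed.

Lemma tikhonov_shift a b e e' t s : a <= b + e / 2 * t -> (e - e') * t <= 2 * s ->
  a - (b + e' / 2 * t) <= s.
Proof. lra. Qed.

Lemma tikhonov_shift_sum a b e e' m m' s t a1 a2 a3 : a <= a1 + a2 + a3 -> m - m' <= s ->
  e' * t <= e * t -> b + e' / 2 * t - m' + a <= b + e / 2 * t - m + a1 + a2 + a3 + s.
Proof. lra. Qed.

End arithmetic.

(** * Power decay along the curve of regularized minimizers *)

Section viscosity_decay.
Context {R : realType} {H : normedModType R} (dot : {dot H for idfun}).
Hypothesis hdot : induces_norm dot.
Context (q alpha c p : R) (q_gt0 : 0 < q) (q_lt1 : q < 1) (alpha_gt0 : 0 < alpha)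
  (c_gt0 : 0 < c) (p_gt1 : 1 < p) (x u y : nat -> H) (F Fy : nat -> R).

Local Notation d := (step x).
Local Notation w k := (alpha * pw (- q) k).
Local Notation eps k := (c * pw (- p) k).

Hypothesis uE : forall k, (1 <= k)%N ->
  u k.+1 = (1 - w k) *: d k - d k.+1 - eps k *: x k.
Hypothesis F_dec : forall k, (2 <= k)%N -> F k.+1 - F k <= dot (u k.+1) (d k.+1).
Hypothesis F_sub : forall k j, (2 <= k)%N -> (2 <= j)%N ->
  F k - Fy j <= dot (u k) (x k - y j).
Hypothesis y_growth : forall k j, (2 <= k)%N -> (2 <= j)%N ->
  Fy j + eps j / 2 * dot (y j) (y j) + eps j / 2 * dot (x k - y j) (x k - y j) <=
  F k + eps j / 2 * dot (x k) (x k).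
Hypothesis y_min : forall i j, (2 <= i)%N -> (2 <= j)%N ->
  Fy j + eps j / 2 * dot (y j) (y j) <= Fy i + eps j / 2 * dot (y i) (y i).

Definition viscosity_gap k :=
  F k + eps k / 2 * dot (x k) (x k) - (Fy k + eps k / 2 * dot (y k) (y k)).

Let xS k : x k.+1 = x k + d k.+1. Proof. by rewrite /step /= subrKC. Qed.
Let xP k : x k.-1 = x k - d k. Proof. by rewrite /step subKr. Qed.

(** The contraction rate is limited by q for the gap and the kinetic part, and by p - q for the
    anchor, since only S e |x - y|^2 is dissipated against S^2 |x - y|^2 in the energy. The three
    bounds on th + om are the orders of the sources: k^(-p-1) from the decrease of the
    regularization, k^(-q-2) from the target shift with weight S, and k^(-3q-2+p) from the shift
    with the extra factor w^2 / eps. *)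
Lemma viscosity_decay (om th L Cy : R) : p < 2 -> q <= om -> p - q <= om -> om < 1 ->
  th + om <= p + 1 -> th + om <= q + 2 -> th + om <= 3 * q + 2 - p ->
  0 <= L -> (forall k, (2 <= k)%N -> dot (y k) (y k) <= L) ->
  0 <= Cy -> (\forall k \near \oo, dot (y k.+1 - y k) (y k.+1 - y k) <= Cy * pw (- 2) k) ->
  exists M, \forall k \near \oo,
    [/\ 0 <= viscosity_gap k, viscosity_gap k <= M * pw (- th) k,
      dot (d k) (d k) <= M * pw (- th) k,
      pw (- p) k * dot (x k - y k) (x k - y k) <= M * pw (- th) k &
      pw (- (2 * q)) k * dot (x k - y k) (x k - y k) <= M * pw (- th) k].
Proof.
move: (q_gt0) (q_lt1) (p_gt1) (alpha_gt0) (c_gt0)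
  => q0 q1 p1 al0 c0 p2 qom pqom om1 th1 th2 th3 L0 yL Cy0 yCy.
have qN : - q <= 0 by lra.
have pN : - p <= 0 by lra.
have exp_t : - q - 1 < - q - p / 2 by lra.
have exp_t2 : 2 * (- q - p / 2) = - q + - q + - p by lra.
have omq : - om <= - q by lra.
have exp_om : - om + 2 * - q <= - q + - p by lra.
have exp1 : - p - 1 <= - th - om by lra.
have exp2 : - q + - 2 <= - th - om by lra.
have exp3 : - q + (2 * - q + p) + - 2 <= - th - om by lra.
have om0 : 0 <= om by lra.
have al4 : alpha / 16 <= alpha / 4 by lra.
have [C2 C20 HC2] := pw_diff (- q) (R := R).
have C21 : 0 < C2 + 1 by lra.
have [C3 C30 HC3] := pw_diff (- p) (R := R).
pose S k : R := pw (- q) k.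
pose m k := Fy k + eps k / 2 * dot (y k) (y k).
pose A k := dot (x k - y k) (x k - y k).
pose D2 k := dot (y k.+1 - y k) (y k.+1 - y k).
pose s1 k : R := c * C3 * L / 2 * pw (- p - 1) k.
pose V k := F k + eps k / 2 * dot (x k) (x k) - m k + dot (d k) (d k) / 2
  + alpha / 16 * (S k * dot (d k) (x k - y k)
      + S k * (alpha * S k) * (dot (x k - d k - y k) (x k - d k - y k) / 2)).
have [K KE] : exists K, K = 1 + alpha / 16 * (1 + 2 * alpha) by eexists.
have K1 : 1 <= K by rewrite KE lerDl !mulr_ge0 ?addr_ge0 ?mulr_ge0 // ltW.
have K0 : 0 < K by lra.
(* The conditions let kap times the upper bound of V fit into the target shift, the kinetic and gap
   part, and the strong convexity part respectively. *)
have [kap [kap0 kap1 kapal kapc]] : exists kap : R,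
    [/\ 0 < kap, kap * K <= 1, kap * K <= alpha / 16 & kap * K <= alpha / 16 * (c / 8)].
  pose mm := Num.min 1 (Num.min (alpha / 16) (alpha / 16 * (c / 8))).
  have mm0 : 0 < mm by rewrite !lt_min ltr01 !mulr_gt0.
  exists (mm / K); rewrite divfK ?gt_eqF //.
  by split; [exact: divr_gt0 | rewrite /mm !ge_min lexx ?orbT..].
have kapK : kap <= kap * K by rewrite ler_peMr // ltW.
have [ka ka0 ka2] := small_square c0.
have near_w : \forall k \near \oo,
    [/\ (2 <= k)%N, 0 < w k, w k <= 2^-1 & eps k <= w k / 8].
  by apply: (near_coefficients q_gt0 q_lt1 alpha_gt0 c_gt0 p_gt1); rewrite invr_gt0.
have V_low : \forall k \near \oo, viscosity_gap k + (dot (d k) (d k) / 4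
    + alpha ^+ 2 / 128 * (S k ^+ 2 * A k)) <= V k.
  near=> k.
  have [k2 w0 w2 ew] : [/\ (2 <= k)%N, 0 < w k, w k <= 2^-1 & eps k <= w k / 8] by near: k.
  have S0 : 0 < S k by apply: pw_gt0; exact: leq_trans k2.
  have := @moving_target_lower_bound R H dot hdot (d k) (x k - y k) alpha (S k) al0 S0 w2.
  have -> : x k - y k - d k = x k - d k - y k by rewrite addrAC.
  by move=> low; rewrite /V -[leRHS]addrA lerD2l.
have gap_ge k : (2 <= k)%N -> eps k / 2 * A k <= viscosity_gap k.
  by move=> k2; rewrite /viscosity_gap lerBrDl; exact: y_growth.
have A0 k : 0 <= A k by exact: dot_ge0.
have D20 k : 0 <= D2 k by exact: dot_ge0.
have N0 k : 0 <= dot (d k) (d k) by exact: dot_ge0.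
have eps0 k : 0 <= eps k by rewrite mulr_ge0 ?pw_ge0 // ltW.
have gap0 k : (2 <= k)%N -> 0 <= viscosity_gap k.
  by move=> k2; apply: le_trans (gap_ge _ k2); rewrite mulr_ge0 // divr_ge0.
have V0 : \forall k \near \oo, 0 <= V k.
  near=> k; have k2 : (2 <= k)%N by near: k; exact: nbhs_infty_ge.
  have L1 : viscosity_gap k + (dot (d k) (d k) / 4
    + alpha ^+ 2 / 128 * (S k ^+ 2 * A k)) <= V k by near: k.
  apply: le_trans L1; apply: addr_ge0; first exact: gap0.
  apply: addr_ge0; first exact: divr_ge0.
  by apply: mulr_ge0; [apply: divr_ge0 => //; exact: sqr_ge0|apply: mulr_ge0 => //; exact: sqr_ge0].
have s10 k : 0 <= s1 k by rewrite !mulr_ge0 ?pw_ge0 // ltW.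
(* Since y_k minimizes with the parameter eps_k, the optimal value drops by at most (eps_k -
   eps_(k+1)) |y_(k+1)|^2 / 2. *)
have m_le k : (2 <= k)%N -> m k - m k.+1 <= s1 k.
  move=> k2; have := y_min (leqW k2) k2; rewrite -/(m k) => h.
  have k0 : (0 < k)%N by exact: leq_trans k2.
  have e1 : eps k - eps k.+1 <= c * (C3 * pw (- p - 1) k).
    rewrite -mulrBr ler_wpM2l ?(ltW c0) // -[leLHS]opprB.
    by apply: (le_trans (ler_norm _)); rewrite normrN; exact: HC3.
  have e2 : 0 <= eps k - eps k.+1.
    by rewrite -mulrBr mulr_ge0 ?(ltW c0) // subr_ge0 pw_anti.
  have e3 : (eps k - eps k.+1) * dot (y k.+1) (y k.+1) <= c * (C3 * pw (- p - 1) k) * L.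
    by apply: ler_pM => //; [exact: dot_ge0|exact: yL (leqW k2)].
  rewrite /m; apply: (tikhonov_shift h); apply: (le_trans e3).
  by rewrite /s1 le_eqVlt; apply/orP; left; apply/eqP; field.
have V_step : \forall k \near \oo, V k.+1 + (alpha * S k / 4 * (dot (d k) (d k)
      + dot (d k.+1) (d k.+1))
    + alpha / 16 * S k * (F k.+1 + eps k / 2 * dot (x k.+1) (x k.+1) - m k)
    + alpha / 16 * S k * (eps k / 8) * dot (x k.+1 - y k) (x k.+1 - y k)) <=
    V k + (s1 k + alpha / 16 * S k * D2 k + alpha / 2 * S k * (w k ^+ 2 / eps k) * D2 k).
  near=> k.
  have [k2 w0 w2 ew] : [/\ (2 <= k)%N, 0 < w k, w k <= 2^-1 & eps k <= w k / 8] by near: k.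
  have k0 : (0 < k)%N by exact: leq_trans k2.
  (* The variation of k^-q is below k^(-q - p/2), the geometric mean demanded by
     [moving_target_step], because p < 2. *)
  have tS : C2 * pw (- q - 1) k <= ka * pw (- q - p / 2) k.
    have : pw (- q - 1) k <= ka / (C2 + 1) * pw (- q - p / 2) k.
      near: k; apply: pw_small => //; exact: divr_gt0.
    rewrite mulrAC ler_pdivlMr // mulrC; apply: le_trans.
    by rewrite ler_wpM2r ?pw_ge0 // lerDl.
  have t2S : (ka * pw (- q - p / 2) k) ^+ 2 <= S k / 16 * (S k * eps k / 16).
    have -> : S k / 16 * (S k * eps k / 16) = c / 256 * (S k * S k * pw (- p) k) by field.
    rewrite exprMn; apply: ler_pM; rewrite ?sqr_ge0 //.
    by rewrite -pwX2 /S -!pwD // exp_t2.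
  have S0 : 0 < S k by exact: pw_gt0.
  have e0 : 0 < eps k by rewrite mulr_gt0 // pw_gt0.
  have ee : eps k.+1 <= eps k by rewrite ler_pM2l // pw_anti.
  have SS := le_trans (HC2 _ k0) tS.
  have HFy := F_sub (leqW k2) k2; rewrite xS in HFy.
  have := @moving_target_step R H dot hdot (x k) (d k) (d k.+1) (u k.+1) (y k) (y k.+1)
    alpha (eps k) (eps k.+1) (F k) (F k.+1) (Fy k) (m k) (m k.+1) (S k) (S k.+1) _ (s1 k)
    al0 S0 w2 e0 ew ee (pw_ge0 _ _) (pw_anti qN k0) SS t2S (uE k0) (F_dec k2) HFy erefl
    (m_le _ k2).
  rewrite -xS => main; rewrite /V /D2.
  have -> : x k.+1 - d k.+1 = x k by rewrite xS addrK.
  by rewrite [leRHS]addrA [_ + (s1 k + _)]addrA.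
have V_up : \forall k \near \oo, V k.+1 <=
    (F k.+1 + eps k / 2 * dot (x k.+1) (x k.+1) - m k) + K * dot (d k.+1) (d k.+1)
    + K * (S k ^+ 2 * dot (x k.+1 - y k) (x k.+1 - y k)) + K * (S k ^+ 2 * D2 k) + s1 k.
  near=> k; have k2 : (2 <= k)%N by near: k; exact: nbhs_infty_ge.
  have k0 : (0 < k)%N by exact: leq_trans k2.
  have S1 : S k <= 1 by rewrite -(pw0 k); exact: pw_le.
  have := @moving_target_upper_bound R H dot hdot (d k.+1) (x k.+1 - y k) (y k.+1 - y k)
    alpha (S k) (S k.+1) al0 (pw_ge0 _ _) (pw_anti qN k0) S1.
  rewrite -KE opprB addrA subrK => up.
  have -> : V k.+1 = F k.+1 + eps k.+1 / 2 * dot (x k.+1) (x k.+1) - m k.+1 +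
    (dot (d k.+1) (d k.+1) / 2 + alpha / 16 * (S k.+1 * dot (d k.+1) (x k.+1 - y k.+1)
      + S k.+1 * (alpha * S k.+1) *
        (dot (x k.+1 - y k.+1 - d k.+1) (x k.+1 - y k.+1 - d k.+1) / 2))).
    by rewrite /V [x k.+1 - y k.+1 - d k.+1]addrAC [RHS]addrA.
  have ee : eps k.+1 <= eps k by rewrite ler_pM2l // pw_anti.
  have eX := ler_wpM2r (dot_ge0 hdot (x k.+1)) ee.
  exact: (tikhonov_shift_sum _ up (m_le _ k2) eX).
pose C := 2 * (c * C3 * L / 2) + (alpha / 16 + 1) * Cy + alpha / 2 * (alpha ^+ 2 / c * Cy).
have [M HM] : exists M, \forall k \near \oo, V k <= M * pw (- th) k.
  apply: (@powR_decay _ V kap C om) => //.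
  near=> k.
  have [k2 w0 w2 ew] : [/\ (2 <= k)%N, 0 < w k, w k <= 2^-1 & eps k <= w k / 8] by near: k.
  have k0 : (0 < k)%N by exact: leq_trans k2.
  have Hstep : V k.+1 + (alpha * S k / 4 * (dot (d k) (d k) + dot (d k.+1) (d k.+1))
    + alpha / 16 * S k * (F k.+1 + eps k / 2 * dot (x k.+1) (x k.+1) - m k)
    + alpha / 16 * S k * (eps k / 8) * dot (x k.+1 - y k) (x k.+1 - y k)) <=
    V k + (s1 k + alpha / 16 * S k * D2 k + alpha / 2 * S k * (w k ^+ 2 / eps k) * D2 k)
    by near: k.
  have Hup : V k.+1 <=
    (F k.+1 + eps k / 2 * dot (x k.+1) (x k.+1) - m k) + K * dot (d k.+1) (d k.+1)
    + K * (S k ^+ 2 * dot (x k.+1 - y k) (x k.+1 - y k)) + K * (S k ^+ 2 * D2 k) + s1 k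
    by near: k.
  have G0 : 0 <= F k.+1 + eps k / 2 * dot (x k.+1) (x k.+1) - m k.
    rewrite subr_ge0; apply: le_trans (y_growth (leqW k2) k2).
    by rewrite lerDl mulr_ge0 ?(dot_ge0 hdot) // divr_ge0.
  have S0 := pw_ge0 (- q) k (R := R).
  have S1 : S k <= 1 by rewrite -(pw0 k); exact: pw_le.
  have zS : pw (- om) k <= S k by exact: pw_le.
  have kA : kap * K * (pw (- om) k * S k ^+ 2) <= alpha / 16 * S k * (eps k / 8).
    have -> : alpha / 16 * S k * (eps k / 8) = alpha / 16 * (c / 8) * (S k * pw (- p) k).
      by field.
    apply: ler_pM => //; rewrite ?mulr_ge0 ?pw_ge0 ?sqr_ge0 ?(ltW kap0) ?(ltW K0) //.
    by rewrite -pwX2 /S -!pwD //; exact: pw_le.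
  have := decay_step_arith al0 S0 S1 (pw_ge0 _ _) zS (ltW kap0) (le_trans kapK kap1)
    (le_trans kapK kapal) K1 (le_trans kapal al4) kap1 kA G0 (N0 k) (N0 k.+1)
    (dot_ge0 hdot _) (D20 k) (s10 k) Hstep Hup.
  move=> fin; apply: (le_trans fin); rewrite lerD2l.
  have D2k : D2 k <= Cy * pw (- 2) k by near: k.
  have src1 : s1 k <= c * C3 * L / 2 * pw (- th - om) k.
    rewrite /s1 ler_wpM2l //; first by rewrite !mulr_ge0 // ltW.
    exact: pw_le.
  have src2 : S k * D2 k <= Cy * pw (- th - om) k.
    apply: (le_trans (ler_wpM2l S0 D2k)); rewrite mulrCA ler_wpM2l // -pwD //.
    exact: pw_le.
  have src3 : S k * (w k ^+ 2 / eps k) * D2 k <= alpha ^+ 2 / c * Cy * pw (- th - om) k.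
    have Q0 : 0 <= S k * (w k ^+ 2 / eps k) by rewrite mulr_ge0 // divr_ge0 ?sqr_ge0.
    apply: (le_trans (ler_wpM2l Q0 D2k)).
    have -> : S k * (w k ^+ 2 / eps k) * (Cy * pw (-2) k) =
      alpha ^+ 2 / c * Cy * (S k * (S k ^+ 2 * pw p k) * pw (-2) k).
      have -> : pw p k = (pw (- p) k)^-1 :> R by rewrite pwN invrK.
      rewrite /S; field; rewrite !gt_eqF ?pw_gt0 //.
    rewrite ler_wpM2l //.
      by rewrite mulr_ge0 // divr_ge0 ?sqr_ge0 // ltW.
    by rewrite -pwX2 /S -!pwD //; exact: pw_le.
  have al16 : 0 <= alpha / 16 by rewrite divr_ge0 // ltW.
  have al2 : 0 <= alpha / 2 by rewrite divr_ge0 // ltW.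
  exact: (source_arith al16 al2 src1 src2 src3).
have al2 : 0 < alpha ^+ 2 / 128 by rewrite divr_gt0 // exprn_gt0.
(* The summands invert the coefficient 1/4 of |d|^2, the c / 2 in the growth of the gap, and the
   alpha^2 / 128 of the anchor. *)
exists (4 * `|M| + 2 / c * `|M| + (alpha ^+ 2 / 128)^-1 * `|M|).
near=> k.
have k2 : (2 <= k)%N by near: k; exact: nbhs_infty_ge.
have k0 : (0 < k)%N by exact: leq_trans k2.
have L1 : viscosity_gap k + (dot (d k) (d k) / 4
    + alpha ^+ 2 / 128 * (S k ^+ 2 * A k)) <= V k by near: k.
have VM : V k <= `|M| * pw (- th) k.
  apply: (@le_trans _ _ (M * pw (- th) k)); first by near: k.
  by rewrite ler_wpM2r ?pw_ge0 // ler_norm.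
have h0 := gap0 _ k2.
have [] := le_three_parts (a := viscosity_gap k) (b := dot (d k) (d k) / 4)
  (c := alpha ^+ 2 / 128 * (S k ^+ 2 * A k)) (e := V k) (m := `|M| * pw (- th) k) _ _ VM.
- split => //; first exact: divr_ge0.
  by apply: mulr_ge0; [exact: ltW|apply: mulr_ge0 => //; exact: sqr_ge0].
- by rewrite -addrA.
move=> l1 l2 l3; have g0 : 0 <= `|M| * pw (- th) k by rewrite mulr_ge0 ?pw_ge0.
have t1 : 0 <= 4 * `|M| * pw (- th) k by rewrite -mulrA mulr_ge0.
have t2 : 0 <= 2 / c * `|M| * pw (- th) k by rewrite -mulrA mulr_ge0 // divr_ge0 // ltW.
have t3 : 0 <= (alpha ^+ 2 / 128)^-1 * `|M| * pw (- th) k.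
  by rewrite -mulrA mulr_ge0 // invr_ge0 ltW.
have -> : (4 * `|M| + 2 / c * `|M| + (alpha ^+ 2 / 128)^-1 * `|M|) * pw (- th) k =
  4 * `|M| * pw (- th) k + 2 / c * `|M| * pw (- th) k
  + (alpha ^+ 2 / 128)^-1 * `|M| * pw (- th) k by rewrite !mulrDl.
have l4 : dot (d k) (d k) <= 4 * `|M| * pw (- th) k by rewrite -mulrA -ler_pdivrMl // mulrC.
have l5 : pw (- p) k * A k <= 2 / c * `|M| * pw (- th) k.
  rewrite -mulrA -ler_pdivrMl ?divr_gt0 // invf_div mulrA.
  apply: le_trans l1; apply: le_trans (gap_ge _ k2).
  by rewrite [c / 2 * _]mulrAC.
have l6 : pw (- (2 * q)) k * A k <= (alpha ^+ 2 / 128)^-1 * `|M| * pw (- th) k.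
  rewrite -mulrA -ler_pdivrMl ?invr_gt0 // invrK.
  by rewrite (_ : pw (- (2 * q)) k = S k ^+ 2) // /S -pwX2 mulrN.
have l7 : viscosity_gap k <= 4 * `|M| * pw (- th) k.
  by apply: (le_trans l1); rewrite -mulrA ler_peMl // ler1n.
have t23 := addr_ge0 t2 t3; have t13 := addr_ge0 t1 t3; have t12 := addr_ge0 t1 t2.
split => //.
- by apply: (le_trans l7); rewrite -addrA lerDl.
- by apply: (le_trans l4); rewrite -addrA lerDl.
- by apply: (le_trans l5); rewrite addrAC lerDr.
- by apply: (le_trans l6); rewrite lerDr.
Unshelve. all: by end_near. Qed.

End viscosity_decay.

(** * The viscosity curve *)

Section viscosity_curve.
Context {R : realType} {H : completeNormedModType R} (dot : {dot H for idfun}).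
Hypothesis hdot : induces_norm dot.
Context (f : H -> \bar R) (f_proper : proper_function f)
  (f_convex : convex_efunction f) (f_lsc : lower_semicontinuous f)
  (f_argmin : argmin f !=set0).
Implicit Types (x y z : H) (e : R).

(* The minimizer of f + e / 2 * |.|^2. *)
Definition viscosity e : H := prox e^-1 f 0.
Local Notation v := viscosity.

Lemma viscosity_subdifferential e : 0 < e -> subdifferential dot f (v e) (- (e *: v e)).
Proof.
move=> e0; have e'0 : 0 < e^-1 by rewrite invr_gt0.
have := prox_subdifferential hdot f_proper f_convex f_lsc f_argmin 0 e'0.
by rewrite invrK sub0r scalerN.
Qed.

Lemma viscosity_fine e : 0 < e -> f (v e) = (fine (f (v e)))%:E.
Proof. by move=> e0; have [fv _] := viscosity_subdifferential e0; rewrite fineK. Qed.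

Lemma viscosity_growth e z : 0 < e -> f z = (fine (f z))%:E ->
  fine (f (v e)) + e / 2 * dot (v e) (v e) + e / 2 * dot (z - v e) (z - v e) <=
  fine (f z) + e / 2 * dot z z.
Proof.
move=> e0 fz; have := subdifferential_fine (viscosity_subdifferential e0) fz.
rewrite !dotE (dotC dot (v e) z); lra.
Qed.

(** The obtuse angle property. It bounds the curve by any minimizer and, in the limit, characterizes
    the projection of 0. *)
Lemma viscosity_dot_le0 e z : 0 < e -> argmin f z -> dot (v e) (v e - z) <= 0.
Proof.
move=> e0 zmin; have fz := argmin_fine f_proper zmin.
have := subdifferential_fine (viscosity_subdifferential e0) fz.
have : fine (f z) <= fine (f (v e)).
  by rewrite -lee_fin -fz -viscosity_fine //; exact: zmin.
rewrite !dotE => h1 h2.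
by rewrite -(pmulr_rle0 _ e0) //; lra.
Qed.

Lemma viscosity_norm_le e z : 0 < e -> argmin f z ->
  dot (v e) (v e) <= dot z z.
Proof.
move=> e0 /(viscosity_dot_le0 e0); have := dot_ge0 hdot (v e - z).
rewrite !dotE (dotC dot z (v e)); lra.
Qed.

(** Sum of the two growth inequalities, each tested at the minimizer of the other parameter. *)
Lemma viscosity_dist e e' : 0 < e' -> e' <= e ->
  e' * dot (v e' - v e) (v e' - v e) <= (e - e') * dot (v e) (v e' - v e).
Proof.
move=> e'0 e'e; have e0 : 0 < e by exact: lt_le_trans e'e.
have := viscosity_growth e0 (viscosity_fine e'0).
have := viscosity_growth e'0 (viscosity_fine e0).
rewrite !dotE (dotC dot (v e') (v e)); lra.
Qed.

(** The difference of the two sides is twice [dot (v e) (v e' - v e)], nonnegative by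
    [viscosity_dist]. So norms increase along the curve, and their convergence makes the curve
    Cauchy. *)
Lemma viscosity_dist_le e e' : 0 < e' -> e' <= e ->
  dot (v e' - v e) (v e' - v e) <= dot (v e') (v e') - dot (v e) (v e).
Proof.
move=> e'0 e'e; have D := viscosity_dist e'0 e'e.
have D0 := dot_ge0 hdot (v e' - v e).
have P0 : 0 <= dot (v e) (v e' - v e).
  have [ee|ee] := eqVneq e' e; first by rewrite ee subrr dot0r.
  have ee0 : 0 < e - e' by rewrite subr_gt0 lt_neqAle ee.
  by rewrite -(pmulr_rge0 _ ee0) (le_trans _ D) // mulr_ge0 // ltW.
move: P0; rewrite !dotE (dotC dot (v e') (v e)); lra.
Qed.

(** The relative change r of the parameter bounds the relative displacement; for eps_k and eps_(k+1)
    it is O(1 / k). *)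
Lemma viscosity_variation e e' r : 0 < e' -> e' <= e -> 0 <= r -> e - e' <= r * e' ->
  dot (v e' - v e) (v e' - v e) <= r ^+ 2 * dot (v e) (v e).
Proof.
move=> e'0 e'e r0 er; have D := viscosity_dist e'0 e'e.
have := dot_young hdot (v e) (v e' - v e) (sqr_ge0 r) ler01 (_ : r ^+ 2 <= _).
rewrite mulr1 mul1r => /(_ (lexx _)) Y.
have D0 := dot_ge0 hdot (v e' - v e).
suff : dot (v e' - v e) (v e' - v e) <= r * dot (v e) (v e' - v e) by lra.
rewrite -(ler_pM2l e'0); apply: (le_trans D).
have P0 : 0 <= (e - e') * dot (v e) (v e' - v e).
  by rewrite (le_trans _ D) // mulr_ge0 // ltW.
rewrite mulrA (mulrC e'); have [P|P] := lerP 0 (dot (v e) (v e' - v e)).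
  by rewrite ler_wpM2r.
have ee : e - e' = 0.
  apply/eqP; rewrite eq_le subr_ge0 e'e andbT -(nmulr_lge0 _ P) //.
move: D; rewrite ee mul0r pmulr_rle0 // => D'.
have -> : v e' - v e = 0 by apply: (dot_eq0 hdot); apply/eqP; rewrite eq_le D'.
by rewrite dot0r mulr0.
Qed.

Lemma viscosity_cvg (e : nat -> R) : (forall k, 0 < e k) -> nonincreasing_seq e ->
  e @ \oo --> (0 : R) ->
  exists2 xs, min_norm (argmin f) = [set xs] & (fun k => `|v (e k) - xs|) @ \oo --> (0 : R).
Proof.
move=> e0 edec ecvg; have [z0 z0min] := f_argmin.
pose n2 k := dot (v (e k)) (v (e k)).
have dist k n : (k <= n)%N -> `|v (e n) - v (e k)| ^+ 2 <= n2 n - n2 k.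
  by move=> kn; rewrite -hdot; apply: viscosity_dist_le => //; exact: edec.
have n2cvg : cvgn n2.
  apply: nondecreasing_is_cvgn.
    by move=> k n kn; rewrite -subr_ge0 (le_trans _ (dist _ _ kn)) // sqr_ge0.
  by exists (dot z0 z0) => _ [k _ <-]; exact: viscosity_norm_le.
have vcvg : cvgn (fun k => v (e k)).
  apply/cauchy_cvgP/cauchy_exP => r r0.
  have r20 : 0 < r ^+ 2 / 2 by rewrite divr_gt0 // exprn_gt0.
  have /cvgrPdist_lt /(_ _ r20) [N _ HN] : n2 @ \oo --> limn n2 by exact: n2cvg.
  exists (v (e N)), N => // n Nn; rewrite /= -ball_normE /= distrC.
  suff : `|v (e n) - v (e N)| ^+ 2 < r ^+ 2.
    by rewrite ltr_pXn2r ?nnegrE ?normr_ge0 ?(ltW r0).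
  apply: (le_lt_trans (dist _ _ Nn)).
  have := HN _ (leqnn N); have := HN _ Nn => /=.
  rewrite !ltr_norml => /andP[a1 a2] /andP[b1 b2]; lra.
set xs := limn (fun k => v (e k)) in vcvg.
have key z : argmin f z -> dot xs (xs - z) <= 0.
  move=> zmin.
  (* Written with squared distances, the expression is continuous in w by [continuous_sqr_dist]. *)
  have E w : dot w (w - z) = 2^-1 * `|w - 0| ^+ 2 + 2^-1 * `|w - z| ^+ 2 - 2^-1 * dot z z.
    rewrite subr0 -!hdot !dotE (dotC dot z w); lra.
  have cs w : (fun k => 2^-1 * `|v (e k) - w| ^+ 2) @ \oo --> 2^-1 * `|xs - w| ^+ 2.
    exact: (cvg_comp _ _ vcvg (@continuous_sqr_dist R H 2^-1 w xs)).
  have c : (fun k => dot (v (e k)) (v (e k) - z)) @ \oo --> dot xs (xs - z).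
    rewrite E; under eq_fun do rewrite E.
    apply: cvgB; last exact: cvg_cst.
    exact: cvgD (cs 0) (cs z).
  apply: (closed_cvg (fun r : R => r <= 0) (@closed_le _ _) _ _ c).
  by apply: nearW => k; exact: viscosity_dot_le0.
have xsmin : argmin f xs.
  move=> y; apply: le_trans (z0min y); rewrite leNgt; apply/negP => lt.
  have fz0 := argmin_fine f_proper z0min.
  have [a [za al]] : exists a : R, (f z0 < a%:E)%E /\ (a%:E < f xs)%E.
    move: lt; rewrite fz0; case: (f xs) => [s| |] //.
      by rewrite lte_fin => rs; exists ((fine (f z0) + s) / 2); rewrite !lte_fin; split; lra.
    by move=> _; exists (fine (f z0) + 1); rewrite ltry lte_fin; split => //; lra.
  have [V Vxs HV] := f_lsc al.
  have z1 : 0 < dot z0 z0 + 1 by rewrite ltr_wpDl ?(dot_ge0 hdot).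
  (* Below this threshold for e, comparison with z0 gives f (v e) <= f z0 + e |z0|^2 / 2 < a,
     against lower semicontinuity at xs. *)
  have az : 0 < (a - fine (f z0)) / (dot z0 z0 + 1).
    by apply: divr_gt0 => //; rewrite subr_gt0 -lte_fin -fz0.
  near \oo => k.
  have : (a%:E < f (v (e k)))%E by apply: HV; near: k; exact: vcvg.
  have : e k < (a - fine (f z0)) / (dot z0 z0 + 1).
    have : `|0 - e k| < (a - fine (f z0)) / (dot z0 z0 + 1).
      by near: k; move/cvgrPdist_lt : ecvg; apply.
    by rewrite sub0r normrN ger0_norm // ltW.
  rewrite viscosity_fine // lte_fin ltr_pdivlMr //.
  have := viscosity_growth (e0 k) fz0; have ek := ltW (e0 k).
  have : 0 <= e k / 2 * dot (v (e k)) (v (e k)) by rewrite mulr_ge0 ?(dot_ge0 hdot) ?divr_ge0.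
  have : 0 <= e k / 2 * dot (z0 - v (e k)) (z0 - v (e k)).
    by rewrite mulr_ge0 ?(dot_ge0 hdot) ?divr_ge0.
  have : 0 <= e k * dot z0 z0 by rewrite mulr_ge0 ?(dot_ge0 hdot).
  have := e0 k.
  move: (e k) (dot (v (e k)) _) (dot (z0 - _) _) (dot z0 z0) (fine (f (v (e k)))).
  move=> {lt za al HV fz0} t t1 t2 t3 t4 *; lra.
exists xs.
  apply/seteqP; split => [w [wmin wnorm]|_ ->].
    have := key w wmin; have : dot w w <= dot xs xs.
      by rewrite !hdot lerXn2r ?nnegrE // wnorm.
    move=> h1 h2; apply/eqP; rewrite -subr_eq0; apply/eqP/(dot_eq0 hdot)/eqP.
    rewrite eq_le (dot_ge0 hdot) andbT; move: h1 h2; rewrite !dotE (dotC dot xs w); lra.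
  split => // w wmin; have := key w wmin; have := dot_ge0 hdot (xs - w).
  suff : dot xs xs <= dot w w -> `|xs| <= `|w|.
    move=> h; rewrite !dotE (dotC dot w xs) => h1 h2; apply: h; lra.
  by rewrite !hdot ler_pXn2r ?nnegrE.
have := vcvg => /cvgrPdist_lt H0; apply/cvgrPdist_lt => r r0.
by near=> k; rewrite sub0r normrN normr_id distrC; near: k; exact: H0.
Unshelve. all: by end_near. Qed.

End viscosity_curve.

(** * Convergence of the algorithm *)

Section asymptotics.
Context {R : realType}.
Implicit Types (a : nat -> R) (r s M : R).

Lemma near_pred (P : nat -> Prop) : (\forall k \near \oo, P k.+1) -> \forall k \near \oo, P k.
Proof. by move=> [N _ HN]; exists N.+1 => // -[//|n] Nn; exact: HN. Qed.

Lemma eqO_pw a r M : (\forall k \near \oo, `|a k| <= M * pw r k) ->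
  a =O_\oo (fun k => k%:R `^ r : R).
Proof.
move=> aM; apply/eqO_exP; exists (`|M| + 1); first by rewrite ltr_wpDl.
near=> k; have h : `|a k| <= M * pw r k by near: k.
have -> : `|k%:R `^ r| = pw r k by rewrite ger0_norm ?powR_ge0.
apply: (le_trans h); rewrite ler_wpM2r ?pw_ge0 //.
by rewrite (le_trans (ler_norm _)) // lerDl.
Unshelve. all: by end_near. Qed.

Lemma eqo_pw a r : (forall e, 0 < e -> \forall k \near \oo, `|a k| <= e * pw r k) ->
  a =o_\oo (fun k => k%:R `^ r : R).
Proof.
move=> aM; apply/eqoP => e e0; near=> k.
have -> : `|k%:R `^ r| = pw r k by rewrite ger0_norm ?powR_ge0.
by near: k; exact: aM.
Unshelve. all: by end_near. Qed.

Lemma eqo_pw_lt a r s M : s < r -> (\forall k \near \oo, `|a k| <= M * pw s k) ->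
  a =o_\oo (fun k => k%:R `^ r : R).
Proof.
move=> sr aM; apply: eqo_pw => e e0; near=> k.
have h : `|a k| <= M * pw s k by near: k.
have M1 : 0 < `|M| + 1 by rewrite ltr_wpDl.
have h2 : pw s k <= e / (`|M| + 1) * pw r k.
  by near: k; apply: pw_small => //; exact: divr_gt0.
apply: (le_trans h); apply: (@le_trans _ _ ((`|M| + 1) * pw s k)).
  by rewrite ler_wpM2r ?pw_ge0 // (le_trans (ler_norm _)) // lerDl.
by rewrite -ler_pdivlMl // mulrA (mulrC _ e).
Unshelve. all: by end_near. Qed.

Lemma eqo_pw_sqr (H : normedModType R) (v : nat -> H) s :
  (fun k => pw (2 * s) k * `|v k| ^+ 2) @ \oo --> (0 : R) ->
  (fun k => `|v k| : R) =o_\oo (fun k => k%:R `^ (- s) : R).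
Proof.
move=> cv; apply: eqo_pw => e e0.
have e20 : 0 < e ^+ 2 by rewrite exprn_gt0.
near=> k; have k0 : (0 < k)%N by near: k; exact: nbhs_infty_gt.
have : `|0 - pw (2 * s) k * `|v k| ^+ 2| < e ^+ 2.
  by near: k; move/cvgrPdist_lt : cv; apply.
rewrite sub0r normrN ger0_norm ?mulr_ge0 ?pw_ge0 ?sqr_ge0 //.
rewrite pwX2 -exprMn normr_id => /ltW h.
rewrite pwN ler_pdivlMr ?pw_gt0 // mulrC.
by rewrite -(@ler_pXn2r _ 2) ?nnegrE ?mulr_ge0 ?pw_ge0 // ltW.
Unshelve. all: by end_near. Qed.

Lemma eqO_pw_sqr (H : normedModType R) (v : nat -> H) s M :
  (\forall k \near \oo, pw (2 * s) k * `|v k| ^+ 2 <= M) ->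
  (fun k => `|v k| : R) =O_\oo (fun k => k%:R `^ (- s) : R).
Proof.
(* Square roots are avoided through M <= (|M| + 1)^2. *)
move=> vM; apply: (@eqO_pw _ _ (`|M| + 1)).
have M1 : 0 <= `|M| + 1 by rewrite addr_ge0.
near=> k; have k0 : (0 < k)%N by near: k; exact: nbhs_infty_gt.
have h : pw (2 * s) k * `|v k| ^+ 2 <= M by near: k.
rewrite normr_id pwN ler_pdivlMr ?pw_gt0 // mulrC.
rewrite -(@ler_pXn2r _ 2) ?nnegrE ?mulr_ge0 ?pw_ge0 //.
rewrite exprMn -pwX2 (le_trans h) // (le_trans (ler_norm _)) //.
by have := sqr_ge0 `|M|; rewrite !expr2; lra.
Unshelve. all: by end_near. Qed.

End asymptotics.

Section demiclosedness.
Context {R : realType} {H : completeNormedModType R} (dot : {dot H for idfun}).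
Hypothesis hdot : induces_norm dot.
Context (f : H -> \bar R) (f_proper : proper_function f)
  (f_convex : convex_efunction f) (f_lsc : lower_semicontinuous f)
  (f_argmin : argmin f !=set0).

(* With y = prox 1 f v one has v - y in the subdifferential at y, and monotonicity
   against u k, x k gives 0 <= - |v - y|^2 in the limit. *)
Lemma weak_limit_argmin (x u : nat -> H) (M : R) (U : set_system nat) (v : H) :
  (\forall k \near \oo, subdifferential dot f (x k) (u k)) ->
  (\forall k \near \oo, `|x k| <= M) -> (fun k => `|u k|) @ \oo --> (0 : R) ->
  UltraFilter U -> \oo `<=` U -> (forall y, (fun k => dot (x k) y) @ U --> dot v y) ->
  argmin f v.
Proof.
move=> xu xM u0 UU oU xv.
have yv := prox_subdifferential hdot f_proper f_convex f_lsc f_argmin v ltr01.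
rewrite invr1 scale1r in yv; move: (prox 1 f v) yv => y yv.
have lim1 : (fun k => dot (u k) (x k - y)) @ U --> (0 : R).
  apply: cvg_trans (cvg_app _ oU) _; apply/norm_cvg0P.
  have b0 : (fun k => `|u k| * (M + `|y|)) @ \oo --> (0 : R).
    by rewrite -[0](mul0r (M + `|y|)); apply: cvgM => //; exact: cvg_cst.
  apply: (squeeze_cvgr (f := fun=> 0)) b0; last exact: cvg_cst.
  near=> k; rewrite normr_ge0 /= (le_trans (dot_le_norm hdot _ _)) // ler_wpM2l //.
  by rewrite (le_trans (ler_normB _ _)) // lerD2r; near: k.
have lim2 : (fun k => dot (x k) (v - y) - dot y (v - y)) @ U -->
    dot v (v - y) - dot y (v - y) by apply: cvgB (xv _) (cvg_cst _).
have lim : (fun k => dot (u k) (x k - y) - (dot (x k) (v - y) - dot y (v - y))) @ U -->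
    0 - (dot v (v - y) - dot y (v - y)) by exact: cvgB lim1 lim2.
have pos : \forall k \near U, 0 <= dot (u k) (x k - y) - (dot (x k) (v - y) - dot y (v - y)).
  apply: oU; near=> k.
  have xuk : subdifferential dot f (x k) (u k) by near: k.
  have := subdifferential_monotone xuk yv.
  by rewrite !dotE (dotC dot (x k) v) (dotC dot y v) (dotC dot y (x k)); lra.
have : 0 <= 0 - (dot v (v - y) - dot y (v - y)).
  exact: (closed_cvg (fun r : R => 0 <= r) (@closed_ge _ _) pos _ lim).
have := dot_ge0 hdot (v - y); rewrite !dotE (dotC dot y v) => h1 h2.
have vy : v - y = 0.
  by apply: (dot_eq0 hdot); rewrite !dotE (dotC dot y v); lra.
rewrite vy in yv; have -> : v = y by apply/eqP; rewrite -subr_eq0 vy.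
exact: subdifferential0_argmin yv.
Unshelve. all: by end_near. Qed.

End demiclosedness.

Section arithmetic.
Context {R : realFieldType}.
Implicit Types a b c g : R.

Lemma gradient_bound a1 a2 a3 a b c g : a1 <= a * g -> a2 <= b * g * c -> a3 <= a * g ->
  2 * a3 + 4 * a1 + 4 * a2 <= (2 * a + 4 * a + 4 * b * c) * g.
Proof. lra. Qed.

Lemma gap_bound a1 a2 a3 a4 a5 a6 b c : 0 <= a1 -> 0 <= a2 -> a4 = c / 2 -> 0 <= c ->
  a5 + a3 + a2 <= a4 -> a6 + a1 - (a5 + a3) <= b -> a6 <= b + c.
Proof. lra. Qed.

Lemma cross_terms_le a b c g g' : 0 <= a -> 0 <= b -> 0 <= c -> 0 <= g -> 0 <= g' ->
  a * g' + b * g <= (a + b + c) * (g + g').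
Proof.
move=> a0 b0 c0 g0 g'0; have := mulr_ge0 a0 g0; have := mulr_ge0 b0 g'0.
have := mulr_ge0 c0 g0; have := mulr_ge0 c0 g'0; lra.
Qed.

End arithmetic.

(** * The iterates of the algorithm *)

Section algorithm.
Context {R : realType} {H : completeNormedModType R} (dot : {dot H for idfun}).
Hypothesis hdot : induces_norm dot.
Context (f : H -> \bar R) (f_proper : proper_function f)
  (f_convex : convex_efunction f) (f_lsc : lower_semicontinuous f)
  (f_argmin : argmin f !=set0).
Context (q alpha c p : R) (q_gt0 : 0 < q) (q_lt1 : q < 1)
  (alpha_gt0 : 0 < alpha) (c_gt0 : 0 < c) (x u : nat -> H).
Hypothesis hx : forall k : nat, (1 <= k)%N ->
     x k.+1 = prox 1 f (x k + (1 - alpha / k%:R `^ q) *: (x k - x k.-1)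
                        - (c / k%:R `^ p) *: x k).
Hypothesis hu : forall k : nat, (2 <= k)%N ->
     x k = (1 - alpha / k.-1%:R `^ q) *: (x k.-1 - x k.-2) - u k
           + (1 - c / k.-1%:R `^ p) *: x k.-1.

Local Notation d := (step x).
Local Notation w k := (alpha * pw (- q) k).
Local Notation eps k := (c * pw (- p) k).
Local Notation F k := (fine (min_gap f (x k))).

Lemma recurrence k : (1 <= k)%N ->
  u k.+1 = (1 - w k) *: d k - d k.+1 - eps k *: x k.
Proof.
move=> k1; have := hu (k := k.+1) k1; rewrite /= !pwN /pw /step /=.
rewrite [(1 - c / _) *: _]scalerBl scale1r.
move: (_ *: (x k - x k.-1)) => A; move: (_ *: x k) => B.
move: (x k.+1) (x k) (u k.+1) => X Y U ->.
have -> : A - U + (Y - B) - Y = A - U - B by rewrite -addrA [Y - B - Y]addrAC subrr sub0r.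
by rewrite opprB opprB addrCA subrKC [RHS]addrC addKr.
Qed.

Lemma subgradient k : (2 <= k)%N -> subdifferential dot f (x k) (u k).
Proof.
case: k => // k k1; rewrite recurrence // hx //.
set v := _ - _ *: x k.
have := prox_subdifferential hdot f_proper f_convex f_lsc f_argmin v ltr01.
rewrite invr1 scale1r; congr (subdifferential dot f _ _).
rewrite /v -hx // /step /= !pwN /pw.
move: (_ *: (x k - x k.-1)) => A; move: (_ *: x k) => B.
move: (x k.+1) (x k) => X Y.
by rewrite opprB addrA (addrC A) addrAC.
Qed.

Lemma inf_argmin z : argmin f z -> ereal_inf (range f) = f z.
Proof.
move=> zmin; apply/eqP; rewrite eq_le; apply/andP; split.
  by apply: ereal_inf_lbound; exists z.
by apply: le_ereal_inf_tmp => _ [y _ <-]; exact: zmin.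
Qed.

Lemma gap_fine z y : argmin f z -> f y = (fine (f y))%:E ->
  min_gap f y = (fine (f y) - fine (f z))%:E.
Proof.
move=> zmin fy.
by rewrite /min_gap (inf_argmin zmin) (argmin_fine f_proper zmin) fy.
Qed.

Lemma gap_ge0 z y : argmin f z -> f y = (fine (f y))%:E -> 0 <= fine (min_gap f y).
Proof.
move=> zmin fy; rewrite (gap_fine zmin fy) /= subr_ge0 -lee_fin -fy.
by rewrite -(argmin_fine f_proper zmin); exact: zmin.
Qed.

Lemma iterate_fine k : (2 <= k)%N -> f (x k) = (fine (f (x k)))%:E.
Proof. by move=> /subgradient [fx _]; rewrite fineK. Qed.

Lemma gap_iterate k : (2 <= k)%N -> min_gap f (x k) = (F k)%:E.
Proof.
move=> k2; have [z zmin] := f_argmin; by rewrite (gap_fine zmin (iterate_fine k2)).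
Qed.

Lemma gap_iterate_ge0 k : (2 <= k)%N -> 0 <= F k.
Proof.
by move=> k2; have [z zmin] := f_argmin; apply: (gap_ge0 zmin (iterate_fine k2)).
Qed.

Lemma gap_subgradient k y : (2 <= k)%N -> f y = (fine (f y))%:E ->
  F k - fine (min_gap f y) <= dot (u k) (x k - y).
Proof.
move=> k2 fy; have [z zmin] := f_argmin.
rewrite (gap_fine zmin (iterate_fine k2)) (gap_fine zmin fy) /=.
have := subdifferential_fine (subgradient k2) fy.
by rewrite !dotE; lra.
Qed.

Lemma gap_decrease k : (2 <= k)%N -> F k.+1 - F k <= dot (u k.+1) (d k.+1).
Proof. by move=> k2; apply: gap_subgradient (leqW k2) (iterate_fine k2). Qed.

Lemma gap_argmin k z : argmin f z -> (2 <= k)%N -> F k <= dot (u k) (x k - z).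
Proof.
move=> zmin k2; have fz := argmin_fine f_proper zmin.
have := gap_subgradient k2 fz; rewrite [in fine (min_gap f z)](gap_fine zmin fz) subrr.
by rewrite subr0.
Qed.

Lemma estimates (r : R) (z : H) : 1 < p -> argmin f z -> r <= q + 1 -> r < p -> 0 < r ->
  [/\ bsum (fun k => pw (r - 1) k * F k),
      bsum (fun k => pw (r - q) k * dot (d k) (d k)),
      bsum (fun k => pw r k * dot (u k) (u k)) &
      exists M, \forall k \near \oo, [/\ pw r k * F k <= M,
        pw r k * dot (d k) (d k) <= M &
        pw (r - 1 - q) k * dot (x k.-1 - z) (x k.-1 - z) <= M]].
Proof.
move=> p1 zmin rq rp r0.
have [bF bX bN be bM] := weighted_estimates hdot q_gt0 q_lt1 alpha_gt0 c_gt0 p1 recurrence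
  gap_iterate_ge0 gap_decrease rq rp r0 (fun k => @gap_argmin k z zmin).
split => //.
- apply: bsum_pw_shift bF; near=> k; apply: gap_iterate_ge0.
  by near: k; exact: nbhs_infty_ge.
- exact: (gradient_sum hdot q_gt0 p1 recurrence q_lt1 bX bN be).
Unshelve. all: by end_near. Qed.

(** At r = q + 1 the anchor weight k^(r-1-q) is constant, so the weighted estimates bound the
    iterates themselves. *)
Lemma weak_convergence : q + 1 < p -> exists2 xs : H, argmin f xs & weak_cvg dot x xs.
Proof.
move=> qp; have p1 : 1 < p by move: (q_gt0) => *; lra.
have r0 : 0 < q + 1 by move: (q_gt0) => *; lra.
have [z0 z0min] := f_argmin.
have [_ _ bU [M HM]] := estimates p1 z0min (lexx _) qp r0.
have xM : \forall k \near \oo, `|x k| <= `|z0| + (M + 1).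
  (* The estimate at k + 1 is used because its anchor term involves x_k; t <= t^2 + 1 then removes
     the square. *)
  near=> k; have [_ _] : [/\ pw (q + 1) k.+1 * F k.+1 <= M,
      pw (q + 1) k.+1 * dot (d k.+1) (d k.+1) <= M &
      pw (q + 1 - 1 - q) k.+1 * dot (x k - z0) (x k - z0) <= M].
    by near: k; exact: (near_succ HM).
  rewrite addrK subrr pw0 mul1r hdot => h.
  rewrite -[x k](subrK z0) addrC (le_trans (ler_normD _ _)) // lerD2l.
  apply: le_trans (lerD h (lexx 1)).
  by have := sqr_ge0 (`|x k - z0| - 2^-1); rewrite !expr2; lra.
apply: (opial hdot xM).
- move=> z zmin; have [_ bN _ [K HK]] := estimates p1 zmin (lexx _) qp r0.
  apply: (@distance_cvg R H dot hdot q alpha c p q_gt0 q_lt1 alpha_gt0 c_gt0 p1 x u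
    (fun k => F k) recurrence gap_iterate_ge0 z K qp).
  + by move=> k; exact: gap_argmin.
  + by rewrite [q + 1]addrC addrK in bN.
  + by near=> k; have [] : [/\ pw (q + 1) k * F k <= K, pw (q + 1) k * dot (d k) (d k) <= K &
        pw (q + 1 - 1 - q) k * dot (x k.-1 - z) (x k.-1 - z) <= K] by near: k.
  + near=> k; have [_ _] : [/\ pw (q + 1) k * F k <= K, pw (q + 1) k * dot (d k) (d k) <= K &
        pw (q + 1 - 1 - q) k * dot (x k.-1 - z) (x k.-1 - z) <= K] by near: k.
    by rewrite addrK subrr pw0 mul1r.
- move=> U v UU oU xv; apply: (weak_limit_argmin hdot f_proper f_convex f_lsc f_argmin
    (x := x) (u := u) _ xM _ UU oU xv).
  + by near=> k; apply: subgradient; near: k; exact: nbhs_infty_ge.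
  + apply/cvgrPdist_lt => e e0; have e20 : 0 < e ^+ 2 by rewrite exprn_gt0.
    have /cvgrPdist_lt /(_ _ e20) H0 :
        (fun k => pw (q + 1) k * dot (u k) (u k)) @ \oo --> (0 : R).
      by apply: bsum_cvg0 bU _; apply: nearW => k; rewrite mulr_ge0 ?pw_ge0 ?(dot_ge0 hdot).
    near=> k; have k0 : (0 < k)%N by near: k; exact: nbhs_infty_gt.
    have : `|0 - pw (q + 1) k * dot (u k) (u k)| < e ^+ 2 by near: k.
    rewrite !sub0r !normrN normr_id ger0_norm; last by rewrite mulr_ge0 ?pw_ge0 ?(dot_ge0 hdot).
    rewrite hdot => h; rewrite -(@ltr_pXn2r _ 2) ?nnegrE ?(ltW e0) //.
    apply: le_lt_trans h; rewrite ler_peMl ?sqr_ge0 //.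
    by have := @pw_le R 0 (q + 1) k k0 (ltW r0); rewrite pw0.
Unshelve. all: by end_near. Qed.

(** Beyond the conditions of [viscosity_decay], th <= 2 p makes the term eps x_k of u_(k+1) small
    enough, and p < th or 2 q < th makes one of the two bounds on |x_k - y_k|^2 tend to 0. The gap
    to min f also carries an O(k^-p) due to the regularization. *)
Lemma strong_convergence (om th : R) : 1 < p -> p < q + 1 -> q <= om -> p - q <= om ->
  om < 1 -> th + om <= p + 1 -> th + om <= q + 2 -> th + om <= 3 * q + 2 - p ->
  th <= 2 * p -> p < th \/ 2 * q < th ->
  (exists2 xs : H, min_norm (argmin f) = [set xs] &
     (fun k => `|x k - xs| : R) @ \oo --> (0 : R)) /\
  exists M, \forall k \near \oo, [/\ F k <= M * (pw (- p) k + pw (- th) k),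
    dot (d k) (d k) <= M * pw (- th) k & dot (u k) (u k) <= M * pw (- th) k].
Proof.
move: (q_gt0) (q_lt1) (c_gt0) (alpha_gt0) => q0 q1 c0 al0 p1 pq qom pqom om1 th1 th2 th3 th2p thD.
have p2 : p < 2 by lra.
have pN : - p <= 0 by lra.
have exp_u : 2 * - p <= - th by lra.
have [z0 z0min] := f_argmin.
pose y k := viscosity f (eps k).
have e0 k : (0 < k)%N -> 0 < eps k by move=> k0; rewrite mulr_gt0 // pw_gt0.
have edec k n : (0 < k)%N -> (k <= n)%N -> eps n <= eps k.
  move=> k0; elim: n => [|n ih]; first by rewrite leqn0 => /eqP ->.
  rewrite leq_eqVlt => /predU1P[<-//|]; rewrite ltnS => kn.
  by apply: le_trans (ih kn); rewrite ler_pM2l // pw_anti // (leq_trans k0).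
have yfin k : (0 < k)%N -> f (y k) = (fine (f (y k)))%:E.
  by move=> k0; apply: (viscosity_fine hdot f_proper f_convex f_lsc f_argmin); exact: e0.
have gapE v : f v = (fine (f v))%:E -> fine (min_gap f v) = fine (f v) - fine (f z0).
  by move=> fv; rewrite (gap_fine z0min fv).
have growth e z : 0 < e -> f z = (fine (f z))%:E ->
    fine (min_gap f (viscosity f e)) + e / 2 * dot (viscosity f e) (viscosity f e)
    + e / 2 * dot (z - viscosity f e) (z - viscosity f e) <=
    fine (min_gap f z) + e / 2 * dot z z.
  move=> ep fz; have := viscosity_growth hdot f_proper f_convex f_lsc f_argmin ep fz.
  rewrite !gapE //; last exact: (viscosity_fine hdot f_proper f_convex f_lsc f_argmin).
  lra.
pose L := dot z0 z0.
have yL k : (2 <= k)%N -> dot (y k) (y k) <= L.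
  move=> k2; apply: (viscosity_norm_le hdot f_proper f_convex f_lsc f_argmin) => //.
  by apply: e0; exact: leq_trans k2.
have [Cy Cy0 yCy] : exists2 Cy, 0 <= Cy &
    \forall k \near \oo, dot (y k.+1 - y k) (y k.+1 - y k) <= Cy * pw (- 2) k.
  have [C3 C30 HC3] := pw_diff (- p) (R := R).
  have [C4 C41 HC4] := pw_succ_le (- p) (R := R).
  have C40 : 0 <= C4 by lra.
  exists ((C3 * C4) ^+ 2 * L); first by rewrite mulr_ge0 ?sqr_ge0 ?(dot_ge0 hdot).
  near=> k; have k2 : (2 <= k)%N by near: k; exact: nbhs_infty_ge.
  have k0 : (0 < k)%N by exact: leq_trans k2.
  (* The relative change of the parameter: eps_k - eps_(k+1) is at most c C3 k^(-p-1), and C4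
     replaces k^-p by (k+1)^-p. *)
  apply: (@le_trans _ _ ((C3 * C4 * pw (-1) k) ^+ 2 * dot (y k) (y k))).
    apply: (viscosity_variation hdot f_proper f_convex f_lsc f_argmin).
    - exact: e0.
    - exact: edec.
    - by rewrite !mulr_ge0 ?pw_ge0.
    rewrite -mulrBr mulrCA ler_wpM2l ?(ltW c0) // -[leLHS]opprB.
    apply: (le_trans (ler_norm _)); rewrite normrN; apply: (le_trans (HC3 _ k0)).
    rewrite -!mulrA ler_wpM2l // pwD // mulrC mulrCA ler_wpM2l ?pw_ge0 //.
    exact: (HC4 _ k0).2.
  rewrite exprMn -pwX2 mulrN1 mulrAC ler_wpM2r ?pw_ge0 // ler_wpM2l ?sqr_ge0 //.
  exact: yL.
have pos k : (2 <= k)%N -> (0 < k)%N by exact: leq_trans.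
have ysub k j : (2 <= k)%N -> (2 <= j)%N ->
    F k - fine (min_gap f (y j)) <= dot (u k) (x k - y j).
  by move=> k2 /pos j0; exact: (gap_subgradient k2 (yfin _ j0)).
have ygrowth k j : (2 <= k)%N -> (2 <= j)%N ->
    fine (min_gap f (y j)) + eps j / 2 * dot (y j) (y j)
    + eps j / 2 * dot (x k - y j) (x k - y j) <= F k + eps j / 2 * dot (x k) (x k).
  by move=> k2 /pos j0; exact: (growth _ _ (e0 _ j0) (iterate_fine k2)).
have ymin i j : (2 <= i)%N -> (2 <= j)%N ->
    fine (min_gap f (y j)) + eps j / 2 * dot (y j) (y j) <=
    fine (min_gap f (y i)) + eps j / 2 * dot (y i) (y i).
  move=> /pos i0 /pos j0; apply: le_trans (growth _ _ (e0 _ j0) (yfin _ i0)).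
  by rewrite lerDl mulr_ge0 ?(dot_ge0 hdot) // divr_ge0 // ltW // e0.
have [M HM] := viscosity_decay hdot q_gt0 q_lt1 alpha_gt0 c_gt0 p1
  recurrence gap_decrease ysub ygrowth ymin
  p2 qom pqom om1 th1 th2 th3 (dot_ge0 hdot _) yL Cy0 yCy.
have [t t0 At] : exists2 t : R, t < 0 &
    \forall k \near \oo, dot (x k - y k) (x k - y k) <= `|M| * pw t k.
  have conclude (m : R) : m < th -> (\forall k \near \oo,
      pw (- m) k * dot (x k - y k) (x k - y k) <= M * pw (- th) k) ->
      exists2 t : R, t < 0 &
      \forall k \near \oo, dot (x k - y k) (x k - y k) <= `|M| * pw t k.
    move=> mth Hm; exists (m - th); first by lra.
    near=> k; have k0 : (0 < k)%N by near: k; exact: nbhs_infty_gt.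
    have h : pw (- m) k * dot (x k - y k) (x k - y k) <= M * pw (- th) k by near: k.
    rewrite -(@ler_pM2l _ (pw (- m) k)) ?pw_gt0 // mulrCA -pwD // addrA addNr add0r.
    by apply: (le_trans h); rewrite ler_wpM2r ?pw_ge0 ?ler_norm.
  case: thD => /conclude; apply; near=> k; by have [] : [/\ 0 <= viscosity_gap dot c p x y
      (fun k => F k) (fun k => fine (min_gap f (y k))) k,
      viscosity_gap dot c p x y (fun k => F k) (fun k => fine (min_gap f (y k))) k
        <= M * pw (- th) k,
      dot (d k) (d k) <= M * pw (- th) k,
      pw (- p) k * dot (x k - y k) (x k - y k) <= M * pw (- th) k &
      pw (- (2 * q)) k * dot (x k - y k) (x k - y k) <= M * pw (- th) k] by near: k.
have AM : \forall k \near \oo, dot (x k - y k) (x k - y k) <= `|M|.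
  near=> k; have k0 : (0 < k)%N by near: k; exact: nbhs_infty_gt.
  apply: (@le_trans _ _ (`|M| * pw t k)); first by near: k.
  by rewrite ler_piMr // -(pw0 k); apply: pw_le => //; exact: ltW.
split.
  (* The sequence is shifted because the convention for powers of 0 makes [eps 0] vanish, while
     [viscosity_cvg] wants positive parameters. *)
  have ec : (fun k => eps k.+1) @ \oo --> (0 : R).
    have c1 : (fun k => eps k) @ \oo --> (0 : R).
      rewrite -[0](mulr0 c); apply: cvgM; first exact: cvg_cst.
      by apply: pw_cvg0; lra.
    by rewrite -cvg_shiftS in c1.
  have [xs xsmin ycvg] := @viscosity_cvg R H dot hdot f f_proper f_convex f_lsc f_argmin
    (fun k => eps k.+1) (fun k => e0 _ (ltn0Sn k)) (fun k n kn => edec k.+1 n.+1 (ltn0Sn k) kn) ec.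
  exists xs => //.
  have {}ycvg : (fun k => `|y k - xs|) @ \oo --> (0 : R) by rewrite -cvg_shiftS.
  apply/cvgrPdist_lt => e ep; have e2 : 0 < e / 2 by exact: divr_gt0.
  move/cvgrPdist_lt : ycvg => /(_ _ e2) ye.
  have e22 : 0 < (e / 2) ^+ 2 by exact: exprn_gt0.
  have M1 : 0 < `|M| + 1 by rewrite ltr_wpDl.
  have s0 := @pw_small R t 0 ((e / 2) ^+ 2 / (`|M| + 1)) t0 (divr_gt0 e22 M1).
  near=> k; have k0 : (0 < k)%N by near: k; exact: nbhs_infty_gt.
  have h1 : `|0 - `|y k - xs| | < e / 2 by near: k.
  have h2 : dot (x k - y k) (x k - y k) <= `|M| * pw t k by near: k.
  have h3 : pw t k <= (e / 2) ^+ 2 / (`|M| + 1) * pw 0 k by near: k.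
  rewrite sub0r normrN normr_id in h1; rewrite sub0r normrN normr_id.
  have h4 : `|x k - y k| <= e / 2.
    rewrite -(@ler_pXn2r _ 2) ?nnegrE ?(ltW e2) // -hdot (le_trans h2) //.
    move: h3; rewrite pw0 mulr1 ler_pdivlMr // => h3.
    have tk := pw_ge0 t k (R := R).
    by apply: le_trans h3; rewrite mulrC ler_wpM2l // lerDl.
  have -> : x k - xs = (x k - y k) + (y k - xs) by rewrite addrA subrK.
  by rewrite (le_lt_trans (ler_normD _ _)) // (splitr e) ler_ltD.
have [C1 C11 HC1] := pw_succ_le (- th) (R := R).
pose X := 2 * `|M| + 2 * L.
have L0 : 0 <= L by exact: dot_ge0.
have X0 : 0 <= X by rewrite addr_ge0 // mulr_ge0.
pose K1 := 2 * `|M| + 4 * `|M| + 4 * c ^+ 2 * X.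
have K10 : 0 <= K1.
  apply: addr_ge0; first by apply: addr_ge0; exact: mulr_ge0.
  by apply: mulr_ge0 => //; apply: mulr_ge0 => //; exact: sqr_ge0.
exists (`|M| + c * L + K1 * C1).
have C10 : 0 <= C1 by exact: le_trans C11.
have Ntk : \forall k \near \oo, dot (d k) (d k) <= `|M| * pw (- th) k.
  near=> k; have [_ _ h _ _] : [/\ 0 <= viscosity_gap dot c p x y
      (fun k => F k) (fun k => fine (min_gap f (y k))) k,
      viscosity_gap dot c p x y (fun k => F k) (fun k => fine (min_gap f (y k))) k
        <= M * pw (- th) k,
      dot (d k) (d k) <= M * pw (- th) k,
      pw (- p) k * dot (x k - y k) (x k - y k) <= M * pw (- th) k &
      pw (- (2 * q)) k * dot (x k - y k) (x k - y k) <= M * pw (- th) k] by near: k.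
  by apply: (le_trans h); rewrite ler_wpM2r ?pw_ge0 // ler_norm.
have u_bound : \forall k \near \oo, dot (u k) (u k) <= K1 * C1 * pw (- th) k.
  apply: near_pred; near=> k.
  have k2 : (2 <= k)%N by near: k; exact: nbhs_infty_ge.
  have k0 : (0 < k)%N by exact: leq_trans k2.
  have [_ w0 w2 _] : [/\ (2 <= k)%N, 0 < w k, w k <= 2^-1 & eps k <= w k / 8].
    near: k; apply: (near_coefficients q_gt0 q_lt1 alpha_gt0 c_gt0 p1).
    by rewrite invr_gt0.
  have n1 : dot (d k) (d k) <= `|M| * pw (- th) k by near: k.
  have n2 : dot (d k.+1) (d k.+1) <= `|M| * pw (- th) k.+1.
    by near: k; exact: (near_succ Ntk).
  have AMk : dot (x k - y k) (x k - y k) <= `|M| by near: k.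
  have Xk : dot (x k) (x k) <= X.
    have := dot_sum_le hdot (x k - y k) (y k); rewrite subrK => h.
    by apply: (le_trans h); rewrite /X lerD // ler_wpM2l //; exact: yL.
  have uE : u k.+1 = - d k.+1 + ((1 - w k) *: d k + (- eps k) *: x k).
    by rewrite recurrence // scaleNr addrA; congr (_ - _); rewrite addrC.
  have := dot_sum3_le (- d k.+1) (d k) (x k) (1 - w k) (- eps k) hdot.
  rewrite -uE (dotNl dot (d k.+1)) (dotNr dot (d k.+1)) opprK sqrrN => h.
  apply: (le_trans h).
  have t1 : (1 - w k) ^+ 2 * dot (d k) (d k) <= `|M| * (C1 * pw (- th) k.+1).
    apply: (@le_trans _ _ (1 * (`|M| * pw (- th) k))).
      apply: ler_pM; rewrite ?sqr_ge0 ?(dot_ge0 hdot) //.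
      rewrite exprn_ile1 // ?lerBlDr ?lerDl ?(ltW w0) // subr_ge0 (le_trans w2) //.
      by rewrite invf_le1 // ler1n.
    by rewrite mul1r ler_wpM2l // (HC1 _ k0).2.
  have t2 : eps k ^+ 2 * dot (x k) (x k) <= c ^+ 2 * (C1 * pw (- th) k.+1) * X.
    apply: ler_pM; rewrite ?sqr_ge0 ?(dot_ge0 hdot) // exprMn ler_wpM2l ?sqr_ge0 //.
    rewrite -pwX2; apply: le_trans (HC1 _ k0).2; exact: pw_le.
  have t3 : dot (d k.+1) (d k.+1) <= `|M| * (C1 * pw (- th) k.+1).
    by apply: (le_trans n2); rewrite ler_wpM2l // ler_peMl ?pw_ge0.
  by rewrite /K1 -[K1 * _ * _]mulrA; exact: gradient_bound.
near=> k.
have k2 : (2 <= k)%N by near: k; exact: nbhs_infty_ge.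
have k0 : (0 < k)%N by exact: leq_trans k2.
have [_ g1 _ _ _] : [/\ 0 <= viscosity_gap dot c p x y
      (fun k => F k) (fun k => fine (min_gap f (y k))) k,
      viscosity_gap dot c p x y (fun k => F k) (fun k => fine (min_gap f (y k))) k
        <= M * pw (- th) k,
      dot (d k) (d k) <= M * pw (- th) k,
      pw (- p) k * dot (x k - y k) (x k - y k) <= M * pw (- th) k &
      pw (- (2 * q)) k * dot (x k - y k) (x k - y k) <= M * pw (- th) k] by near: k.
have g2 : M * pw (- th) k <= `|M| * pw (- th) k by rewrite ler_wpM2r ?pw_ge0 // ler_norm.
have g3 : dot (d k) (d k) <= `|M| * pw (- th) k by near: k.
have g4 : dot (u k) (u k) <= K1 * C1 * pw (- th) k by near: k.
have cL : 0 <= c * L by rewrite mulr_ge0 // ltW.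
have KC : 0 <= K1 * C1 by rewrite mulr_ge0.
have th0 := pw_ge0 (- th) k (R := R); have p0 := pw_ge0 (- p) k (R := R).
split.
(* Comparing y_k with the minimizer z0 bounds the regularized optimal value by eps_k |z0|^2 / 2,
   which converts the regularized gap into a bound on f - min f. *)
- have gz := growth _ _ (e0 _ k0) (argmin_fine f_proper z0min); rewrite -/(y k) in gz.
  have fz : fine (min_gap f z0) = 0.
    by rewrite gapE ?subrr //; exact: argmin_fine z0min.
  rewrite fz add0r -/L in gz; move: g1; rewrite /viscosity_gap => g1.
  have h1 : 0 <= eps k / 2 * dot (x k) (x k).
    by rewrite mulr_ge0 ?(dot_ge0 hdot) // divr_ge0 // ltW // e0.
  have h2 : 0 <= eps k / 2 * dot (z0 - y k) (z0 - y k).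
    by rewrite mulr_ge0 ?(dot_ge0 hdot) // divr_ge0 // ltW // e0.
  have m1 : 0 <= c * L * pw (- p) k by rewrite mulr_ge0.
  have h3 : eps k / 2 * L = c * L * pw (- p) k / 2 by ring.
  apply: (le_trans (gap_bound h1 h2 h3 m1 gz (le_trans g1 g2))).
  exact: cross_terms_le.
- apply: (le_trans g3); rewrite ler_wpM2r // -addrA lerDl addr_ge0 //.
- by apply: (le_trans g4); rewrite ler_wpM2r // lerDr addr_ge0.
Unshelve. all: by end_near. Qed.

End algorithm.

Theorem theorem1p1 (R : realType) (H : completeNormedModType R)
  (dot : {dot H for idfun}) (hdot : induces_norm dot)
  (f : H -> \bar R) (f_proper : proper_function f)
  (f_convex : convex_efunction f) (f_lsc : lower_semicontinuous f)
  (f_argmin : argmin f !=set0)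
  (q alpha c p : R) (q_gt0 : 0 < q) (q_lt1 : q < 1)
  (alpha_gt0 : 0 < alpha) (c_gt0 : 0 < c) (p_gt0 : 0 < p)
  (x u : nat -> H)
  (hx : forall k : nat, (1 <= k)%N ->
     x k.+1 = prox 1 f (x k + (1 - alpha / k%:R `^ q) *: (x k - x k.-1)
                        - (c / k%:R `^ p) *: x k))
  (hu : forall k : nat, (2 <= k)%N ->
     x k = (1 - alpha / k.-1%:R `^ q) *: (x k.-1 - x k.-2) - u k
           + (1 - c / k.-1%:R `^ p) *: x k.-1) :
  (forall k : nat, (2 <= k)%N -> subdifferential dot f (x k) (u k)) /\
  (* (i) *)
  (q + 1 < p -> p <= 2 -> (p = 2 -> q * (1 - q) < c) ->
     (exists2 xs : H, argmin f xs & weak_cvg dot x xs) /\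
     (fun k => fine (min_gap f (x k)) : R) =O_\oo
       (fun k => k%:R `^ (- q - 1) : R) /\
     (fun k => `|x k - x k.-1| : R) =O_\oo
       (fun k => k%:R `^ (- ((q + 1) / 2)) : R) /\
     (fun k => `|u k| : R) =o_\oo
       (fun k => k%:R `^ (- ((q + 1) / 2)) : R) /\
     (\sum_(2 <= k <oo) ((k%:R `^ q)%:E * min_gap f (x k)) < +oo)%E /\
     (\sum_(1 <= k <oo) (k%:R * `|x k - x k.-1| ^+ 2)%:E < +oo)%E /\
     (\sum_(2 <= k <oo) (k%:R `^ (q + 1) * `|u k| ^+ 2)%:E < +oo)%E) /\
  (* (ii) *)
  (p = q + 1 -> forall s : R, 1 / 2 < s -> s < (q + 1) / 2 ->
     (fun k => fine (min_gap f (x k)) : R) =o_\oo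
       (fun k => k%:R `^ (- (2 * s)) : R) /\
     (fun k => `|x k - x k.-1| : R) =o_\oo (fun k => k%:R `^ (- s) : R) /\
     (fun k => `|u k| : R) =o_\oo (fun k => k%:R `^ (- s) : R) /\
     (\sum_(2 <= k <oo)
        ((k%:R `^ (2 * s - 1))%:E * min_gap f (x k)) < +oo)%E /\
     (\sum_(1 <= k <oo)
        (k%:R `^ (2 * s - q) * `|x k - x k.-1| ^+ 2)%:E < +oo)%E /\
     (\sum_(2 <= k <oo) (k%:R `^ (2 * s) * `|u k| ^+ 2)%:E < +oo)%E) /\
  (* (iii) *)
  (1 < p -> p < q + 1 ->
     (exists2 xs : H, min_norm (argmin f) = [set xs] &
        (fun k => `|x k - xs| : R) @ \oo --> (0 : R)) /\
     (p <= 2 * q ->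
        (fun k => `|x k - x k.-1| ^+ 2 : R) =O_\oo
          (fun k => k%:R `^ (q - p - 1) : R) /\
        (fun k => `|u k| ^+ 2 : R) =O_\oo
          (fun k => k%:R `^ (q - p - 1) : R) /\
        (fun k => fine (min_gap f (x k)) : R) =O_\oo
          (fun k => k%:R `^ (- p) : R)) /\
     (2 * q < p -> p <= (3 * q + 1) / 2 ->
        (fun k => `|x k - x k.-1| ^+ 2 : R) =O_\oo
          (fun k => k%:R `^ (- q - 1) : R) /\
        (fun k => `|u k| ^+ 2 : R) =O_\oo
          (fun k => k%:R `^ (- q - 1) : R) /\
        (fun k => fine (min_gap f (x k)) : R) =O_\oo
          (fun k => k%:R `^ (- p) : R)) /\
     ((3 * q + 1) / 2 < p ->
        (fun k => `|x k - x k.-1| ^+ 2 : R) =O_\oo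
          (fun k => k%:R `^ (2 * p - 4 * q - 2) : R) /\
        (fun k => `|u k| ^+ 2 : R) =O_\oo
          (fun k => k%:R `^ (2 * p - 4 * q - 2) : R) /\
        (p < (4 * q + 2) / 3 ->
           (fun k => fine (min_gap f (x k)) : R) =O_\oo
             (fun k => k%:R `^ (- p) : R)) /\
        ((4 * q + 2) / 3 <= p ->
           (fun k => fine (min_gap f (x k)) : R) =O_\oo
             (fun k => k%:R `^ (2 * p - 4 * q - 2) : R))) /\
     (2 * q < p ->
        (\sum_(2 <= k <oo) (k%:R `^ (2 * q) * `|u k| ^+ 2)%:E < +oo)%E /\
        (\sum_(1 <= k <oo)
           (k%:R `^ q * `|x k.+1 - x k| ^+ 2)%:E < +oo)%E)).
Proof.
have [z0 z0min] := f_argmin.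
have est r : 1 < p -> r <= q + 1 -> r < p -> 0 < r -> _ :=
  fun p1 => @estimates R H dot hdot f f_proper f_convex f_lsc f_argmin q alpha c p
    q_gt0 q_lt1 alpha_gt0 c_gt0 x u hx hu r z0 p1 z0min.
have gapF k : (2 <= k)%N -> min_gap f (x k) = (fine (min_gap f (x k)))%:E.
  exact: (gap_iterate hdot f_proper f_convex f_lsc f_argmin hx hu).
have F0 k : (2 <= k)%N -> 0 <= fine (min_gap f (x k)).
  exact: (gap_iterate_ge0 hdot f_proper f_convex f_lsc f_argmin hx hu).
have gap_sum r : bsum (fun k => pw r k * fine (min_gap f (x k))) ->
    (\sum_(2 <= k <oo) ((k%:R `^ r)%:E * min_gap f (x k)) < +oo)%E.
  move=> b; apply: (bsum_nneseries b) => k k2; first by rewrite gapF.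
  by rewrite mulr_ge0 ?pw_ge0 ?F0.
have sqr_sum (m : nat) (v : nat -> H) r : bsum (fun k => pw r k * dot (v k) (v k)) ->
    (\sum_(m <= k <oo) (k%:R `^ r * `|v k| ^+ 2)%:E < +oo)%E.
  move=> b; apply: (bsum_nneseries b) => k _; first by rewrite hdot.
  by rewrite mulr_ge0 ?pw_ge0 ?(dot_ge0 hdot).
have sqr_cvg0 (v : nat -> H) s : bsum (fun k => pw (2 * s) k * dot (v k) (v k)) ->
    (fun k => `|v k| : R) =o_\oo (fun k => k%:R `^ (- s) : R).
  move=> b; apply: eqo_pw_sqr.
  have -> : (fun k => pw (2 * s) k * `|v k| ^+ 2) =
      (fun k => pw (2 * s) k * dot (v k) (v k)) by apply/funext => k; rewrite hdot.
  by apply: bsum_cvg0 b _; apply: nearW => k; rewrite mulr_ge0 ?pw_ge0 ?(dot_ge0 hdot).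
have F_normE k : (2 <= k)%N -> `|fine (min_gap f (x k))| = fine (min_gap f (x k)).
  by move=> /F0 h; rewrite ger0_norm.
split; first exact: (subgradient hdot f_proper f_convex f_lsc f_argmin hx hu).
split.
  move=> qp p2 _; have p1 : 1 < p by lra.
  have r0 : 0 < q + 1 by lra.
  have [bF bN bU [M HM]] := est (q + 1) p1 (lexx _) qp r0.
  have s2 : 2 * ((q + 1) / 2) = q + 1 by lra.
  split; first exact: (weak_convergence hdot f_proper f_convex f_lsc f_argmin q_gt0 q_lt1
    alpha_gt0 c_gt0 hx hu qp).
  split.
    apply: (@eqO_pw _ _ _ M); near=> k.
    have k2 : (2 <= k)%N by near: k; exact: nbhs_infty_ge.
    have k0 : (0 < k)%N by exact: leq_trans k2.
    have [h _ _] : [/\ pw (q + 1) k * fine (min_gap f (x k)) <= M,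
        pw (q + 1) k * dot (step x k) (step x k) <= M &
        pw (q + 1 - 1 - q) k * dot (x k.-1 - z0) (x k.-1 - z0) <= M] by near: k.
    have -> : - q - 1 = - (q + 1) by rewrite opprD.
    by rewrite F_normE // pwN ler_pdivlMr ?pw_gt0 // mulrC.
  split.
    apply: (@eqO_pw_sqr _ _ (step x) _ M); near=> k.
    have [_ h _] : [/\ pw (q + 1) k * fine (min_gap f (x k)) <= M,
        pw (q + 1) k * dot (step x k) (step x k) <= M &
        pw (q + 1 - 1 - q) k * dot (x k.-1 - z0) (x k.-1 - z0) <= M] by near: k.
    by rewrite s2 -hdot.
  split; first by apply: sqr_cvg0; rewrite s2.
  split; first by apply: gap_sum; rewrite addrK in bF.
  split; last exact: sqr_sum.
  rewrite [q + 1]addrC addrK in bN; have := sqr_sum 1%N (step x) 1 bN.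
  by under eq_eseriesr do rewrite powRr1 //.
split.
  move=> pE s s1 s2; have p1 : 1 < p by lra.
  have r1 : 2 * s <= q + 1 by lra.
  have r2 : 2 * s < p by lra.
  have r3 : 0 < 2 * s by lra.
  have [bF bN bU _] := est (2 * s) p1 r1 r2 r3.
  (* An exponent strictly between 2 s and q + 1: the O estimate at m gives the o estimate at 2 s. *)
  have [m [sm mp mq m0]] : exists m, [/\ 2 * s < m, m < p, m <= q + 1 & 0 < m].
    by exists (s + (q + 1) / 2); split; lra.
  have [_ _ _ [M HM]] := est m p1 mq mp m0.
  split.
    apply: (@eqo_pw_lt _ _ _ (- m) M); first by lra.
    near=> k; have k2 : (2 <= k)%N by near: k; exact: nbhs_infty_ge.
    have k0 : (0 < k)%N by exact: leq_trans k2.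
    have [h _ _] : [/\ pw m k * fine (min_gap f (x k)) <= M,
        pw m k * dot (step x k) (step x k) <= M &
        pw (m - 1 - q) k * dot (x k.-1 - z0) (x k.-1 - z0) <= M] by near: k.
    by rewrite F_normE // pwN ler_pdivlMr ?pw_gt0 // mulrC.
  split.
    apply: (@eqo_pw_lt _ _ _ (- (m / 2)) (`|M| + 1)); first by lra.
    near=> k; have k2 : (2 <= k)%N by near: k; exact: nbhs_infty_ge.
    have k0 : (0 < k)%N by exact: leq_trans k2.
    have [_ h _] : [/\ pw m k * fine (min_gap f (x k)) <= M,
        pw m k * dot (step x k) (step x k) <= M &
        pw (m - 1 - q) k * dot (x k.-1 - z0) (x k.-1 - z0) <= M] by near: k.
    have M1 : 0 <= `|M| + 1 by rewrite addr_ge0.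
    rewrite normr_id pwN ler_pdivlMr ?pw_gt0 // mulrC.
    rewrite -(@ler_pXn2r _ 2) ?nnegrE ?mulr_ge0 ?pw_ge0 //.
    rewrite exprMn -pwX2 (_ : 2 * (m / 2) = m); last by lra.
    rewrite -hdot (le_trans h) // (le_trans (ler_norm _)) //.
    by have := sqr_ge0 `|M|; rewrite !expr2; lra.
  split; first exact: sqr_cvg0.
  split; first exact: gap_sum.
  by split; [exact: sqr_sum|exact: sqr_sum].
move=> p1 pq.
have strong om th := @strong_convergence R H dot hdot f f_proper f_convex f_lsc f_argmin
  q alpha c p q_gt0 q_lt1 alpha_gt0 c_gt0 x u hx hu om th p1 pq.
have rates th M r r' : - th <= r -> - p <= r' -> - th <= r' ->
  (\forall k \near \oo, [/\ fine (min_gap f (x k)) <= M * (pw (- p) k + pw (- th) k),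
    dot (step x k) (step x k) <= M * pw (- th) k & dot (u k) (u k) <= M * pw (- th) k]) ->
  [/\ (fun k => `|x k - x k.-1| ^+ 2 : R) =O_\oo (fun k => k%:R `^ r : R),
    (fun k => `|u k| ^+ 2 : R) =O_\oo (fun k => k%:R `^ r : R) &
    (fun k => fine (min_gap f (x k)) : R) =O_\oo (fun k => k%:R `^ r' : R)].
  move=> hr hp hth HM.
  split; [apply: (@eqO_pw _ _ _ `|M|)|apply: (@eqO_pw _ _ _ `|M|)
    |apply: (@eqO_pw _ _ _ (2 * `|M|))]; near=> k;
    have k2 : (2 <= k)%N by [near: k; exact: nbhs_infty_ge];
    have k0 : (0 < k)%N by [exact: leq_trans k2];
    have [h1 h2 h3] : [/\ fine (min_gap f (x k)) <= M * (pw (- p) k + pw (- th) k),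
      dot (step x k) (step x k) <= M * pw (- th) k & dot (u k) (u k) <= M * pw (- th) k]
      by near: k.
  - have := pw_le k0 hr (R := R) => /(ler_wpM2l (normr_ge0 M)) h.
    rewrite ger0_norm ?sqr_ge0 // -hdot (le_trans h2) // (le_trans _ h) //.
    by rewrite ler_wpM2r ?pw_ge0 // ler_norm.
  - have := pw_le k0 hr (R := R) => /(ler_wpM2l (normr_ge0 M)) h.
    rewrite ger0_norm ?sqr_ge0 // -hdot (le_trans h3) // (le_trans _ h) //.
    by rewrite ler_wpM2r ?pw_ge0 // ler_norm.
  - rewrite F_normE // (le_trans h1) //.
    apply: (@le_trans _ _ (`|M| * (pw (- p) k + pw (- th) k))).
      by rewrite ler_wpM2r ?addr_ge0 ?pw_ge0 // ler_norm.
    rewrite [2 * _]mulrC -mulrA ler_wpM2l // [2 * _]mulr_natl mulr2n.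
    by rewrite lerD // pw_le.
have cases : [\/ p <= 2 * q, 2 * q < p /\ p <= (3 * q + 1) / 2 | (3 * q + 1) / 2 < p].
  have [h|h] := leP p (2 * q); first by constructor 1.
  by have [h'|h'] := leP p ((3 * q + 1) / 2); [constructor 2|constructor 3].
(* In each regime om = max(q, p - q), and th is the largest admissible value: th + om is p + 1 in
   the first two regimes, and 3 q + 2 - p when p > (3 q + 1) / 2. *)
have strong1 (h : p <= 2 * q) := strong q (p + 1 - q)
  ltac:(lra) ltac:(lra) ltac:(lra) ltac:(lra) ltac:(lra) ltac:(lra) ltac:(lra) ltac:(by left; lra).
have strong2 (h : 2 * q < p) (h' : p <= (3 * q + 1) / 2) := strong (p - q) (q + 1)
  ltac:(lra) ltac:(lra) ltac:(lra) ltac:(lra) ltac:(lra) ltac:(lra) ltac:(lra) ltac:(by right; lra).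
have strong3 (h : (3 * q + 1) / 2 < p) := strong (p - q) (4 * q + 2 - 2 * p)
  ltac:(lra) ltac:(lra) ltac:(lra) ltac:(lra) ltac:(lra) ltac:(lra) ltac:(lra) ltac:(by right; lra).
split.
  case: cases => [h|[h h']|h].
  - by case: (strong1 h).
  - by case: (strong2 h h').
  - by case: (strong3 h).
split.
  move=> h.
  case: (strong1 h) => _ [M HM].
  have [] := rates (p + 1 - q) M (q - p - 1) (- p) ltac:(lra) ltac:(lra) ltac:(lra) HM.
  by split.
split.
  move=> h h'.
  case: (strong2 h h') => _ [M HM].
  have [] := rates (q + 1) M (- q - 1) (- p) ltac:(lra) ltac:(lra) ltac:(lra) HM.
  by split.
split.
  move=> h.
  case: (strong3 h) => _ [M HM].
  have h1 : - (4 * q + 2 - 2 * p) <= 2 * p - 4 * q - 2 by lra.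
  (* The maximum serves both subcases; its entries coincide exactly at p = (4 q + 2) / 3. *)
  have h2 : - p <= Num.max (- p) (2 * p - 4 * q - 2) by rewrite le_max lexx.
  have h3 : - (4 * q + 2 - 2 * p) <= Num.max (- p) (2 * p - 4 * q - 2).
    by rewrite le_max h1 orbT.
  have [r1 r2 r3] := rates _ M _ _ h1 h2 h3 HM.
  split => //; split => //; split => h4.
    by move: r3; rewrite max_l //; lra.
  by move: r3; rewrite max_r //; lra.
(* The weighted estimates with the fixed minimizer z0 apply here at r = 2 q, since 2 q < p, and give
   the kinetic weight k^(r-q) = k^q. *)
move=> h; have r1 : 2 * q <= q + 1 by lra.
have r2 : 0 < 2 * q by lra.
have [_ bN bU _] := est (2 * q) p1 r1 h r2.
split; first exact: sqr_sum.
apply: (sqr_sum 1%N (fun k => step x k.+1)).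
apply: bsum_near (bsumS bN); apply: nearW => k.
rewrite ler_wpM2r ?(dot_ge0 hdot) // (_ : 2 * q - q = q); last by lra.
by apply: pw_mono => //; exact: ltW.
Unshelve. all: by end_near. Qed.
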